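(* Let $k$ be an algebraically closed field of characteristic zero and let $n\ge 2$. Let $P_{n,\tau}=\mathrm{PGL}_n\rtimes\langle\tau\rangle$, where $\tau$ has order two and acts on $\mathrm{PGL}_n$ by $\tau(h)=(h^{-1})^t$. Let $A$ be a central simple algebra of degree $n$ (whose center is a finitely generated field extension of $k$) with involution $\sigma$. Then there is an irreducible $P_{n,\tau}$-variety $X$ which is generically free as a $\mathrm{PGL}_n$-variety such that $(A,\sigma)$ and $(k_n(X),\sigma_{X,\tau})$ are isomorphic as algebras with involution.
   Context: Conventions: A central simple algebra is a simple $k$-algebra that is finite-dimensional over its center, such that the center is a finitely generated field extension of $k$; it has degree $n$ if its dimension over its center is $n^2$. All algebra homomorphisms and involutions are $k$-linear; an involution is an anti-automorphism $\sigma$ with $\sigma^2=\mathrm{id}$. $a^t$ denotes the transpose of a matrix $a$, and for $h\in\mathrm{PGL}_n$, $h^t$ denotes the class of the transpose of a matrix representing $h$. $\mathrm{PGL}_n$ is identified with the subgroup $\mathrm{PGL}_n\times 1$ of $P_{n,\tau}$. ''In general position'' means in some dense open subset. A $G$-variety is generically free if points in general position have trivial stabilizer in $G$. For an irreducible, generically free $\mathrm{PGL}_n$-variety $X$, $k_n(X)$ denotes the set of $\mathrm{PGL}_n$-equivariant rational maps $X\dashrightarrow \mathrm{M}_n=\mathrm{M}_n(k)$ ($\mathrm{PGL}_n$ acting on $\mathrm{M}_n$ by conjugation), with pointwise addition and multiplication; it is a central simple algebra of degree $n$ (known fact). If $X$ is an irreducible $P_{n,\tau}$-variety which is generically free as a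 $\mathrm{PGL}_n$-variety, $\sigma_{X,\tau}$ is the involution of $k_n(X)$ given by $\sigma_{X,\tau}(f)(x)=f(\tau x)^t$ for $x\in X$ in general position. *)

(* Defs.v *)
From HB Require Import structures.
From mathcomp Require Import all_boot all_order all_algebra.
From mathcomp Require Import all_classical topology.
From mathcomp.multinomials Require Import mpoly.

Set Implicit Arguments.
Unset Strict Implicit.
Unset Printing Implicit Defensive.

Import GRing.Theory.

Local Open Scope classical_set_scope.
Local Open Scope ring_scope.
Local Open Scope quotient_scope.

(** A variety over the algebraically closed field [k] is a topological space
    with a sheaf of [k]-valued functions (Serre's definition): it has a finite
    cover by open sets isomorphic to Zariski closed subsets of affine spaces,
    and its diagonal is closed.

    The sheaf is given by its germs: [regular_at x f] says that [f] is regular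
    on some neighbourhood of [x], so that the sections over an open set [U] are
    the [f] with [regular_on U f]; the values of [f] outside [U] are junk. *)

HB.mixin Record hasRegular (k : closedFieldType) T & Topological T := {
  regular_at : T -> (T -> k) -> Prop
}.

#[short(type="regSpaceType")]
HB.structure Definition RegSpace (k : closedFieldType) :=
  {T of Topological T & hasRegular k T}.

#[short(type="regGroupType")]
HB.structure Definition RegGroup (k : closedFieldType) :=
  {T of RegSpace k T & Group T}.

Definition regular_on (k : closedFieldType) (X : regSpaceType k)
    (U : set X) (f : X -> k) : Prop :=
  forall x, U x -> regular_at x f.

Definition morphism (k : closedFieldType) (X Y : regSpaceType k)
    (f : X -> Y) : Prop :=
  continuous f /\
  forall (x : X) (g : Y -> k), regular_at (f x) g -> regular_at x (g \o f).

(** Topology and regular functions induced on a set [D] by coordinates [phi].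
    It suffices to test on principal open sets [q != 0]: if [f = p / q] holds
    only on the smaller principal open set [q r != 0], then [f = pr / qr]
    there. *)
Section Coordinates.
Variables (k : closedFieldType) (T : Type) (m : nat).
Variables (D : set T) (phi : T -> 'I_m -> k).

Definition zopen (W : set T) : Prop :=
  forall x, W x -> exists2 q : {mpoly k[m]}, q.@[phi x] != 0 &
    forall y, D y -> q.@[phi y] != 0 -> W y.

Definition zregular (x : T) (f : T -> k) : Prop :=
  exists p q : {mpoly k[m]}, q.@[phi x] != 0 /\
    forall y, D y -> q.@[phi y] != 0 -> f y = p.@[phi y] / q.@[phi y].

Lemma zopenT : zopen setT.
Proof.
by move=> x _; exists 1 => //; rewrite rmorph1 oner_neq0.
Qed.

Lemma zopenI : setI_closed zopen.
Proof.
move=> A B oA oB x [/oA[p px pA] /oB[q qx qB]].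
exists (p * q); first by rewrite rmorphM mulf_neq0.
move=> y Dy; rewrite rmorphM mulf_eq0 negb_or => /andP[py qy].
by split; [exact: pA | exact: qB].
Qed.

Lemma zopen_bigU (I : Type) (W : I -> set T) :
  (forall i, zopen (W i)) -> zopen (\bigcup_i W i).
Proof.
move=> oW x [i _ /oW[q qx qW]]; exists q => // y Dy qy.
by exists i => //; exact: qW.
Qed.

End Coordinates.

Definition zariski_closed (k : closedFieldType) (m : nat)
    (V : set ('I_m -> k)) : Prop :=
  exists S : set {mpoly k[m]}, V = [set v | forall p, S p -> p.@[v] = 0].

Definition affine_chart (k : closedFieldType) (X : regSpaceType k)
    (U : set X) (m : nat) (phi : X -> 'I_m -> k) : Prop :=
  [/\ open U, set_inj U phi, zariski_closed (phi @` U),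
      forall W : set X, W `<=` U -> (open W <-> zopen U phi W) &
      forall x f, U x -> (regular_at x f <-> zregular U phi x f)].

(** The product of two varieties is _not_ given the product topology: the open
    sets are generated by the [U * V] and by the nonvanishing loci of the
    functions [\sum_i a_i(x) b_i(y)], and a function is regular when it is
    locally a quotient of two functions of this form. *)

Definition zprod (k : closedFieldType) (X Y : regSpaceType k) : Type :=
  (X * Y)%type.

Section Product.
Variables (k : closedFieldType) (X Y : regSpaceType k).

Definition tensor (U : set X) (V : set Y) : set (X * Y -> k) :=
  [set t | exists (r : nat) (a : 'I_r -> X -> k) (b : 'I_r -> Y -> k),
    [/\ forall i, regular_on U (a i), forall i, regular_on V (b i) &
        t = fun z => \sum_i a i z.1 * b i z.2]].

Definition zprod_open (W : set (X * Y)) : Prop :=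
  forall z, W z -> exists (U : set X) (V : set Y) (ts : seq (X * Y -> k)),
    [/\ open U /\ U z.1, open V /\ V z.2,
        forall t, t \in ts -> tensor U V t /\ t z != 0 &
        forall w, U w.1 -> V w.2 -> (forall t, t \in ts -> t w != 0) -> W w].

Definition zprod_regular_at (z : X * Y) (f : X * Y -> k) : Prop :=
  exists (U : set X) (V : set Y) (s t : X * Y -> k),
    [/\ open U /\ U z.1, open V /\ V z.2, tensor U V s, tensor U V t /\ t z != 0 &
        forall w, U w.1 -> V w.2 -> t w != 0 -> f w = s w / t w].

Lemma tensorS (U U' : set X) (V V' : set Y) :
  U' `<=` U -> V' `<=` V -> tensor U V `<=` tensor U' V'.
Proof.
move=> UU VV t [r [a [b [ha hb ->]]]]; exists r, a, b; split=> // i x.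
  by move=> /UU; exact: ha.
by move=> /VV; exact: hb.
Qed.

Fact zprod_openT : zprod_open setT.
Proof.
move=> z _; exists setT, setT, [::]; split=> //; split=> //; exact: openT.
Qed.

Fact zprod_openI : setI_closed zprod_open.
Proof.
move=> A B oA oB z [/oA[U [V [ts [[oU Uz] [oV Vz] hts hA]]]]].
move=> /oB[U' [V' [ts' [[oU' Uz'] [oV' Vz'] hts' hB]]]].
exists (U `&` U'), (V `&` V'), (ts ++ ts'); split.
- by split=> //; exact: openI.
- by split=> //; exact: openI.
- move=> t; rewrite mem_cat => /orP[/hts|/hts'] [tt tz]; split=> //.
    by apply: tensorS tt => // ? [].
  by apply: tensorS tt => // ? [].
- move=> w [Uw Uw'] [Vw Vw'] tw; split.
    by apply: hA => // t tts; apply: tw; rewrite mem_cat tts.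
  by apply: hB => // t tts; apply: tw; rewrite mem_cat tts orbT.
Qed.

Fact zprod_open_bigU (I : Type) (W : I -> set (X * Y)) :
  (forall i, zprod_open (W i)) -> zprod_open (\bigcup_i W i).
Proof.
move=> oW z [i _ /oW[U [V [ts [hU hV hts h]]]]]; exists U, V, ts; split=> //.
by move=> w Uw Vw tw; exists i => //; exact: h.
Qed.

HB.instance Definition _ := Choice.copy (zprod X Y) (X * Y)%type.
HB.instance Definition _ := isOpenTopological.Build (zprod X Y)
  zprod_openT zprod_openI zprod_open_bigU.
HB.instance Definition _ := hasRegular.Build k (zprod X Y) zprod_regular_at.

End Product.

Definition is_variety (k : closedFieldType) (X : regSpaceType k) : Prop :=
  (exists (r : nat) (U : 'I_r -> set X) (m : 'I_r -> nat)
      (phi : forall i, X -> 'I_(m i) -> k),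
    (forall i, affine_chart (U i) (phi i)) /\ (forall x, exists i, U i x)) /\
  closed [set z : zprod X X | z.1 = z.2].

Definition irreducible (T : topologicalType) : Prop :=
  [set: T] !=set0 /\
  forall A B : set T, closed A -> closed B -> A `|` B = setT ->
    A = setT \/ B = setT.

(** [P x] holds for [x] in general position. *)
Definition generically (T : topologicalType) (P : T -> Prop) : Prop :=
  exists U : set T, [/\ open U, dense U & forall x, U x -> P x].

Lemma generically_and (T : topologicalType) (P Q : T -> Prop) :
  generically P -> generically Q -> generically (fun x => P x /\ Q x).
Proof.
move=> [U [oU dU hU]] [V [oV dV hV]]; exists (U `&` V); split.
- exact: openI.
- move=> O O0 oO; rewrite setIA; apply: dV; first exact: dU.
  exact: openI.
- by move=> x [/hU ? /hV].
Qed.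

Lemma generically_imp (T : topologicalType) (P Q : T -> Prop) :
  (forall x, P x -> Q x) -> generically P -> generically Q.
Proof. by move=> PQ [U [oU dU hU]]; exists U; split=> // x /hU /PQ. Qed.

Lemma generically_all (T : topologicalType) (P : T -> Prop) :
  (forall x, P x) -> generically P.
Proof.
move=> h; exists setT; split=> //; first exact: openT.
by move=> O O0 oO; rewrite setIT.
Qed.

Record gVariety (k : closedFieldType) (G : regGroupType k) := GVariety {
  gspace :> regSpaceType k;
  gspaceP : is_variety gspace;
  act : G -> gspace -> gspace;
  act1 : forall x, act 1%g x = x;
  actM : forall g h x, act (g * h)%g x = act g (act h x);
  act_morphism : morphism (fun z : zprod G gspace => act z.1 z.2)
}.

Definition GL (k : closedFieldType) (n : nat) : Type :=
  {h : 'M[k]_n | h \in unitmx}.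

Section GL.
Variables (k : closedFieldType) (n : nat).

Definition GL_coord (h : GL k n) : 'I_(n * n) -> k := mxvec (val h) 0.

HB.instance Definition _ := Choice.copy (GL k n) {h : 'M[k]_n | h \in unitmx}.
HB.instance Definition _ := SubType.copy (GL k n) {h : 'M[k]_n | h \in unitmx}.
HB.instance Definition _ := isOpenTopological.Build (GL k n)
  (zopenT setT GL_coord) (@zopenI _ _ _ setT GL_coord)
  (@zopen_bigU _ _ _ setT GL_coord).
HB.instance Definition _ :=
  hasRegular.Build k (GL k n) (zregular setT GL_coord).

Definition proportional (g h : GL k n) : bool :=
  `[< exists2 c : k, c != 0 & val g = c *: val h >].

Fact proportional_refl : reflexive proportional.
Proof. by move=> g; apply/asboolP; exists 1; rewrite ?oner_neq0 ?scale1r. Qed.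

Fact proportional_sym : ssrbool.symmetric proportional.
Proof.
have H g h : proportional g h -> proportional h g.
  move=> /asboolP[c c0 e]; apply/asboolP; exists c^-1; rewrite ?invr_eq0 //.
  by rewrite e scalerA mulVf // scale1r.
by move=> g h; apply/idP/idP; exact: H.
Qed.

Fact proportional_trans : transitive proportional.
Proof.
move=> h g l /asboolP[c c0 e] /asboolP[d d0 e']; apply/asboolP.
by exists (c * d); rewrite ?mulf_neq0 // e e' scalerA.
Qed.

Canonical proportional_equiv :=
  EquivRel proportional proportional_refl proportional_sym proportional_trans.

Definition GL1 : GL k n := exist _ 1%:M (unitmx1 k n).

Fact GL_mul_subproof (g h : GL k n) : val g *m val h \in unitmx.
Proof. by rewrite unitmx_mul (valP g) (valP h). Qed.
Definition GL_mul (g h : GL k n) : GL k n :=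
  exist _ (val g *m val h) (GL_mul_subproof g h).

Fact GL_inv_subproof (g : GL k n) : invmx (val g) \in unitmx.
Proof. by rewrite unitmx_inv (valP g). Qed.
Definition GL_inv (g : GL k n) : GL k n :=
  exist _ (invmx (val g)) (GL_inv_subproof g).

Fact GL_contra_subproof (g : GL k n) : (invmx (val g))^T \in unitmx.
Proof. by rewrite unitmx_tr unitmx_inv (valP g). Qed.
Definition GL_contra (g : GL k n) : GL k n :=
  exist _ (invmx (val g))^T (GL_contra_subproof g).

End GL.

Definition PGL (k : closedFieldType) (n : nat) : Type :=
  {eq_quot @proportional_equiv k n}.

Section PGL.
Variables (k : closedFieldType) (n : nat).
Local Notation PGLn := (PGL k n).
Local Notation cl := (\pi_PGLn).

HB.instance Definition _ := Choice.copy PGLn {eq_quot @proportional_equiv k n}.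
HB.instance Definition _ :=
  EqQuotient.copy PGLn {eq_quot @proportional_equiv k n}.

Lemma PGL_eqP (g h : GL k n) :
  reflect (exists2 c : k, c != 0 & val g = c *: val h)
    (cl g == cl h).
Proof. by rewrite eqmodE; apply: asboolP. Qed.

Lemma PGL_repr (g : GL k n) :
  exists2 c : k, c != 0 & val (repr (cl g)) = c *: val g.
Proof. by apply/PGL_eqP; rewrite reprK. Qed.

Lemma invmxZ (c : k) (a : 'M[k]_n) : c != 0 -> a \in unitmx ->
  invmx (c *: a) = c^-1 *: invmx a.
Proof.
move=> c0 ua; have uc : c *: a \in unitmx by rewrite unitmxZ // unitfE.
apply: (can_inj (mulKmx uc)); rewrite mulmxV // -scalemxAl -scalemxAr scalerA.
by rewrite mulfV // scale1r mulmxV.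
Qed.

Definition PGL1 : PGLn := cl (GL1 k n).
Definition PGL_mul (g h : PGLn) : PGLn := cl (GL_mul (repr g) (repr h)).
Definition PGL_inv (g : PGLn) : PGLn := cl (GL_inv (repr g)).

Definition PGL_contra (g : PGLn) : PGLn := cl (GL_contra (repr g)).

Lemma PGL_mulE (g h : GL k n) :
  PGL_mul (cl g) (cl h) = cl (GL_mul g h).
Proof.
have [c c0 eg] := PGL_repr g; have [d d0 eh] := PGL_repr h.
apply/eqP/PGL_eqP; exists (c * d); first by rewrite mulf_neq0.
by rewrite /= eg eh -scalemxAl -scalemxAr scalerA.
Qed.

Lemma PGL_invE (g : GL k n) : PGL_inv (cl g) = cl (GL_inv g).
Proof.
have [c c0 eg] := PGL_repr g; apply/eqP/PGL_eqP.
by exists c^-1; rewrite ?invr_eq0 //= eg invmxZ // (valP g).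
Qed.

Lemma PGL_contraE (g : GL k n) : PGL_contra (cl g) = cl (GL_contra g).
Proof.
have [c c0 eg] := PGL_repr g; apply/eqP/PGL_eqP.
by exists c^-1; rewrite ?invr_eq0 //= eg invmxZ ?(valP g) // linearZ.
Qed.

Fact PGL_mulA : associative PGL_mul.
Proof.
elim/quotW=> a; elim/quotW=> b; elim/quotW=> c.
rewrite (PGL_mulE b c) (PGL_mulE a b) !PGL_mulE.
by congr (cl _); apply: val_inj; rewrite /= mulmxA.
Qed.

Fact PGL_mul1 : left_id PGL1 PGL_mul.
Proof.
elim/quotW=> a; rewrite PGL_mulE.
by congr (cl _); apply: val_inj; rewrite /= mul1mx.
Qed.

Fact PGL_mulr1 : right_id PGL1 PGL_mul.
Proof.
elim/quotW=> a; rewrite PGL_mulE.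
by congr (cl _); apply: val_inj; rewrite /= mulmx1.
Qed.

Fact PGL_mulV : left_inverse PGL1 PGL_inv PGL_mul.
Proof.
elim/quotW=> a; rewrite PGL_invE PGL_mulE.
by congr (cl _); apply: val_inj; rewrite /= mulVmx // (valP a).
Qed.

Fact PGL_mulrV : right_inverse PGL1 PGL_inv PGL_mul.
Proof.
elim/quotW=> a; rewrite PGL_invE PGL_mulE.
by congr (cl _); apply: val_inj; rewrite /= mulmxV // (valP a).
Qed.

HB.instance Definition _ := isGroup.Build PGLn
  PGL_mulA PGL_mul1 PGL_mulr1 PGL_mulV PGL_mulrV.

Lemma PGL_contraM : {morph PGL_contra : g h / (g * h)%g}.
Proof.
elim/quotW=> a; elim/quotW=> b.
rewrite [(_ * _)%g]PGL_mulE !PGL_contraE [RHS]PGL_mulE.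
congr (cl _); apply: val_inj => /=; rewrite -trmx_mul; congr (_^T).
have ua := valP a; have ub := valP b.
have uab : val a *m val b \in unitmx by rewrite unitmx_mul ua ub.
apply: (can_inj (mulKmx uab)); rewrite mulmxV // -mulmxA (mulmxA (val b)).
by rewrite mulmxV // mul1mx mulmxV.
Qed.

Lemma PGL_contraK : involutive PGL_contra.
Proof.
elim/quotW=> a; rewrite (PGL_contraE a) PGL_contraE; congr (cl _); apply: val_inj => /=.
by rewrite -trmx_inv trmxK invmxK.
Qed.

Lemma PGL_contra1 : PGL_contra 1%g = 1%g.
Proof.
rewrite [LHS]PGL_contraE; congr (cl _); apply: val_inj => /=.
by rewrite invmx1 trmx1.
Qed.

(** [PGL_n] carries the structure of the quotient of the variety [GL_n]: open
    sets and regular functions are those that pull back to such on [GL_n]. *)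
Definition PGL_open (W : set PGLn) : Prop :=
  open ((fun h : GL k n => cl h) @^-1` W).

Fact PGL_openT : PGL_open setT.
Proof. by rewrite /PGL_open preimage_setT; exact: openT. Qed.
Fact PGL_openI : setI_closed PGL_open.
Proof. by move=> A B oA oB; exact: openI. Qed.
Fact PGL_open_bigU (I : Type) (W : I -> set PGLn) :
  (forall i, PGL_open (W i)) -> PGL_open (\bigcup_i W i).
Proof. by move=> oW; apply: bigcup_open => i _; exact: oW. Qed.

HB.instance Definition _ := isOpenTopological.Build PGLn
  PGL_openT PGL_openI PGL_open_bigU.

Definition PGL_regular_at (g : PGLn) (f : PGLn -> k) : Prop :=
  exists W : set PGLn, [/\ open W, W g &
    forall h : GL k n, W (cl h) -> regular_at h (fun h' => f (cl h'))].

HB.instance Definition _ := hasRegular.Build k PGLn PGL_regular_at.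

Definition PGL_conj (g : PGLn) (a : 'M[k]_n) : 'M[k]_n :=
  val (repr g) *m a *m invmx (val (repr g)).

Lemma PGL_conjE (g : GL k n) (a : 'M[k]_n) :
  PGL_conj (cl g) a = val g *m a *m invmx (val g).
Proof.
have [c c0 eg] := PGL_repr g.
rewrite /PGL_conj eg invmxZ ?(valP g) // -!scalemxAl -scalemxAr scalerA.
by rewrite mulfV // scale1r.
Qed.

Lemma PGL_conj_contra (g : PGLn) (a : 'M[k]_n) :
  (PGL_conj (PGL_contra g) a)^T = PGL_conj g a^T.
Proof.
elim/quotW: g => g; rewrite PGL_contraE !PGL_conjE /= !trmx_mul -trmx_inv invmxK.
by rewrite !trmxK mulmxA.
Qed.

Lemma PGL_conj1 g : PGL_conj g 1 = 1.
Proof. by rewrite /PGL_conj mulmx1 mulmxV // (valP (repr g)). Qed.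

Lemma PGL_conjB g : {morph PGL_conj g : a b / a - b}.
Proof. by move=> a b; rewrite /PGL_conj mulmxBr mulmxBl. Qed.

Lemma PGL_conjM g : {morph PGL_conj g : a b / a * b}.
Proof.
move=> a b; rewrite /PGL_conj; set h := val _.
rewrite -[_ * (h *m b *m _)]/((h *m a *m invmx h) *m (h *m b *m invmx h)).
by rewrite !mulmxA mulmxKV // (valP (repr g)).
Qed.

Lemma PGL_conjZ g (c : k) a : PGL_conj g (c *: a) = c *: PGL_conj g a.
Proof. by rewrite /PGL_conj -scalemxAr -scalemxAl. Qed.

End PGL.

(** The pair [(g, b)] stands for [g * tau ^ b]. *)
Definition Ptau (k : closedFieldType) (n : nat) : Type := (PGL k n * bool)%type.

Section Ptau.
Variables (k : closedFieldType) (n : nat).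
Local Notation P := (Ptau k n).

Definition tau_pow (b : bool) (g : PGL k n) : PGL k n :=
  if b then PGL_contra g else g.

Definition Ptau_one : P := (1%g, false).
Definition Ptau_mul (x y : P) : P := ((x.1 * tau_pow x.2 y.1)%g, x.2 (+) y.2).
Definition Ptau_inv (x : P) : P := (tau_pow x.2 (x.1^-1)%g, x.2).

Fact tau_powM b : {morph tau_pow b : g h / (g * h)%g}.
Proof. by case: b => // g h; exact: PGL_contraM. Qed.
Fact tau_powD b c g : tau_pow b (tau_pow c g) = tau_pow (b (+) c) g.
Proof. by case: b c => [] [] //=; rewrite PGL_contraK. Qed.
Fact tau_pow1 b : tau_pow b 1%g = 1%g.
Proof. by case: b => //; exact: PGL_contra1. Qed.

Fact Ptau_mulA : associative Ptau_mul.
Proof.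
move=> [g a] [h b] [l c]; rewrite /Ptau_mul /= tau_powM tau_powD mulgA.
by rewrite addbA.
Qed.
Fact Ptau_mul1 : left_id Ptau_one Ptau_mul.
Proof. by move=> [g b]; rewrite /Ptau_mul /= mul1g. Qed.
Fact Ptau_mulr1 : right_id Ptau_one Ptau_mul.
Proof. by move=> [g b]; rewrite /Ptau_mul /= tau_pow1 mulg1 addbF. Qed.
Fact Ptau_mulV : left_inverse Ptau_one Ptau_inv Ptau_mul.
Proof.
by move=> [g b]; rewrite /Ptau_mul /= -tau_powM mulVg tau_pow1 addbb.
Qed.
Fact Ptau_mulrV : right_inverse Ptau_one Ptau_inv Ptau_mul.
Proof.
by move=> [g b]; rewrite /Ptau_mul /= tau_powD addbb /= mulgV.
Qed.

(** As [bool] is discrete, the product topology is the disjoint union of two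
    copies of [PGL_n]. *)
HB.instance Definition _ := Topological.copy P (PGL k n * bool)%type.
HB.instance Definition _ := isGroup.Build P
  Ptau_mulA Ptau_mul1 Ptau_mulr1 Ptau_mulV Ptau_mulrV.
HB.instance Definition _ := hasRegular.Build k P
  (fun x f => regular_at x.1 (fun g => f (g, x.2))).

Definition inPGL (g : PGL k n) : P := (g, false).
Definition tau : P := (1%g, true).

Lemma tau_inPGL (g : PGL k n) : (tau * inPGL g)%g = (inPGL (PGL_contra g) * tau)%g.
Proof. by congr pair => /=; rewrite mul1g mulg1. Qed.

End Ptau.
Arguments tau {k n}.

Section RegularFunctions.
Variables (k : closedFieldType) (X : regSpaceType k) (XP : is_variety X).

Let chartP (x : X) : exists (U : set X) (m : nat) (phi : X -> 'I_m -> k),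
  affine_chart U phi /\ U x.
Proof.
have [[r [U [m [phi [ch cov]]]]] _] := XP.
by have [i Ux] := cov x; exists (U i), (m i), (phi i).
Qed.

Lemma regular_at_germ (x : X) (f g : X -> k) (W : set X) :
  open W -> W x -> (forall y, W y -> f y = g y) ->
  regular_at x f -> regular_at x g.
Proof.
move=> oW Wx fg; have [U [m [phi [[oU _ _ hop hreg] Ux]]]] := chartP x.
move=> /(hreg x f Ux)[p [q [qx pq]]]; apply/(hreg x g Ux).
have UW : W `&` U `<=` U by move=> ? [].
have /(hop _ UW)/(_ x (conj Wx Ux)) : open (W `&` U) by exact: openI.
move=> [r rx rW]; exists (p * r), (q * r); split.
  by rewrite rmorphM mulf_neq0.
move=> y Uy; rewrite !rmorphM mulf_eq0 negb_or => /andP[qy ry].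
have [Wy _] := rW y Uy ry.
by rewrite -fg // pq // -mulf_div divff // mulr1.
Qed.

Lemma regular_at_cst (x : X) (c : k) : regular_at x (fun=> c).
Proof.
have [U [m [phi [[oU _ _ hop hreg] Ux]]]] := chartP x.
apply/(hreg x _ Ux); exists c%:MP, 1; split; first by rewrite rmorph1 oner_neq0.
by move=> y _ _; rewrite mevalC rmorph1 divr1.
Qed.

Lemma regular_atD (x : X) (f g : X -> k) :
  regular_at x f -> regular_at x g -> regular_at x (fun y => f y + g y).
Proof.
have [U [m [phi [[oU _ _ hop hreg] Ux]]]] := chartP x.
move=> /(hreg x _ Ux)[p [q [qx pq]]] /(hreg x _ Ux)[p' [q' [qx' pq']]].
apply/(hreg x _ Ux); exists (p * q' + p' * q), (q * q'); split.
  by rewrite rmorphM mulf_neq0.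
move=> y Uy; rewrite rmorphM mulf_eq0 negb_or => /andP[qy qy'].
by rewrite pq // pq' // addf_div // rmorphD !rmorphM.
Qed.

Lemma regular_atM (x : X) (f g : X -> k) :
  regular_at x f -> regular_at x g -> regular_at x (fun y => f y * g y).
Proof.
have [U [m [phi [[oU _ _ hop hreg] Ux]]]] := chartP x.
move=> /(hreg x _ Ux)[p [q [qx pq]]] /(hreg x _ Ux)[p' [q' [qx' pq']]].
apply/(hreg x _ Ux); exists (p * p'), (q * q'); split.
  by rewrite rmorphM mulf_neq0.
move=> y Uy; rewrite rmorphM mulf_eq0 negb_or => /andP[qy qy'].
by rewrite pq // pq' // mulf_div !rmorphM.
Qed.

Lemma regular_at_neq0 (x : X) (f : X -> k) : regular_at x f -> f x != 0 ->
  exists W : set X, [/\ open W, W x & forall y, W y -> f y != 0].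
Proof.
have [U [m [phi [[oU _ _ hop hreg] Ux]]]] := chartP x.
move=> /(hreg x _ Ux)[p [q [qx pq]]] fx.
exists (U `&` [set y | (p * q).@[phi y] != 0]); split.
- have s : U `&` [set y | (p * q).@[phi y] != 0] `<=` U by move=> ? [].
  by apply/(hop _ s) => y [Uy h]; exists (p * q).
- split=> //=; rewrite rmorphM mulf_neq0 //.
  by apply: contraNneq fx => p0; rewrite pq // p0 mul0r.
- move=> y [Uy] /=; rewrite rmorphM mulf_eq0 negb_or => /andP[py qy].
  by rewrite pq // mulf_neq0 ?invr_eq0.
Qed.

Lemma regular_atV (x : X) (f : X -> k) : regular_at x f -> f x != 0 ->
  regular_at x (fun y => (f y)^-1).
Proof.
have [U [m [phi [[oU _ _ hop hreg] Ux]]]] := chartP x.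
move=> /(hreg x _ Ux)[p [q [qx pq]]] fx.
apply/(hreg x _ Ux); exists (q * q), (p * q); split.
  rewrite rmorphM mulf_neq0 //.
  by apply: contraNneq fx => p0; rewrite pq // p0 mul0r.
move=> y Uy; rewrite rmorphM mulf_eq0 negb_or => /andP[py qy].
by rewrite pq // invf_div rmorphM -mulf_div divff // mulr1.
Qed.

Lemma regular_at_sum (x : X) (r : nat) (f : 'I_r -> X -> k) :
  (forall i, regular_at x (f i)) -> regular_at x (fun y => \sum_i f i y).
Proof.
move=> hf; elim: (index_enum _) => [|i s IH].
  by under eq_fun do rewrite big_nil; exact: regular_at_cst.
by under eq_fun do rewrite big_cons; apply: regular_atD.
Qed.

End RegularFunctions.

Lemma act_morph (k : closedFieldType) (G : regGroupType k) (X : gVariety G)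
  (g : G) : morphism (act g : X -> X).
Proof.
have XP := gspaceP X.
have regl (U : set G) (V : set X) (t : G * X -> k) x : U g -> V x ->
    tensor U V t -> regular_at x (fun y => t (g, y)).
  move=> Ug Vx [r [a [b [ha hb ->]]]] /=; apply: regular_at_sum => // i.
  by apply: regular_atM => //; [exact: regular_at_cst | exact: hb].
suff [cj rj] : morphism (fun x : X => (g, x) : zprod G X).
  have [ca ra] := act_morphism X; split.
    move=> x; exact: (continuous_comp (cj x) (ca (g, x))).
  by move=> x f /(ra (g, x) f)/rj.
split.
  apply/continuousP => W oW; rewrite openE => x /= Wx.
  have [U [V [ts [[oU Ug] [oV Vx] hts hW]]]] := oW _ Wx.
  have : exists N : set X, [/\ open N, N x &
      forall y, N y -> forall t, t \in ts -> t (g, y) != 0].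
    elim: ts hts {hW} => [|t ts IH] hts.
      by exists setT; split=> //; exact: openT.
    have [|N [oN Nx hN]] := IH.
      by move=> s sts; apply: hts; rewrite inE sts orbT.
    have [tt tx] := hts t (mem_head _ _).
    have [M [oM Mx hM]] := regular_at_neq0 XP (regl _ _ _ x Ug Vx tt) tx.
    exists (N `&` M); split=> //; first exact: openI.
    by move=> y [Ny My] s; rewrite inE => /orP[/eqP->|/hN]; [exact: hM | exact].
  move=> [N [oN Nx hN]].
  rewrite /interior nbhsE; exists (V `&` N).
    by split; [exact: openI | split].
  by move=> y [Vy Ny]; apply: hW => //; exact: hN.
move=> x f [U [V [s [t [[oU Ug] [oV Vx] hs [ht tx] hf]]]]].
have rt := regl _ _ _ x Ug Vx ht.
have [M [oM Mx hM]] := regular_at_neq0 XP rt tx.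
apply: (@regular_at_germ _ _ XP x (fun y => s (g, y) / t (g, y)) _ (V `&` M)).
- exact: openI.
- by [].
- by move=> y [Vy My] /=; rewrite hf //; exact: hM.
- apply: regular_atM => //; first exact: regl hs.
  exact: regular_atV.
Qed.

Lemma generically_act (k : closedFieldType) (G : regGroupType k)
    (X : gVariety G) (g : G) (P : X -> Prop) :
  generically P -> generically (fun x => P (act g x)).
Proof.
move=> [U [oU dU hU]]; have pre h (W : set X) : open W -> open (act h @^-1` W).
  have [/continuousP c _] := act_morph X h; exact: c.
exists (act g @^-1` U); split; first exact: pre.
  move=> O [y Oy] oO; have [z [/= Oz Uz]] : act g^-1%g @^-1` O `&` U !=set0.
    apply: dU; last exact: pre.
    by exists (act g y); rewrite /= -actM mulVg act1.
  by exists (act g^-1%g z); split; rewrite //= -actM mulgV act1.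
by move=> x /hU.
Qed.

Section Kn.
Variables (k : closedFieldType) (n : nat) (X : gVariety (Ptau k n)).

Definition mx_regular_at (x : X) (f : X -> 'M[k]_n) : Prop :=
  forall i j, regular_at x (fun y => f y i j).

(** A rational map [X --> M_n] is represented by any total function that agrees
    with it in general position. *)
Definition rational_map (f : X -> 'M[k]_n) : Prop :=
  generically (fun x => mx_regular_at x f).

(** Equality of the rational maps [f \o h] and [h f h^-1], for each [h]; the
    open set where they agree may depend on [h]. *)
Definition equivariant (f : X -> 'M[k]_n) : Prop :=
  forall h : PGL k n,
    generically (fun x => f (act (inPGL h) x) = PGL_conj h (f x)).

Definition equi_rational : {pred (X -> 'M[k]_n)} :=
  fun f => `[< rational_map f /\ equivariant f >].

Fact equi_rational_subring : subring_closed equi_rational.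
Proof.
have XP := gspaceP X; split.
- apply/asboolP; split=> [|h]; apply: generically_all => x.
    move=> i j; exact: regular_at_cst.
  by rewrite PGL_conj1.
- move=> f g /asboolP[rf ef] /asboolP[rg eg]; apply/asboolP; split=> [|h].
    apply: generically_imp (generically_and rf rg) => x [rfx rgx] i j.
    under eq_fun do rewrite !mxE -mulN1r; apply: regular_atD => //.
    by apply: regular_atM => //; exact: regular_at_cst.
  apply: generically_imp (generically_and (ef h) (eg h)) => x [e1 e2].
  by rewrite [RHS]PGL_conjB -e1 -e2.
- move=> f g /asboolP[rf ef] /asboolP[rg eg]; apply/asboolP; split=> [|h].
    apply: generically_imp (generically_and rf rg) => x [rfx rgx] i j.
    under eq_fun do rewrite !mxE; apply: regular_at_sum => // l.
    exact: regular_atM.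
  apply: generically_imp (generically_and (ef h) (eg h)) => x [e1 e2].
  by rewrite [RHS]PGL_conjM -e1 -e2.
Qed.

Fact equi_rational_scale : GRing.scaler_closed equi_rational.
Proof.
have XP := gspaceP X.
move=> c f /asboolP[rf ef]; apply/asboolP; split=> [|h].
  apply: generically_imp rf => x rfx i j.
  under eq_fun do rewrite !mxE; apply: regular_atM => //.
  exact: regular_at_cst.
by apply: generically_imp (ef h) => x e; rewrite [RHS]PGL_conjZ -e.
Qed.

HB.instance Definition _ :=
  GRing.isSubringClosed.Build _ equi_rational equi_rational_subring.
HB.instance Definition _ :=
  GRing.isScaleClosed.Build _ _ equi_rational equi_rational_scale.

Definition knfun : Type := {f : X -> 'M[k]_n | f \in equi_rational}.
HB.instance Definition _ := 
  SubChoice.copy knfun {f : X -> 'M[k]_n | f \in equi_rational}.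
HB.instance Definition _ := 
  GRing.SubChoice_isSubPzRing.Build _ _ knfun (GRing.subringClosedP _).
HB.instance Definition _ := [SubZmodule_isSubLmodule of knfun by <:].

(** Two such functions represent the same rational map when they agree in
    general position. *)
Definition kn_eq (f g : knfun) : bool :=
  `[< generically (fun x => val f x = val g x) >].

Fact kn_eq_refl : reflexive kn_eq.
Proof. by move=> f; apply/asboolP; exact: generically_all. Qed.
Fact kn_eq_sym : ssrbool.symmetric kn_eq.
Proof.
by move=> f g; apply/asboolP/asboolP; apply: generically_imp => x ->.
Qed.
Fact kn_eq_trans : transitive kn_eq.
Proof.
move=> g f h /asboolP fg /asboolP gh; apply/asboolP.
by apply: generically_imp (generically_and fg gh) => x [-> ->].
Qed.
Canonical kn_equiv := EquivRel kn_eq kn_eq_refl kn_eq_sym kn_eq_trans.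

Definition kn : Type := {eq_quot kn_equiv}.
HB.instance Definition _ := Choice.copy kn {eq_quot kn_equiv}.
HB.instance Definition _ := EqQuotient.copy kn {eq_quot kn_equiv}.

Local Notation cl := (\pi_kn).

Lemma kn_eqP (f g : knfun) :
  reflect (generically (fun x => val f x = val g x)) (cl f == cl g).
Proof. by rewrite eqmodE; apply: asboolP. Qed.

Lemma kn_repr (f : knfun) : generically (fun x => val (repr (cl f)) x = val f x).
Proof. by apply/kn_eqP; rewrite reprK. Qed.

Definition kn_add (f g : kn) : kn := cl (repr f + repr g).
Definition kn_opp (f : kn) : kn := cl (- repr f).
Definition kn_mul (f g : kn) : kn := cl (repr f * repr g).
Definition kn_scale (c : k) (f : kn) : kn := cl (c *: repr f).

Lemma kn_addE (f g : knfun) : kn_add (cl f) (cl g) = cl (f + g).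
Proof.
apply/eqP/kn_eqP; apply: generically_imp (generically_and (kn_repr f) (kn_repr g)).
by move=> x [e1 e2]; rewrite -[LHS]/(val (repr _) x + val (repr _) x) e1 e2.
Qed.
Lemma kn_oppE (f : knfun) : kn_opp (cl f) = cl (- f).
Proof.
apply/eqP/kn_eqP; apply: generically_imp (kn_repr f) => x e.
by rewrite -[LHS]/(- val (repr _) x) e.
Qed.
Lemma kn_mulE (f g : knfun) : kn_mul (cl f) (cl g) = cl (f * g).
Proof.
apply/eqP/kn_eqP; apply: generically_imp (generically_and (kn_repr f) (kn_repr g)).
by move=> x [e1 e2]; rewrite -[LHS]/(val (repr _) x * val (repr _) x) e1 e2.
Qed.
Lemma kn_scaleE (c : k) (f : knfun) : kn_scale c (cl f) = cl (c *: f).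
Proof.
apply/eqP/kn_eqP; apply: generically_imp (kn_repr f) => x e.
by rewrite -[LHS]/(c *: val (repr _) x) e.
Qed.

Fact kn_addA : associative kn_add.
Proof.
elim/quotW=> a; elim/quotW=> b; elim/quotW=> c.
by rewrite (kn_addE b c) (kn_addE a b) !kn_addE addrA.
Qed.
Fact kn_addC : commutative kn_add.
Proof.
by elim/quotW=> a; elim/quotW=> b; rewrite (kn_addE a b) (kn_addE b a) addrC.
Qed.
Fact kn_add0 : left_id (cl 0) kn_add.
Proof. by elim/quotW=> a; rewrite kn_addE add0r. Qed.
Fact kn_addN : left_inverse (cl 0) kn_opp kn_add.
Proof. by elim/quotW=> a; rewrite kn_oppE kn_addE addNr. Qed.
HB.instance Definition _ :=
  GRing.isZmodule.Build kn kn_addA kn_addC kn_add0 kn_addN.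

Lemma kn_addrE (f g : knfun) : cl f + cl g = cl (f + g).
Proof. exact: kn_addE. Qed.

Fact kn_mulA : associative kn_mul.
Proof.
elim/quotW=> a; elim/quotW=> b; elim/quotW=> c.
by rewrite (kn_mulE b c) (kn_mulE a b) !kn_mulE mulrA.
Qed.
Fact kn_mul1 : left_id (cl 1) kn_mul.
Proof. by elim/quotW=> a; rewrite kn_mulE mul1r. Qed.
Fact kn_mulr1 : right_id (cl 1) kn_mul.
Proof. by elim/quotW=> a; rewrite kn_mulE mulr1. Qed.
Fact kn_mulDl : left_distributive kn_mul +%R.
Proof.
elim/quotW=> a; elim/quotW=> b; elim/quotW=> c.
by rewrite kn_addrE (kn_mulE a c) (kn_mulE b c) kn_mulE kn_addrE mulrDl.
Qed.
Fact kn_mulDr : right_distributive kn_mul +%R.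
Proof.
elim/quotW=> a; elim/quotW=> b; elim/quotW=> c.
by rewrite kn_addrE (kn_mulE a b) (kn_mulE a c) kn_mulE kn_addrE mulrDr.
Qed.
HB.instance Definition _ := GRing.Zmodule_isPzRing.Build kn
  kn_mulA kn_mul1 kn_mulr1 kn_mulDl kn_mulDr.

Fact kn_scaleA a b (f : kn) : kn_scale a (kn_scale b f) = kn_scale (a * b) f.
Proof. by elim/quotW: f => f; rewrite (kn_scaleE b f) !kn_scaleE scalerA. Qed.
Fact kn_scale1 : left_id 1 kn_scale.
Proof. by elim/quotW=> f; rewrite kn_scaleE scale1r. Qed.
Fact kn_scaleDr : right_distributive kn_scale +%R.
Proof.
move=> c; elim/quotW=> f; elim/quotW=> g.
by rewrite kn_addrE (kn_scaleE c f) (kn_scaleE c g) kn_scaleE kn_addrE scalerDr.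
Qed.
Fact kn_scaleDl (f : kn) : {morph kn_scale^~ f : a b / a + b}.
Proof.
elim/quotW: f => f a b.
by rewrite (kn_scaleE a f) (kn_scaleE b f) kn_scaleE kn_addrE scalerDl.
Qed.
HB.instance Definition _ := GRing.Zmodule_isLmodule.Build k kn
  kn_scaleA kn_scale1 kn_scaleDr kn_scaleDl.

Definition tau_tr (f : X -> 'M[k]_n) : X -> 'M[k]_n :=
  fun x => (f (act tau x))^T.

Fact tau_tr_subproof (f : knfun) : tau_tr (val f) \in equi_rational.
Proof.
have /asboolP[rf ef] := valP f; apply/asboolP; split=> [|h].
  apply: generically_imp (generically_act tau rf) => x rfx i j.
  under eq_fun do rewrite /tau_tr mxE.
  by have [_ h] := act_morph X tau; exact: (h x (fun y => val f y j i)).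
apply: generically_imp (generically_act tau (ef (PGL_contra h))) => x e.
by rewrite /tau_tr -actM tau_inPGL actM e PGL_conj_contra.
Qed.

Definition sigma_tau (f : kn) : kn :=
  cl (exist _ (tau_tr (val (repr f))) (tau_tr_subproof (repr f)) : knfun).

Lemma sigma_tauP (f : kn) : generically (fun x : X =>
  val (repr (sigma_tau f)) x = (val (repr f) (act tau x))^T).
Proof. exact: kn_repr. Qed.

Lemma sigma_tauK : involutive sigma_tau.
Proof.
move=> f; rewrite -[RHS]reprK; apply/eqP/kn_eqP.
apply: generically_imp (generically_act tau (sigma_tauP f)) => x.
rewrite /= /tau_tr => ->; rewrite trmxK -actM (_ : (tau * tau)%g = 1%g) ?act1 //.
by congr pair; rewrite /= mul1g PGL_contra1.
Qed.

End Kn.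

Definition pgl_generically_free (k : closedFieldType) (n : nat)
    (X : gVariety (Ptau k n)) : Prop :=
  generically (fun x : X =>
    forall h : PGL k n, act (inPGL h) x = x -> h = 1%g).

Section CentralSimple.
Variables (k : closedFieldType) (A : algType k).

Definition center : set A := [set z | forall a, GRing.comm z a].

Definition two_sided_ideal (I : set A) : Prop :=
  [/\ I 0, forall x y, I x -> I y -> I (x + y) &
      forall a x b, I x -> I (a * x * b)].

(** No nontriviality condition: [1 != 0] is part of [algType]. *)
Definition simple_algebra : Prop :=
  forall I : set A, two_sided_ideal I -> I = [set 0] \/ I = setT.

(** The center of a simple algebra is a field; these are its subfields
    containing [k]. *)
Definition central_subextension (F : set A) : Prop :=
  [/\ F `<=` center, forall c : k, F c%:A,
      forall x y, F x -> F y -> F (x - y),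
      forall x y, F x -> F y -> F (x * y) &
      forall x y, F x -> x * y = 1 -> F y].

Definition center_fin_gen : Prop :=
  exists s : seq A, (forall c, c \in s -> center c) /\
    forall F : set A, central_subextension F -> (forall c, c \in s -> F c) ->
      center `<=` F.

Definition basis_over_center (d : nat) (e : 'I_d -> A) : Prop :=
  forall a, exists! z : 'I_d -> A,
    (forall i, center (z i)) /\ a = \sum_i z i * e i.

Definition central_simple_of_degree (n : nat) : Prop :=
  [/\ simple_algebra, center_fin_gen &
      exists e : 'I_(n ^ 2) -> A, basis_over_center e].

Definition algebra_involution (s : {linear A -> A}) : Prop :=
  [/\ s 1 = 1, forall a b, s (a * b) = s b * s a & involutive s].

End CentralSimple.
Arguments central_simple_of_degree {k} A n.

(* Main.v *)
(** Choose generators of the center [K] of [A] and a [K]-basis [e] of [A], all of them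
    symmetric or skew, so that the structure constants of [e] are polynomials in the
    generators, and a splitting [A -> M_n(L)] over an extension [L] of [K]. The variety
    [X] is the Zariski closure over [k] of the [GL_n(k)]-conjugates of the [L]-point [x]
    given by the images of these elements; [tau] acts on it by signs and transposition.
    Generically the fibers of [X] over its central coordinates are single orbits
    (Skolem-Noether over [k]). Specializing points of [L] to points of [k] then shows
    that [X] is stable under [tau], and that the invariant rational functions on [X] are
    the elements of [K]: an invariant outside [K] would take two distinct values on one
    fiber. As the entries of [e] form a basis of [M_n] generically, an equivariant
    rational map is a combination of [e] with invariant coefficients, that is, an
    element of [A]. *)
Require Import Defs.
From HB Require Import structures.
From mathcomp Require Import all_boot all_order all_algebra.
From mathcomp Require Import fieldext.
From mathcomp Require Import all_classical topology.
From mathcomp.multinomials Require Import mpoly.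

Set Implicit Arguments.
Unset Strict Implicit.
Unset Printing Implicit Defensive.

Import GRing.Theory.
Local Open Scope ring_scope.

(** * Specialization of points over an integral domain *)

(** The field [L] that splits [A] may be any extension of [K], and [sigma] need not extend to it.
    Hence whatever involves [tau], or compares two points of a fiber, is checked at points over [k].
    The passage from [L] to [k] is by elimination: coordinates are specialized one at a time, each
    being transcendental or a root of a minimal relation over the previous ones, and every step
    preserves all relations while avoiding a prescribed hypersurface. This plays the role of the
    Nullstellensatz. A variant producing two distinct values detects an element of [L] outside [K];
    there characteristic zero gives separability. The structure constants are put among the
    generators of [K] so that the multiplication rules are polynomial identities without
    denominators, valid at every point of the closure and not only generically. Since [sigma] may
    move [K], the generators of [K] as well as the basis are made symmetric or skew; [tau] is then a
    linear map of the coordinate space. *)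

Section SpecializationStep.
Variables (T : idomainType) (L : fieldType) (k : closedFieldType).
Variables (e : {rmorphism T -> L}) (y : L).
Implicit Types P Q B : {poly T}.

(** [e] may have a kernel: later [T] is a polynomial ring evaluated in [L], and the kernel is the
    ideal of relations already imposed. Polynomials over [T] are therefore judged only through
    [map_poly e]. *)
Definition ev P : L := (map_poly e P).[y].

(** A minimal polynomial of [y] over the image of [T], with denominators cleared and coefficients
    lifted to [T]. The condition on sizes keeps the leading coefficient outside the kernel of
    [e]. *)
Definition minimal_relation P : Prop :=
  [/\ size (map_poly e P) = size P, ev P = 0, map_poly e P != 0 &
      forall Q, (size Q < size P)%N -> ev Q = 0 -> map_poly e Q = 0].

Lemma evD P Q : ev (P + Q) = ev P + ev Q.
Proof. by rewrite /ev rmorphD hornerD. Qed.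

Lemma evM P Q : ev (P * Q) = ev P * ev Q.
Proof. by rewrite /ev rmorphM hornerM. Qed.

Lemma evZ c P : ev (c *: P) = e c * ev P.
Proof. by rewrite /ev map_polyZ hornerZ. Qed.

Lemma size_map_leq P : (size (map_poly e P) <= size P)%N.
Proof.
by apply/leq_sizeP => i ij; rewrite coef_map /= nth_default ?rmorph0.
Qed.

Lemma trim_poly P : exists Q,
  map_poly e Q = map_poly e P /\ size Q = size (map_poly e P).
Proof.
pose d := size (map_poly e P).
have eQ : map_poly e (take_poly d P) = map_poly e P.
  apply/polyP => i; rewrite !coef_map coef_take_poly.
  have [//|dle] := ltnP; have := nth_default 0 dle.
  by rewrite coef_map /= => ->; rewrite rmorph0.
exists (take_poly d P); split=> //; apply/eqP; rewrite eqn_leq size_take_poly.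
by rewrite -[X in (X <= _)%N]/(size (map_poly e P)) -{1}eQ size_map_leq.
Qed.

Lemma lead_map_neq0 P : size (map_poly e P) = size P -> map_poly e P != 0 ->
  e (lead_coef P) != 0.
Proof.
by move=> sP nP; rewrite -coef_map /= -sP -[_`_ _]/(lead_coef _) lead_coef_eq0.
Qed.

(** Division over a domain costs a power of the leading coefficient, which is harmless as long as
    [e] does not kill it. *)
Lemma pseudo_div P B : B != 0 -> exists (s : nat) Q R,
  lead_coef B ^+ s *: P = Q * B + R /\ (size R < size B)%N.
Proof.
move=> nB; exists (scalp P B), (P %/ B), (P %% B).
by rewrite Pdiv.Idomain.divp_eq ltn_modp.
Qed.

Lemma size_min_ind (p : {poly T} -> Prop) :
  (exists P, p P) -> exists2 P, p P & forall Q, (size Q < size P)%N -> ~ p Q.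
Proof.
move=> [P pP].
have ex : exists m : nat, `[< exists2 P, p P & size P = m >].
  by exists (size P); apply/asboolP; exists P.
case: (ex_minnP ex) => j /asboolP[Q pQ sQ] hmin; exists Q => // R sR pR.
have : (j <= size R)%N by apply: hmin; apply/asboolP; exists R.
by rewrite -sQ leqNgt sR.
Qed.

Lemma exists_minimal_relation : (exists2 P, map_poly e P != 0 & ev P = 0) ->
  exists P, minimal_relation P.
Proof.
move=> [P0 nP0 eP0].
have [|P [nP eP] Pmin] := @size_min_ind (fun P => map_poly e P != 0 /\ ev P = 0).
  by exists P0.
have [Q [eQ sQ]] := trim_poly P.
have sPQ : (size Q <= size P)%N by rewrite sQ size_map_leq.
exists Q; split; rewrite ?eQ ?sQ //; first by rewrite /ev eQ.
move=> R sR eR; apply/eqP; apply: contrapT => /negP nR; apply: (Pmin R) => //.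
by apply: leq_trans sR _; rewrite size_map_leq.
Qed.

(** A Bezout identity modulo [P] with denominators cleared: a nonzero value at [y] has a multiple in
    the image of [T]. It comes from a smallest polynomial [M] whose value at [y] is nonzero and a
    multiple of that of [B]; such an [M] must be constant. *)
Lemma minimal_relation_inverse P B : minimal_relation P -> ev B != 0 ->
  exists (d : T) (U : {poly T}), e d != 0 /\ ev (U * B) = e d.
Proof.
move=> [sP eP nP Pmin] eB.
pose p R := ev R != 0 /\ exists U, ev R = ev (U * B).
have nP' : P != 0 by apply: contraNneq nP => ->; rewrite rmorph0.
have lP := lead_map_neq0 sP nP.
have [|M0 [eM0 [U eU]] Mmin] := @size_min_ind p.
  by exists B; split=> //; exists 1; rewrite mul1r.
have [M [eMM sM]] := trim_poly M0.
have evMM : ev M = ev M0 by rewrite /ev eMM.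
have eM : ev M != 0 by rewrite evMM.
have sMM : (size M <= size M0)%N by rewrite sM size_map_leq.
have nM : map_poly e M != 0 by apply: contraNneq eM; rewrite /ev => ->; rewrite horner0.
have nM' : M != 0 by apply: contraNneq nM => ->; rewrite rmorph0.
have lM : e (lead_coef M) != 0 by apply: lead_map_neq0 => //; rewrite eMM sM.
(* Otherwise the remainder of [M] modulo [P] would be smaller, with the same value up to a power of
   the leading coefficient of [P]. *)
have sMP : (size M < size P)%N.
  have [s [Q [R [eR sR]]]] := pseudo_div M nP'.
  rewrite ltnNge; apply/negP => sPM; apply: (Mmin R).
    by apply: leq_trans sR (leq_trans sPM sMM).
  have evR : ev R = ev ((lead_coef P ^+ s)%:P * U * B).
    have : ev (lead_coef P ^+ s *: M) = ev (Q * P + R) by rewrite eR.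
    rewrite evZ evD evM eP mulr0 add0r => <-.
    by rewrite -mulrA evM -eU evMM; congr (_ * _); rewrite /ev map_polyC hornerC.
  split; last by eexists; exact: evR.
  by rewrite evR -mulrA evM -eU mulf_neq0 // /ev map_polyC hornerC /= rmorphXn expf_neq0.
have [s1|s1] := leqP (size M) 1.
  exists (M`_0), U; rewrite -eU -evMM.
  have -> : ev M = e M`_0 by rewrite {1}(size1_polyC s1) /ev map_polyC hornerC.
  split=> //; move: eM; rewrite {1}(size1_polyC s1) /ev map_polyC hornerC //.
(* If [M] is not constant, divide [P] by it. Minimality of [M] makes the remainder vanish at [y],
   hence the quotient too; both are smaller than [P], so [e] kills them and with them a nonzero
   multiple of [P]. *)
exfalso; have [s [Q [R [eR sR]]]] := pseudo_div P nM'.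
have evR : ev (Q * M) = - ev R.
  have : ev (lead_coef M ^+ s *: P) = ev (Q * M + R) by rewrite eR.
  by rewrite evZ eP mulr0 evD => /esym/eqP; rewrite addr_eq0 => /eqP.
have eR0 : ev R = 0.
  apply: contrapT => /eqP nR; apply: (Mmin R); first exact: leq_trans sR sMM.
  split=> //; exists (- Q * U); rewrite -mulrA evM -eU.
  by rewrite -evMM -evM mulNr -[- _]mulN1r evM evR /ev rmorphN1 hornerN hornerC mulN1r opprK.
have eQ0 : ev Q = 0.
  by move: evR; rewrite eR0 oppr0 evM => /eqP; rewrite mulf_eq0 (negPf eM) orbF => /eqP.
have mR : map_poly e R = 0 by apply: Pmin => //; exact: ltn_trans sR sMP.
have mQ : map_poly e Q = 0.
  apply: Pmin => //; have [->|nQ] := eqVneq Q 0.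
    by rewrite size_poly0 (leq_trans _ sMP).
  have ltR : (size R < size (Q * M)%R)%N.
    apply: leq_trans sR _; rewrite size_mul //.
    by case: (size Q) (size_poly_eq0 Q) => [|j _]; rewrite ?(negPf nQ) // addSn leq_addl.
  have : size (lead_coef M ^+ s *: P) = size (Q * M) by rewrite eR size_polyDl.
  have nl : lead_coef M ^+ s != 0.
    by rewrite expf_neq0 //; apply: contraNneq lM => ->; rewrite rmorph0.
  rewrite size_scale // size_mul // => ->.
  by move: s1; case: (size M) => [//|[//|j]] _; rewrite !addnS /= ltnS leq_addr.
have : map_poly e (lead_coef M ^+ s *: P) = 0 by rewrite eR rmorphD rmorphM /= mR mQ mul0r addr0.
by move/eqP; rewrite map_polyZ scaler_eq0 (negPf nP) rmorphXn expf_eq0 (negPf lM) andbF.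
Qed.

Section Hom.
Variable h : {rmorphism T -> k}.
Hypothesis hspec : forall t, e t = 0 -> h t = 0.

Lemma spec_map_poly0 P : map_poly e P = 0 -> map_poly h P = 0.
Proof.
move=> /polyP eP; apply/polyP => i; rewrite coef_map coef0 /= hspec //.
by have := eP i; rewrite coef_map coef0.
Qed.

(** Pseudo-division of a relation by [P] leaves a smaller relation, whose coefficients are killed by
    [e] and so by [h]; thus the specialized [P] divides every specialized relation. *)
Lemma minimal_relation_spec P (w : k) : minimal_relation P ->
  h (lead_coef P) != 0 -> root (map_poly h P) w ->
  forall Q, ev Q = 0 -> (map_poly h Q).[w] = 0.
Proof.
move=> [sP eP nP Pmin] hl /rootP rw Q eQ.
have nP' : P != 0 by apply: contraNneq nP => ->; rewrite rmorph0.
have [s [U [R [eR sR]]]] := pseudo_div Q nP'.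
have eR0 : ev R = 0.
  have : ev (lead_coef P ^+ s *: Q) = ev (U * P + R) by rewrite eR.
  by rewrite evZ eQ mulr0 evD evM eP mulr0 add0r => <-.
have hR := spec_map_poly0 (Pmin R sR eR0).
have : (map_poly h (lead_coef P ^+ s *: Q)).[w] = 0.
  by rewrite eR rmorphD rmorphM /= hR addr0 hornerM rw mulr0.
rewrite map_polyZ hornerZ rmorphXn /= => /eqP.
by rewrite mulf_eq0 expf_eq0 (negPf hl) andbF => /eqP.
Qed.

End Hom.

(** The Bezout identity [U * B = d] holds at [y], so it survives specialization, where a zero of [B]
    would force [h d = 0]. *)
Lemma minimal_relation_spec_neq0 P B : minimal_relation P -> ev B != 0 ->
  exists2 d : T, e d != 0 & forall h : {rmorphism T -> k},
    (forall t, e t = 0 -> h t = 0) -> h (lead_coef P) != 0 -> h d != 0 ->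
    forall w, root (map_poly h P) w -> (map_poly h B).[w] != 0.
Proof.
move=> Pmin eB; have [d [U [ed eU]]] := minimal_relation_inverse Pmin eB.
exists d => // h hs hl hd w rw.
have e0 : ev (U * B - d%:P) = 0.
  by rewrite evD eU -polyCN /ev map_polyC hornerC /= rmorphN subrr.
have := minimal_relation_spec hs Pmin hl rw e0.
rewrite rmorphB rmorphM /= hornerD hornerN map_polyC hornerC hornerM /= => eq0.
apply: contraNneq hd => b0; move: eq0; rewrite b0 mulr0 sub0r.
by move/eqP; rewrite oppr_eq0 => /eqP ->.
Qed.

End SpecializationStep.

Lemma infinite_avoid (k F : fieldType) (f : {rmorphism k -> F}) (p : {poly F}) (s : seq F) :
  [pchar k] =i pred0 -> p != 0 -> exists2 t : k, p.[f t] != 0 & f t \notin s.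
Proof.
move=> char0 np; pose q := p * \prod_(a <- s) ('X - a%:P).
have nq : q != 0.
  by rewrite mulf_neq0 // prodf_seq_neq0; apply/allP => a _; rewrite implyTb polyXsubC_eq0.
have inj : injective (fun i : nat => f i%:R).
  have inj0 i j : (i <= j)%N -> i%:R = j%:R :> k -> i = j.
    move=> ij /eqP; rewrite eq_sym -subr_eq0 -natrB // (pcharf0P k).1 //.
    by rewrite subn_eq0 => ji; apply/eqP; rewrite eqn_leq ij.
  move=> i j /fmorph_inj eij.
  by have [/inj0|/ltnW/inj0/(_ (esym eij))] := leqP i j; [exact|].
pose l := [seq f i%:R | i <- iota 0 (size q)].
have : ~~ all (root q) l.
  apply/negP => al; have := max_poly_roots nq al.
  by rewrite (map_inj_uniq inj) iota_uniq size_map size_iota ltnn => /(_ isT).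
move=> /allPn[_ /mapP[i _ ->]]; rewrite /root /q hornerM mulf_eq0 negb_or => /andP[pw sw].
by exists i%:R => //; rewrite -root_prod_XsubC.
Qed.

Section Extension.
Variables (T : idomainType) (L : fieldType) (k : closedFieldType).
Hypothesis char0 : [pchar k] =i pred0.
Variables (e : {rmorphism T -> L}) (y : L).

(** Such an [h] factors through the subring [e(T)] of [L], without this subring being formed. *)
Definition specialization (h : T -> k) : Prop := forall t, e t = 0 -> h t = 0.

(** If [y] is algebraic over the image of [T], any root of the specialized minimal relation will do.
    If it is transcendental, all relations are trivial and [w] only has to avoid the roots of the
    specialized [B]. *)
Lemma specialization_step (B : {poly T}) : ev e y B != 0 ->
  exists2 a : T, e a != 0 & forall h : {rmorphism T -> k},
    specialization h -> h a != 0 ->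
    exists w : k, (map_poly h B).[w] != 0 /\
      forall Q, ev e y Q = 0 -> (map_poly h Q).[w] = 0.
Proof.
move=> eB; have [alg|trans] := pselect (exists2 P, map_poly e P != 0 & ev e y P = 0).
  have [P Pmin] := exists_minimal_relation alg.
  have [d ed hd] := minimal_relation_spec_neq0 k Pmin eB.
  have [sP eP nP _] := Pmin.
  have lP := lead_map_neq0 sP nP.
  exists (lead_coef P * d) => [|h hs]; rewrite rmorphM; first by rewrite mulf_neq0.
  rewrite mulf_eq0 negb_or => /andP[hl hd'].
  have nc : size (map_poly h P) != 1.
    rewrite size_poly_eq // -sP; apply/eqP => /eqP/size_poly1P[c c0 ec].
    by move: eP; rewrite /ev ec hornerC => /eqP; rewrite (negPf c0).
  have /closed_rootP[w rw] := nc; exists w; split; first exact: (hd h).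
  exact: (minimal_relation_spec hs Pmin).
have : map_poly e B != 0 by apply: contraNneq eB; rewrite /ev => ->; rewrite horner0.
rewrite -lead_coef_eq0 lead_coefE coef_map /= => eb.
exists B`_(size (map_poly e B)).-1 => // h hs hb.
have nB : map_poly h B != 0.
  by apply: contraNneq hb => /polyP/(_ (size (map_poly e B)).-1); rewrite coef_map coef0 => ->.
have [w hw _] := infinite_avoid (idfun : {rmorphism k -> k}) [::] char0 nB; exists w; split=> // Q eQ.
rewrite (spec_map_poly0 hs) ?horner0 //.
by apply: contrapT => /eqP nQ; apply: trans; exists Q.
Qed.

(** The second hypothesis says that [y] is not in the fraction field of the image of [T]. An
    algebraic [y] then has degree at least two over it and is separable, which gives two distinct
    roots; a transcendental [y] leaves infinitely many values. *)
Lemma specialization_step_pair (B : {poly T}) : [pchar L] =i pred0 ->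
  (forall u v : T, e u != 0 -> e u * y <> e v) -> ev e y B != 0 ->
  exists2 a : T, e a != 0 & forall h : {rmorphism T -> k},
    specialization h -> h a != 0 ->
    exists w1 w2 : k, w1 != w2 /\ forall w, w \in [:: w1; w2] ->
      (map_poly h B).[w] != 0 /\
      forall Q, ev e y Q = 0 -> (map_poly h Q).[w] = 0.
Proof.
move=> charL irr eB.
have [alg|trans] := pselect (exists2 P, map_poly e P != 0 & ev e y P = 0).
  have [P Pmin] := exists_minimal_relation alg.
  have [sP eP nP Pm] := Pmin.
  have lP := lead_map_neq0 sP nP.
  have sP3 : (2 < size P)%N.
    have nc : (1 < size P)%N.
      rewrite ltnNge; apply/negP => /size1_polyC eP1; move: eP nP.
      by rewrite eP1 /ev map_polyC hornerC /= => ->; rewrite eqxx.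
    rewrite ltn_neqAle nc andbT eq_sym; apply/eqP => sP2.
    have ePl : ev e y P = e P`_0 + e P`_1 * y.
      rewrite /ev horner_coef sP sP2 !big_ord_recr big_ord0 /= !coef_map /= add0r.
      by rewrite expr0 expr1 mulr1.
    apply: (irr P`_1 (- P`_0)); first by move: lP; rewrite lead_coefE sP2.
    by rewrite rmorphN; apply/eqP; rewrite eq_sym -subr_eq0 -opprD oppr_eq0 -ePl eP.
  (* The derivative is smaller than [P], so vanishing at [y] would make [e] kill its coefficients,
     in particular the degree times the leading coefficient of [P]. *)
  have eD : ev e y P^`() != 0.
    apply/eqP => /Pm; rewrite lt_size_deriv -?size_poly_gt0 ?(ltn_trans _ sP3) //.
    move=> /(_ isT) /polyP/(_ (size P).-2); rewrite -deriv_map coef_deriv coef0 coef_map.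
    have -> : (size P).-2.+1 = (size P).-1 by case: (size P) sP3 => [|[]].
    move/eqP; rewrite -mulr_natr mulf_eq0 -lead_coefE (negPf lP) /=.
    by rewrite (pcharf0P L).1 //; case: (size P) sP3 => [|[]].
  have [d ed hd] := minimal_relation_spec_neq0 k Pmin eB.
  have [d' ed' hd'] := minimal_relation_spec_neq0 k Pmin eD.
  exists (lead_coef P * d * d') => [|h hs]; rewrite !rmorphM /=; first by rewrite !mulf_neq0.
  rewrite !mulf_eq0 !negb_or -andbA => /and3P[hl hdd hdd'].
  have sh : size (map_poly h P) = size P by rewrite size_poly_eq.
  have /closed_rootP[w1 rw1] : size (map_poly h P) != 1.
    by rewrite sh; case: (size P) sP3 => [|[|[]]].
  have /factor_theorem[q eq] := rw1.
  have sq : (size q).+1 = size P.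
    rewrite -sh eq size_Mmonic ?monicXsubC ?size_XsubC ?addn2 //.
    by apply: contraTneq sP3 => q0; rewrite -sh eq q0 mul0r size_poly0.
  have /closed_rootP[w2 rw2] : size q != 1.
    by move: sP3; rewrite -sq; case: (size q) => [|[|[]]].
  have rw2' : root (map_poly h P) w2 by rewrite eq rootM rw2.
  exists w1, w2; split.
    (* A double root would be a root of the derivative, which [d'] excludes. *)
    apply: contraNneq (hd' h hs hl hdd' _ rw1) => e12.
    rewrite -deriv_map eq derivM hornerD !hornerM derivXsubC hornerC hornerXsubC.
    by rewrite subrr mulr0 add0r mulr1 e12; apply/eqP/rootP.
  have ok w : root (map_poly h P) w -> (map_poly h B).[w] != 0 /\
      forall Q, ev e y Q = 0 -> (map_poly h Q).[w] = 0.
    by move=> rw; split; [exact: (hd h) | exact: (minimal_relation_spec hs Pmin)].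
  by move=> w; rewrite !inE => /orP[] /eqP ->; exact: ok.
have : map_poly e B != 0 by apply: contraNneq eB; rewrite /ev => ->; rewrite horner0.
rewrite -lead_coef_eq0 lead_coefE coef_map /= => eb.
exists B`_(size (map_poly e B)).-1 => // h hs hb.
have nB : map_poly h B != 0.
  by apply: contraNneq hb => /polyP/(_ (size (map_poly e B)).-1); rewrite coef_map coef0 => ->.
have Q0 Q : ev e y Q = 0 -> map_poly h Q = 0.
  move=> eQ; apply: (spec_map_poly0 hs).
  by apply: contrapT => /eqP nQ; apply: trans; exists Q.
have [w1 hw1 _] := infinite_avoid (idfun : {rmorphism k -> k}) [::] char0 nB.
have [w2 hw2 n12] := infinite_avoid (idfun : {rmorphism k -> k}) [:: w1] char0 nB.
exists w1, w2; split; first by move: n12; rewrite !inE eq_sym.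
by move=> w; rewrite !inE => /orP[] /eqP ->; split=> // Q /Q0 ->; rewrite horner0.
Qed.

End Extension.

Lemma mpoly_morph_eq n (R : nzRingType) (S : nzRingType)
    (f g : {rmorphism {mpoly R[n]} -> S}) :
  (forall c, f c%:MP = g c%:MP) -> (forall i, f 'X_i = g 'X_i) -> f =1 g.
Proof.
move=> fgC fgX p; rewrite (mpolyE p) !rmorph_sum; apply: eq_bigr => m _.
rewrite -mul_mpolyC !rmorphM fgC mpolyXE_id !rmorph_prod; congr (_ * _).
by apply: eq_bigr => i _; rewrite !rmorphXn /= fgX.
Qed.

Lemma mmapU n (R : nzRingType) (S : comNzRingType) (f : {rmorphism R -> S})
  (v : 'I_n -> S) i : mmap f v 'X_i = v i.
Proof. by rewrite mmapX mmap1U. Qed.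

Lemma mmap_mmap n (R : nzRingType) (S U : comNzRingType)
    (f : {rmorphism R -> S}) (g : {rmorphism S -> U}) (v : 'I_n -> S)
    (fg : {rmorphism R -> U}) (w : 'I_n -> U) :
  (forall c, g (f c) = fg c) -> (forall i, g (v i) = w i) ->
  forall p, g (mmap f v p) = mmap fg w p.
Proof.
move=> hf hv p.
apply: (@mpoly_morph_eq _ _ _ (g \o mmap f v) (mmap fg w)) => [c|i] /=.
  by rewrite !mmapC hf.
by rewrite !mmapU hv.
Qed.

Section Specialization.
Variables (L : fieldType) (k : closedFieldType).
Hypothesis char0 : [pchar k] =i pred0.

(** The last coordinate is treated over the domain [{mpoly T[n]}], mapped to [L] by evaluation at
    the other ones. The element [a1] that it requires to be nonzero becomes the datum [b] of the
    induction hypothesis. *)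
Lemma specialization_extend n (T : idomainType) (e : {rmorphism T -> L})
    (y : 'I_n -> L) (b : {mpoly T[n]}) : mmap e y b != 0 ->
  exists2 a : T, e a != 0 & forall h : {rmorphism T -> k},
    specialization e h -> h a != 0 ->
    exists w : 'I_n -> k, mmap h w b != 0 /\
      forall p, mmap e y p = 0 -> mmap h w p = 0.
Proof.
elim: n T e y b => [|n IH] T e y b yb.
  have C p : exists c : T, p = c%:MP_[0].
    by exists p@_0; apply/mpolyP => m; rewrite mcoeffC (_ : m = 0%MM) ?eqxx ?mulr1 //; apply/mnmP; case.
  have [c bc] := C b; exists c => [|h hs hc].
    by move: yb; rewrite bc mmapC.
  exists (fun=> 0); split=> [|p]; first by rewrite bc mmapC.
  by have [d ->] := C p; rewrite !mmapC; exact: hs.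
pose y' i := y (widen_ord (leqnSn n) i).
pose e' : {rmorphism {mpoly T[n]} -> L} := mmap e y'.
(* [mmap c X] rewrites a polynomial in [n.+1] variables as one in the last variable. *)
pose X (i : 'I_n.+1) : {poly {mpoly T[n]}} :=
  if unlift ord_max i is Some j then ('X_j)%:P else 'X.
pose c : {rmorphism T -> {poly {mpoly T[n]}}} := polyC \o @mpolyC n T.
have Xy i : (map_poly e' (X i)).[y ord_max] = y i.
  rewrite /X; case: unliftP => [j ->|->]; last by rewrite map_polyX hornerX.
  rewrite map_polyC hornerC /= mmapU /y'; congr y; apply: val_inj => /=.
  by rewrite /bump leqNgt ltn_ord.
have evE p : ev e' (y ord_max) (mmap c X p) = mmap e y p.
  rewrite /ev; apply: (@mpoly_morph_eq _ _ _
    (horner_eval (y ord_max) \o map_poly e' \o mmap c X) (mmap e y)) => [t|i] /=.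
    by rewrite !mmapC /= map_polyC /= mmapC /horner_eval hornerC.
  by rewrite !mmapU /horner_eval Xy.
have [|a1 ea1 ha1] := @specialization_step _ _ _ char0 e' (y ord_max) (mmap c X b).
  by rewrite evE.
have [a ea ha] := IH T e y' a1 ea1.
exists a => // h hs hha; have [w' [hw' hs']] := ha h hs hha.
pose h' : {rmorphism {mpoly T[n]} -> k} := mmap h w'.
have [w [hw hs2]] := ha1 h' hs' hw'.
pose w2 i := if unlift ord_max i is Some j then w' j else w.
have hE p : (map_poly h' (mmap c X p)).[w] = mmap h w2 p.
  apply: (@mpoly_morph_eq _ _ _
    (horner_eval w \o map_poly h' \o mmap c X) (mmap h w2)) => [t|i] /=.
    by rewrite !mmapC /= map_polyC /= mmapC /horner_eval hornerC.
  rewrite !mmapU /horner_eval /X /w2; case: unliftP => [j _|_].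
    by rewrite map_polyC hornerC /= mmapU.
  by rewrite map_polyX hornerX.
exists w2; split=> [|p yp]; rewrite -hE //.
by apply: hs2; rewrite evE.
Qed.

End Specialization.

(** * Density and splitting of simple algebras *)

Section Density.
Variables (M : zmodType) (S : (M -> M) -> Prop).
Hypothesis S_id : S id.
Hypothesis S_comp : forall f g, S f -> S g -> S (f \o g).
Hypothesis S_sub : forall f g, S f -> S g -> S (fun x => f x - g x).
Hypothesis S_morph : forall f, S f -> forall x y, f (x - y) = f x - f y.
Hypothesis S_irr : forall x y, x != 0 -> exists2 f, S f & f x = y.

Definition commutant (t : M -> M) : Prop :=
  (forall x y, t (x - y) = t x - t y) /\ (forall f, S f -> forall x, t (f x) = f (t x)).

(** Linear independence over the commutant, whose elements serve as coefficients. *)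
Definition commutant_free s (v : 'I_s -> M) : Prop :=
  forall t : 'I_s -> M -> M, (forall i, commutant (t i)) ->
    \sum_i t i (v i) = 0 -> forall i x, t i x = 0.

Lemma morph_sub0 (f : M -> M) : (forall x y, f (x - y) = f x - f y) -> f 0 = 0.
Proof. by move=> fB; have := fB 0 0; rewrite !subrr. Qed.

Lemma S_zero : S (fun=> 0).
Proof.
have -> : (fun=> 0) = (fun x : M => x - x) by apply/funext => x; rewrite subrr.
exact: S_sub.
Qed.

Lemma S_add f g : S f -> S g -> S (fun x => f x + g x).
Proof.
move=> Sf Sg; have -> : (fun x => f x + g x) = (fun x => f x - (0 - g x)).
  by apply/funext => x; rewrite sub0r opprK.
exact: S_sub Sf (S_sub S_zero Sg).
Qed.

Lemma S_sum s (f : 'I_s -> M -> M) : (forall i, S (f i)) -> S (fun x => \sum_i f i x).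
Proof.
move=> Sf; elim: (index_enum _) => [|i r IH].
  by under eq_fun do rewrite big_nil; exact: S_zero.
by under eq_fun do rewrite big_cons; apply: S_add.
Qed.

Lemma commutant0 : commutant (fun=> 0).
Proof.
by split=> [x y|f Sf x]; rewrite ?subrr ?(morph_sub0 (S_morph Sf)).
Qed.

(** It is enough that some [f] in [S] kills the other vectors but not [v i], as irreducibility then
    moves [f (v i)] to [u]. If there is none, [v i] is a combination of the others over the
    commutant. *)
Lemma jacobson_density s (v : 'I_s -> M) : commutant_free v ->
  forall i u, exists f, [/\ S f, f (v i) = u & forall j, j != i -> f (v j) = 0].
Proof.
elim: s v => [|s IH] v free i u; first by case: i.
have {}IH := IH (fun j => v (lift i j)).
have free' : commutant_free (fun j => v (lift i j)).
  move=> t ct t0 j x; pose t' l := if unlift i l is Some j then t j else fun=> 0.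
  have -> : t j x = t' (lift i j) x by rewrite /t' liftK.
  apply: free => [l|].
    by rewrite /t'; case: unlift => [l'|]; [exact: ct | exact: commutant0].
  rewrite (bigD1_ord i) //= {1}/t' unlift_none add0r -[RHS]t0.
  by apply: eq_bigr => l _; rewrite /t' liftK.
have {free'}IH := IH free'.
have [kills|] := pselect (forall f, S f -> (forall j, f (v (lift i j)) = 0) -> f (v i) = 0).
  have ex j w : exists f, [/\ S f, f (v (lift i j)) = w &
     forall l, l != j -> f (v (lift i l)) = 0] by exact: IH.
  pose F j w := projT1 (cid (ex j w)).
  have FP j w : [/\ S (F j w), F j w (v (lift i j)) = w &
     forall l, l != j -> F j w (v (lift i l)) = 0] by exact: (projT2 (cid (ex j w))).
  have uniqF j w f : S f -> f (v (lift i j)) = w ->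
      (forall l, l != j -> f (v (lift i l)) = 0) -> f (v i) = F j w (v i).
    move=> Sf fj fl; have [SF Fj Fl] := FP j w.
    apply/eqP; rewrite -subr_eq0; apply/eqP.
    apply: (kills (fun x => f x - F j w x)); first exact: S_sub.
    by move=> l; have [->|lj] := eqVneq l j; rewrite ?fj ?Fj ?fl ?Fl ?subrr.
  (* Any two members of [S] that agree on the other vectors agree at [v i]. So [t j w] depends only
     on [w], and this uniqueness puts [t j] in the commutant. *)
  pose t j w := F j w (v i).
  have ct j : commutant (t j).
    split=> [x y|f Sf x]; apply/esym.
      have [Sx xj xl] := FP j x; have [Sy yj yl] := FP j y.
      apply: (uniqF j (x - y) (fun z => F j x z - F j y z)); first exact: S_sub.
        by rewrite xj yj.
      by move=> l lj; rewrite xl // yl // subrr.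
    have [Sx xj xl] := FP j x.
    apply: (uniqF j (f x) (f \o F j x)) => /=; first exact: S_comp.
      by rewrite xj.
    by move=> l lj; rewrite xl // (morph_sub0 (S_morph Sf)).
  have vi : v i = \sum_j t j (v (lift i j)).
    apply/eqP; rewrite -subr_eq0; apply/eqP.
    apply: (kills (fun x => x - \sum_j F j (v (lift i j)) x)).
      by apply: S_sub => //; apply: S_sum => j; have [] := FP j (v (lift i j)).
    move=> l; rewrite (bigD1 l) //= big1 => [|j jl].
      by have [_ -> _] := FP l (v (lift i l)); rewrite addr0 subrr.
    by have [_ _ ->] := FP j (v (lift i j)); rewrite // eq_sym.
  (* The dependence relation with coefficient [-1] at [v i]: freeness makes [-1] zero on [M], so
     that [M] is trivial. *)
  pose t' l := if unlift i l is Some j then t j else fun x => - x.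
  have z (x : M) : x = 0.
    apply/eqP; rewrite -oppr_eq0; apply/eqP.
    have -> : - x = t' i x by rewrite /t' unlift_none.
    apply: free => [l|].
      rewrite /t'; case: unlift => [l'|]; first exact: ct.
      split=> [a b|f Sf a]; first by rewrite opprB addrC opprK.
      by rewrite -[- a]sub0r (S_morph Sf) (morph_sub0 (S_morph Sf)) sub0r.
    rewrite (bigD1_ord i) //= {1}/t' unlift_none.
    apply/eqP; rewrite addrC subr_eq0 vi; apply/eqP.
    by apply: eq_bigr => l _; rewrite /t' liftK.
  by exists id; split=> [||j _] //; rewrite [LHS]z ?[RHS]z.
move=> /existsNP[f] /not_implyP[Sf] /not_implyP[fk /eqP fi].
have [g Sg gf] := S_irr u fi.
exists (g \o f); split=> //=; first exact: S_comp.
move=> j; rewrite eq_sym => /unlift_some[j' -> _].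
by rewrite fk (morph_sub0 (S_morph Sg)).
Qed.

End Density.

(** By induction on the size: a reducible [p] is replaced by a proper factor, an irreducible one
    gets a root adjoined. *)
Lemma root_in_extension (F : fieldType) (p : {poly F}) : (1 < size p)%N ->
  exists (E : fieldType) (i : {rmorphism F -> E}) (x : E), root (map_poly i p) x.
Proof.
move: {2}(size p) (leqnn (size p)) => s; elim: s p => [|s IH] p; first by case: (size p).
move=> ps p1; have [irr|] := pselect (irreducible_poly p).
  have [E _ [x rx _]] := irredp_FAdjoin irr.
  by exists E, (in_alg E : {rmorphism F -> E}), x.
move=> nirr; have : ~ forall q : {poly F}, size q != 1%N -> q %| p -> q %= p.
  by move=> h; apply: nirr.
move=> /existsNP[q] /not_implyP[q1] /not_implyP[qp /negP nqp].
have np : p != 0 by rewrite -size_poly_gt0 (ltn_trans _ p1).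
have nq : q != 0 by apply: contraNneq np => q0; move: qp; rewrite q0 dvd0p.
have lt_qp : (size q < size p)%N.
  by rewrite ltn_neqAle (dvdp_leq np qp) andbT; apply: contra nqp => /eqP e; rewrite -dvdp_size_eqp // e.
have [||E [i [x rx]]] := IH q.
- by rewrite -ltnS (leq_trans lt_qp).
- by rewrite ltn_neqAle eq_sym q1 size_poly_gt0.
by exists E, i, x; rewrite -(divpK qp) rmorphM rootM rx orbT.
Qed.

(** * Splitting fields from representations of least degree *)

Section Splitting.
Variables (K : fieldType) (A : nzRingType) (c : {rmorphism K -> A}).
Variables (N : nat) (e : 'I_N -> A) (co : A -> 'I_N -> K).
Hypothesis c_comm : forall z a, GRing.comm (c z) a.
Hypothesis c_center : forall a, (forall b, GRing.comm a b) -> exists z, a = c z.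
Hypothesis A_simple : forall u : A, u != 0 ->
  exists s : seq (A * A), \sum_(p <- s) p.1 * u * p.2 = 1.
Hypothesis coP : forall a, a = \sum_i c (co a i) * e i.
Hypothesis e_free : forall z : 'I_N -> K, \sum_i c (z i) * e i = 0 -> forall i, z i = 0.

Lemma co_uniq (a : A) (z : 'I_N -> K) : a = \sum_i c (z i) * e i -> forall i, co a i = z i.
Proof.
move=> az i; apply/eqP; rewrite -subr_eq0; apply/eqP; move: i.
apply: (e_free (z := fun i => co a i - z i)).
under eq_bigr do rewrite rmorphB mulrBl.
by rewrite sumrB -coP -az subrr.
Qed.

(** The maps [a |-> \sum p.1 * a * p.2] act irreducibly on [A] by simplicity, and their commutant
    consists of the multiplications by central elements. The basis is free over it, so density
    provides the coordinate forms as such maps. *)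
Lemma sandwich_dual i : exists s : seq (A * A),
  forall j, \sum_(p <- s) p.1 * e j * p.2 = (j == i)%:R.
Proof.
pose S (f : A -> A) := exists s : seq (A * A), f = fun a => \sum_(p <- s) p.1 * a * p.2.
have S_id : S id.
  by exists [:: (1, 1)]; apply/funext => a; rewrite big_seq1 mul1r mulr1.
have S_comp f g : S f -> S g -> S (f \o g).
  move=> [s ->] [t ->]; exists [seq (p.1 * q.1, q.2 * p.2) | p <- s, q <- t].
  apply/funext => a /=; rewrite big_allpairs_dep; apply: eq_bigr => p _ /=.
  by rewrite mulr_sumr mulr_suml; apply: eq_bigr => q _; rewrite !mulrA.
have S_sub f g : S f -> S g -> S (fun x => f x - g x).
  move=> [s ->] [t ->]; exists (s ++ [seq (- q.1, q.2) | q <- t]).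
  apply/funext => a; rewrite big_cat big_map -sumrN; congr (_ + _).
  by apply: eq_bigr => q _; rewrite !mulNr.
have S_morph f : S f -> forall x y, f (x - y) = f x - f y.
  move=> [s ->] x y; rewrite -sumrB; apply: eq_bigr => p _.
  by rewrite mulrBr mulrBl.
have S_irr x y : x != 0 -> exists2 f, S f & f x = y.
  move=> /A_simple[s hs]; exists (fun a => \sum_(p <- [seq (y * p.1, p.2) | p <- s]) p.1 * a * p.2).
    by eexists.
  rewrite big_map -[RHS]mulr1 -hs mulr_sumr; apply: eq_bigr => p _ /=.
  by rewrite !mulrA.
have free : commutant_free S e.
  move=> t ct t0.
  have tl j a b : t j (a * b) = a * t j b.
    have [_ h] := ct j; apply: (h (fun x => a * x)).
    by exists [:: (a, 1)]; apply/funext => x; rewrite big_seq1 mulr1.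
  have tr j a b : t j (a * b) = t j a * b.
    have [_ h] := ct j; apply: (h (fun x => x * b)).
    by exists [:: (1, b)]; apply/funext => x; rewrite big_seq1 mul1r.
  have /choice[z hz] j : exists z, t j 1 = c z.
    by apply: c_center => b; rewrite /GRing.comm -tl -tr mulr1 mul1r.
  have te j a : t j a = c (z j) * a by rewrite -hz -tr mul1r.
  have z0 : forall j, z j = 0.
    by apply: e_free; rewrite -[RHS]t0; apply: eq_bigr => j _; rewrite te.
  by move=> j x; rewrite te z0 rmorph0 mul0r.
have [f [[s ->] f1 f0]] := jacobson_density S_id S_comp S_sub S_morph S_irr free i 1.
by exists s => j; have [->|/f0] := eqVneq j i.
Qed.

Definition representation (L : fieldType) (kap : K -> L) r (Phi : A -> 'M[L]_r) : Prop :=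
  [/\ forall x y, Phi (x - y) = Phi x - Phi y,
      forall x y, Phi (x * y) = Phi x *m Phi y,
      Phi 1 = 1%:M & forall z, Phi (c z) = (kap z)%:M].

Lemma representation0 (L : fieldType) (kap : K -> L) r (Phi : A -> 'M[L]_r) :
  representation kap Phi -> Phi 0 = 0.
Proof. by move=> [PB _ _ _]; have := PB 0 0; rewrite !subrr. Qed.

Lemma representation_sum (L : fieldType) (kap : K -> L) r (Phi : A -> 'M[L]_r)
    (I : Type) (s : seq I) (F : I -> A) :
  representation kap Phi -> Phi (\sum_(i <- s) F i) = \sum_(i <- s) Phi (F i).
Proof.
move=> rP; have [PB _ _ _] := rP; have P0 := representation0 rP.
have PD x y : Phi (x + y) = Phi x + Phi y.
  by rewrite -[y in LHS]opprK PB -[- y]sub0r PB P0 sub0r opprK.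
by elim: s => [|i s IH]; rewrite ?big_nil ?big_cons // PD IH.
Qed.

Lemma representation_basis (L : fieldType) (kap : K -> L) r (Phi : A -> 'M[L]_r) a :
  representation kap Phi -> Phi a = \sum_i kap (co a i) *: Phi (e i).
Proof.
move=> rP; have [_ PM _ Pc] := rP; rewrite {1}(coP a) (representation_sum _ _ rP).
by apply: eq_bigr => i _; rewrite PM Pc mul_scalar_mx.
Qed.

(** The extension [L] is not fixed, so a least [r] is least over all extensions at once; this does
    the work of an algebraic closure of [K]. *)
Definition has_representation (r : nat) : Prop :=
  (0 < r)%N /\ exists (L : fieldType) (kap : {rmorphism K -> L}) (Phi : A -> 'M[L]_r),
    representation kap Phi.

(** [A] acts on itself from the right, which is multiplicative for matrices acting on row
    vectors. *)
Lemma regular_representation : has_representation N.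
Proof.
split.
  case: N e co coP => [|//] e' co' h; have := h 1; rewrite big_ord0.
  by move/eqP; rewrite oner_eq0.
exists K, (idfun : {rmorphism K -> K}), (fun a => \matrix_(i, j) co (e i * a) j).
split=> [x y|x y||z].
- apply/matrixP => i j; rewrite !mxE; apply: (co_uniq (z := fun j => co (e i * x) j - co (e i * y) j)).
  under eq_bigr do rewrite rmorphB mulrBl.
  by rewrite sumrB -!coP mulrBr.
- apply/matrixP => i j; rewrite !mxE.
  pose z j := \sum_l (co (e i * x) l * co (e l * y) j).
  rewrite (co_uniq (z := z)) /z; first by apply: eq_bigr => l _; rewrite !mxE.
  under [RHS]eq_bigr do rewrite rmorph_sum mulr_suml.
  rewrite exchange_big /= mulrA {1}(coP (e i * x)) mulr_suml; apply: eq_bigr => l _.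
  rewrite -mulrA {1}(coP (e l * y)) mulr_sumr; apply: eq_bigr => j' _.
  by rewrite rmorphM mulrA.
- apply/matrixP => i j; rewrite !mxE mulr1 (co_uniq (z := fun j => (i == j)%:R)) //.
  rewrite (bigD1 i) //= eqxx rmorph1 mul1r big1 ?addr0 // => l li.
  by rewrite eq_sym (negPf li) rmorph0 mul0r.
- apply/matrixP => i j; rewrite !mxE (co_uniq (z := fun j => z *+ (i == j))) //.
  rewrite (bigD1 i) //= eqxx c_comm big1 ?addr0 // => l li.
  by rewrite eq_sym (negPf li) rmorph0 mul0r.
Qed.

Lemma subrepresentation (L : fieldType) (kap : {rmorphism K -> L}) r p
    (Phi : A -> 'M[L]_r) (U : 'M[L]_(p, r)) :
  representation kap Phi -> (forall a, (U *m Phi a <= U)%MS) -> U != 0 ->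
  has_representation (\rank U).
Proof.
move=> [PB PM P1 Pc] stab nU; split; first by rewrite lt0n mxrank_eq0.
pose B := row_base U.
have Bfree : row_free B by rewrite row_base_free.
have stabB a : (B *m Phi a <= B)%MS.
  by rewrite (eqmxMr _ (eq_row_base U)) (eq_row_base U).
pose Psi a := B *m Phi a *m pinvmx B.
have PsiB a : Psi a *m B = B *m Phi a by rewrite mulmxKpV.
exists L, kap, Psi; split=> [x y|x y||z].
- by rewrite /Psi PB mulmxBr mulmxBl.
- apply: (row_free_inj Bfree).
  by rewrite PsiB PM mulmxA -PsiB -mulmxA -PsiB mulmxA.
- by apply: (row_free_inj Bfree); rewrite PsiB P1 mulmx1 mul1mx.
- by apply: (row_free_inj Bfree); rewrite PsiB Pc mul_scalar_mx scalar_mxC mul_scalar_mx.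
Qed.

Section Minimal.
Variable r : nat.
Hypothesis r_min : forall s, has_representation s -> (r <= s)%N.
Variables (L : fieldType) (kap : {rmorphism K -> L}) (Phi : A -> 'M[L]_r).
Hypothesis r_gt0 : (0 < r)%N.
Hypothesis rP : representation kap Phi.

(** The action of the [L]-span of the image of [A] on row vectors. *)
Let S (f : 'rV[L]_r -> 'rV[L]_r) :=
  exists d : 'rV[L]_N, f = fun v => v *m \sum_i d 0 i *: Phi (e i).

Let S_Phi l a : S (fun v => l *: (v *m Phi a)).
Proof.
exists (\row_i (l * kap (co a i))); apply/funext => v.
rewrite (representation_basis a rP) scalemxAr scaler_sumr; congr (_ *m _).
by apply: eq_bigr => i _; rewrite mxE scalerA.
Qed.

(** The vectors [x *m Phi (e i)] span a nonzero subrepresentation, which is everything by minimality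
    of [r]. *)
Let S_irr (x y : 'rV[L]_r) : x != 0 -> exists2 f, S f & f x = y.
Proof.
move=> nx; have [_ PM P1 _] := rP; pose U := \matrix_(i < N) (x *m Phi (e i)).
have sub a : (x *m Phi a <= U)%MS.
  rewrite (representation_basis a rP) mulmx_sumr summx_sub // => i _.
  by rewrite -scalemxAr scalemx_sub // -(rowK (fun i => x *m Phi (e i)) i) row_sub.
have nU : U != 0.
  apply: contraNneq nx => U0; have := sub 1.
  by rewrite U0 P1 mulmx1 => /submx0null ->.
have /r_min rU : has_representation (\rank U).
  apply: (subrepresentation rP _ nU) => a; apply/row_subP => i.
  by rewrite row_mul rowK -mulmxA -PM sub.
have /submxP[D yD] : (y <= U)%MS.
  by apply: submx_full; rewrite /row_full eqn_leq rank_leq_col.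
exists (fun v => v *m \sum_i D 0 i *: Phi (e i)); first by exists D.
rewrite yD mulmx_sumr mulmx_sum_row; apply: eq_bigr => i _.
by rewrite rowK scalemxAr.
Qed.

(** Schur's lemma. An eigenvalue of [t] exists over some extension [E], and its eigenspace is a
    representation over [E]; minimality of [r] applies over [E] as well and makes [t] a scalar,
    whose entries lie in [L]. *)
Let commutant_scalar t : commutant S t -> exists d : L, forall v, t v = d *: v.
Proof.
move=> [tB tS]; have [_ PM P1 _] := rP.
have tZ l v : t (l *: v) = l *: t v.
  have := tS _ (S_Phi l 1) v; rewrite P1 !mulmx1 //.
have t0 : t 0 = 0 by have := tB 0 0; rewrite !subrr.
have tD u v : t (u + v) = t u + t v.
  by rewrite -[v in LHS]opprK tB -[- v]sub0r tB t0 sub0r opprK.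
pose D := \matrix_(i < r) t (delta_mx 0 i).
have tE v : t v = v *m D.
  rewrite {1}(row_sum_delta v) mulmx_sum_row (big_morph t tD t0).
  by apply: eq_bigr => i _; rewrite tZ rowK.
have comm a : Phi a *m D = D *m Phi a.
  apply/row_matrixP => i; rewrite !rowE !mulmxA -!tE.
  by have := tS _ (S_Phi 1 a) (delta_mx 0 i); rewrite !scale1r.
have [|E [i [x rx]]] := @root_in_extension L (char_poly D); first by rewrite size_char_poly.
move: rx; rewrite map_char_poly -eigenvalue_root_char => /= ev.
pose Phi' a := map_mx i (Phi a); pose kap' : {rmorphism K -> E} := i \o kap.
have rP' : representation kap' Phi'.
  have [PB _ _ Pc] := rP; split=> [u v|u v||z]; rewrite /Phi'.
  - by rewrite PB map_mxB.
  - by rewrite PM map_mxM.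
  - by rewrite P1 map_mx1.
  - by rewrite Pc map_scalar_mx.
pose U := eigenspace (map_mx i D) x.
have stab a : (U *m Phi' a <= U)%MS.
  apply/eigenspaceP; rewrite -mulmxA -map_mxM comm map_mxM mulmxA.
  by have /eigenspaceP -> := submx_refl U; rewrite scalemxAl.
have /r_min rU := subrepresentation rP' stab ev.
have Dx : map_mx i D = x%:M.
  have : (1%:M <= U)%MS by rewrite sub1mx /row_full eqn_leq rank_leq_col.
  by move/eigenspaceP; rewrite mul1mx scalemx1.
pose i0 := Ordinal r_gt0.
exists (D i0 i0) => v; rewrite tE -mul_mx_scalar; congr (_ *m _).
apply: (@map_mx_inj _ _ i); rewrite Dx map_scalar_mx; congr (_ %:M).
by move/matrixP/(_ i0 i0): Dx; rewrite !mxE eqxx.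
Qed.

(** The images of the basis are independent because [sandwich_dual] extracts each coefficient of a
    relation, and they span because density produces every matrix unit; counting gives
    [r * r = N]. *)
Lemma minimal_representation_basis :
  (r * r)%N = N /\ row_free (\matrix_(i < N) mxvec (Phi (e i))).
Proof.
have [_ PM P1 _] := rP; set X := \matrix_i _.
have free : row_free X.
  apply/inj_row_free => v vX.
  have vP : \sum_i v 0 i *: Phi (e i) = 0.
    apply: (can_inj mxvecK); rewrite linear0 -[RHS]vX mulmx_sum_row linear_sum.
    by apply: eq_bigr => i _; rewrite linearZ /= rowK.
  apply/rowP => i; rewrite mxE; have [s hs] := sandwich_dual i.
  have : \sum_(p <- s) Phi p.1 *m (\sum_j v 0 j *: Phi (e j)) *m Phi p.2 = 0.
    by rewrite vP big1_seq // => p _; rewrite mulmx0 mul0mx.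
  under eq_bigr do rewrite mulmx_sumr mulmx_suml.
  rewrite exchange_big /= (bigD1 i) //= [X in _ + X]big1 ?addr0.
    under eq_bigr do rewrite -scalemxAr -scalemxAl -!PM.
    rewrite -scaler_sumr -(representation_sum _ _ rP) hs eqxx P1 scalemx1.
    by move/matrixP/(_ (Ordinal r_gt0) (Ordinal r_gt0)); rewrite !mxE eqxx mulr1n.
  move=> j ji; under eq_bigr do rewrite -scalemxAr -scalemxAl -!PM.
  by rewrite -scaler_sumr -(representation_sum _ _ rP) hs (negPf ji) (representation0 rP) scaler0.
have full : row_full X.
  have S_id : S id.
    have := S_Phi 1 1; rewrite P1; congr S.
    by apply/funext => v; rewrite mulmx1 scale1r.
  have S_comp f g : S f -> S g -> S (f \o g).
    move=> [d ->] [d' ->]; pose a i := \sum_j (d' 0 j * d 0 i).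
    exists (\row_l \sum_i \sum_j (d' 0 j * d 0 i * kap (co (e j * e i) l))).
    apply/funext => v /=; rewrite -mulmxA; congr (_ *m _).
    under [RHS]eq_bigr do rewrite mxE scaler_suml.
    rewrite exchange_big mulmx_sumr; apply: eq_bigr => i _.
    under [RHS]eq_bigr do rewrite scaler_suml.
    rewrite exchange_big mulmx_suml; apply: eq_bigr => j _ /=.
    rewrite -scalemxAl -scalemxAr scalerA -PM (representation_basis _ rP) scaler_sumr.
    by apply: eq_bigr => l _; rewrite scalerA.
  have S_sub f g : S f -> S g -> S (fun x => f x - g x).
    move=> [d ->] [d' ->]; exists (d - d'); apply/funext => v.
    rewrite -mulmxBr -sumrB; congr (_ *m _).
    by apply: eq_bigr => i _; rewrite !mxE scalerBl.
  have S_morph f : S f -> forall x y, f (x - y) = f x - f y.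
    by move=> [d ->] x y; rewrite mulmxBl.
  have fr : commutant_free S (fun i : 'I_r => delta_mx 0 i : 'rV[L]_r).
    move=> t ct t0; have /choice[d hd] i := commutant_scalar (ct i).
    move=> i x; rewrite hd; suff -> : d i = 0 by rewrite scale0r.
    have := t0; under eq_bigr do rewrite hd.
    move=> /rowP/(_ i); rewrite summxE mxE (bigD1 i) //= big1 => [|j ji].
      by rewrite !mxE !eqxx mulr1 addr0.
    by rewrite !mxE eqxx eq_sym (negPf ji) mulr0.
  rewrite -sub1mx; apply/row_subP => l; rewrite row1.
  case/mxvec_indexP: l => i j; rewrite -mxvec_delta.
  have [f [[d ->] f1 f0]] := jacobson_density S_id S_comp S_sub S_morph S_irr fr i (delta_mx 0 j).
  have -> : delta_mx i j = \sum_l d 0 l *: Phi (e l).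
    apply/row_matrixP => i'; rewrite !rowE; have [->|ni] := eqVneq i' i.
      by rewrite f1 mul_delta_mx.
    by rewrite f0 // mul_delta_mx_0.
  rewrite linear_sum summx_sub // => l _; rewrite linearZ scalemx_sub //=.
  by rewrite -(rowK (fun i => mxvec (Phi (e i))) l) row_sub.
by split=> //; apply/eqP; move: free; rewrite /row_free (eqP full).
Qed.

End Minimal.

Lemma splitting_field : exists (r : nat) (L : fieldType) (kap : {rmorphism K -> L})
    (Phi : A -> 'M[L]_r), [/\ (r * r)%N = N, representation kap Phi &
      row_free (\matrix_(i < N) mxvec (Phi (e i)))].
Proof.
have ex : exists r, `[< has_representation r >].
  by exists N; apply/asboolP; exact: regular_representation.
case: (ex_minnP ex) => r /asboolP[r0 [L [kap [Phi rP]]]] rmin.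
have [|rN fr] := @minimal_representation_basis r _ L kap Phi r0 rP.
  by move=> s hs; apply: rmin; apply/asboolP.
by exists r, L, kap, Phi.
Qed.

End Splitting.

(** * Conjugacy of matrix families and coordinates *)

(** Over a field it is invertible exactly when [u] is a basis of the matrix algebra. *)
Definition vec_matrix (R : Type) n (u : 'I_(n * n) -> 'M[R]_n) : 'M[R]_(n * n) :=
  \matrix_l mxvec (u l).

Section SkolemNoether.
Variables (F : fieldType) (n : nat).
Hypothesis n_gt0 : (0 < n)%N.
Implicit Types a b : 'M[F]_n.

(** The columns of [h] are the [t (delta_mx i i0) *m c]. The rule for [a *m delta_mx i i0] shows
    that [h] intertwines the standard action of [a] with that of [t a]; [c] is chosen to make [h]
    nonzero. *)
Lemma matrix_endomorphism_inner (t : {linear 'M[F]_n -> 'M[F]_n}) :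
  (forall a b, t (a *m b) = t a *m t b) -> (forall a, t a = 0 -> a = 0) ->
  exists2 h : 'M[F]_n, h \in unitmx & forall a, t a *m h = h *m a.
Proof.
move=> tM t0; pose i0 := Ordinal n_gt0; pose E i := t (delta_mx i i0).
have [c nc] : exists c : 'cV[F]_n, E i0 *m c != 0.
  have : E i0 != 0.
    apply/eqP => /t0/matrixP/(_ i0 i0); rewrite !mxE !eqxx => /eqP.
    by rewrite oner_eq0.
  move/matrix0Pn => [s [u nsu]]; exists (delta_mx u 0).
  apply: contraNneq nsu; rewrite -colE => /colP/(_ s).
  by rewrite !mxE => ->.
pose h := \matrix_(s, i) (E i *m c) s 0.
have colh i : col i h = E i *m c by apply/colP => s; rewrite !mxE.
have ha a : t a *m h = h *m a.
  apply/matrixP => s i; have -> : (h *m a) s i = col i (h *m a) s 0 by rewrite [RHS]mxE.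
  have -> : (t a *m h) s i = col i (t a *m h) s 0 by rewrite [RHS]mxE.
  have aE : a *m delta_mx i i0 = \sum_j a j i *: delta_mx j i0.
    apply/matrixP => u v; rewrite summxE !mxE (bigD1 i) //= big1 => [|j ji]; last first.
      by rewrite !mxE (negPf ji) mulr0.
    rewrite (bigD1 u) //= big1 => [|j ju]; last by rewrite !mxE eq_sym (negPf ju) mulr0.
    by rewrite !mxE !eqxx !addr0.
  have -> : col i (t a *m h) = t (a *m delta_mx i i0) *m c.
    by rewrite tM -mulmxA -[_ *m c]colh !colE mulmxA.
  rewrite aE linear_sum mulmx_suml mxE summxE mxE; apply: eq_bigr => j _.
  by rewrite linearZ -scalemxAl !mxE mulrC.
exists h => //; rewrite -unitmx_tr -row_free_unit.
apply/inj_row_free => v; move/(congr1 trmx); rewrite trmx_mul trmxK trmx0 => hv.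
apply: contrapT => /eqP/rV0Pn[j vj]; move/eqP: nc; apply.
rewrite -colh colE.
(* A nonzero vector in the kernel of [h] generates all columns under matrices, so [h] would kill the
   basis vector at [i0], whose image is [E i0 *m c]. *)
have -> : delta_mx i0 0 = (v 0 j)^-1 *: (delta_mx i0 j *m v^T) :> 'cV[F]_n.
  apply/colP => u; rewrite !mxE (bigD1 j) //= big1 => [|l lj].
    by rewrite !mxE eqxx andbT addr0 mulrC -mulrA mulfV ?mulr1 // eqxx andbT.
  by rewrite !mxE (negPf lj) andbF mul0r.
by rewrite -scalemxAr mulmxA -ha -mulmxA hv mulmx0 scaler0.
Qed.

Lemma vec_matrix_span u a : vec_matrix u \in unitmx ->
  a = \sum_l (mxvec a *m invmx (vec_matrix u)) 0 l *: u l.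
Proof.
move=> uu; have := mulmxKV uu (mxvec a); set d := mxvec a *m _ => da.
apply: (can_inj mxvecK); rewrite -da mulmx_sum_row linear_sum.
by apply: eq_bigr => l _; rewrite linearZ rowK.
Qed.

Lemma vec_matrix_free u (d : 'rV[F]_(n * n)) : vec_matrix u \in unitmx ->
  \sum_l d 0 l *: u l = 0 -> d = 0.
Proof.
rewrite -row_free_unit => uu du; apply: (row_free_inj uu); rewrite mul0mx.
rewrite mulmx_sum_row -[RHS](linear0 mxvec) -du linear_sum.
by apply: eq_bigr => l _; rewrite linearZ /= rowK.
Qed.

(** The linear map sending [u i] to [w i] is multiplicative because the structure constants agree,
    hence inner. *)
Lemma same_structure_conjugate (u w : 'I_(n * n) -> 'M[F]_n)
    (g : 'I_(n * n) -> 'I_(n * n) -> 'I_(n * n) -> F) :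
  vec_matrix u \in unitmx -> vec_matrix w \in unitmx ->
  (forall i j, u i *m u j = \sum_l g i j l *: u l) ->
  (forall i j, w i *m w j = \sum_l g i j l *: w l) ->
  exists2 h : 'M[F]_n, h \in unitmx & forall i, w i = h *m u i *m invmx h.
Proof.
move=> uu uw us ws.
pose t a := vec_mx (mxvec a *m invmx (vec_matrix u) *m vec_matrix w).
have tl : linear t.
  by move=> c a b; rewrite /t linearP /= !mulmxDl -!scalemxAl linearP.
have [T Tt] : exists T : {linear 'M[F]_n -> 'M[F]_n}, forall a, T a = t a.
  by exists (HB.pack_for {linear 'M[F]_n -> 'M[F]_n} t
    (GRing.isLinear.Build _ _ _ _ t tl)).
have TZ c a : T (c *: a) = c *: T a by rewrite linearZ.
have tu i : T (u i) = w i.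
  by rewrite Tt /t -(rowK (fun l => mxvec (u l)) i) -row_mul mulmxV // row1 -rowE rowK mxvecK.
have TE (d : 'I_(n * n) -> F) : T (\sum_i d i *: u i) = \sum_i d i *: w i.
  by rewrite linear_sum; apply: eq_bigr => i _; rewrite TZ tu.
have tM a b : T (a *m b) = T a *m T b.
  rewrite (vec_matrix_span a uu) (vec_matrix_span b uu).
  set d := mxvec a *m _; set d' := mxvec b *m _.
  rewrite !TE !mulmx_suml linear_sum; apply: eq_bigr => i _.
  rewrite !mulmx_sumr linear_sum; apply: eq_bigr => j _.
  by rewrite -!scalemxAl -!scalemxAr us ws !TZ TE.
have t0 a : T a = 0 -> a = 0.
  move/(congr1 mxvec); rewrite Tt vec_mxK linear0 => /(congr1 (mulmx^~ (invmx (vec_matrix w)))).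
  rewrite mulmxK // mul0mx => /(congr1 (mulmx^~ (vec_matrix u))).
  by rewrite mulmxKV // mul0mx => /(congr1 vec_mx); rewrite mxvecK linear0.
have [h uh hP] := matrix_endomorphism_inner tM t0.
by exists h => // i; rewrite -hP tu mulmxK.
Qed.

Lemma commutes_with_all_scalar (h : 'M[F]_n) :
  (forall a, h *m a = a *m h) -> exists c, h = c%:M.
Proof.
move=> hc; pose i0 := Ordinal n_gt0; exists (h i0 i0); apply/matrixP => i j; rewrite mxE.
have /matrixP/(_ i0 j) := hc (delta_mx i0 i).
have -> : (h *m delta_mx i0 i) i0 j = h i0 i0 *+ (i == j).
  rewrite mxE (bigD1 i0) //= big1 => [|l li]; last by rewrite !mxE (negPf li) mulr0.
  by rewrite !mxE eqxx addr0 /= eq_sym mulr_natr.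
rewrite mxE (bigD1 i) //= big1 => [|l li]; last by rewrite !mxE (negPf li) andbF mul0r.
by rewrite !mxE !eqxx addr0 mul1r => ->.
Qed.

End SkolemNoether.

(** * Coordinates on tuples of matrices and scalars *)

Section Points.
Variables (n N r : nat).

Definition coord_index : finType := ('I_N * ('I_n * 'I_n) + 'I_r)%type.
Local Notation m := #|coord_index|.

Definition point (R : Type) (E : 'I_N -> 'M[R]_n) (z : 'I_r -> R) (i : 'I_m) : R :=
  match enum_val i with
  | inl p => E p.1 p.2.1 p.2.2
  | inr j => z j
  end.

Lemma point_map (R S : Type) (f : R -> S) E z i :
  f (point E z i) = point (fun l => map_mx f (E l)) (f \o z) i.
Proof. by rewrite /point; case: enum_val => // p; rewrite mxE. Qed.

Lemma eq_point (R : Type) (E E' : 'I_N -> 'M[R]_n) (z z' : 'I_r -> R) :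
  E =1 E' -> z =1 z' -> point E z =1 point E' z'.
Proof. by move=> eE ez i; rewrite /point; case: enum_val => // p; rewrite eE. Qed.

Variable k : nzRingType.

Definition mat_var (l : 'I_N) : 'M[{mpoly k[m]}]_n :=
  \matrix_(s, t) 'X_(enum_rank (inl (l, (s, t)) : coord_index)).

Definition scal_var (j : 'I_r) : {mpoly k[m]} := 'X_(enum_rank (inr j : coord_index)).

Variables (S : comNzRingType) (f : {rmorphism k -> S}).

Lemma mat_varE E z l : map_mx (mmap f (point E z)) (mat_var l) = E l.
Proof. by apply/matrixP => s t; rewrite !mxE mmapU /point enum_rankK. Qed.

Lemma scal_varE E z j : mmap f (point E z) (scal_var j) = z j.
Proof. by rewrite mmapU /point enum_rankK. Qed.

Definition scal_poly (P : {mpoly k[r]}) : {mpoly k[m]} := mmap (@mpolyC _ k) scal_var P.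

End Points.

Section Substitution.
Variables (n N r : nat) (k : comNzRingType) (S : comNzRingType) (f : {rmorphism k -> S}).
Local Notation m := #|coord_index n N r|.

(** Composition of [p] with the polynomial self-map of the coordinate space given by [E] and [z]. *)
Definition substitute (E : 'I_N -> 'M[{mpoly k[m]}]_n) (z : 'I_r -> {mpoly k[m]})
    (p : {mpoly k[m]}) : {mpoly k[m]} :=
  mmap (@mpolyC _ k) (point E z) p.

Lemma mmap_eq (v w : 'I_m -> S) p : v =1 w -> mmap f v p = mmap f w p.
Proof. by move=> /funext ->. Qed.

Lemma substituteE E z E' z' p :
  mmap f (point E z) (substitute E' z' p) =
  mmap f (point (fun l => map_mx (mmap f (point E z)) (E' l)) (mmap f (point E z) \o z')) p.
Proof.
rewrite /substitute (mmap_mmap (fg := f) (w := mmap f (point E z) \o point E' z')) //.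
  by apply: mmap_eq => i; exact: (point_map (mmap f (point E z))).
by move=> c; exact: mmapC.
Qed.

Lemma scal_polyE E z (P : {mpoly k[r]}) : mmap f (point E z) (scal_poly n N P) = mmap f z P.
Proof.
rewrite /scal_poly (mmap_mmap (fg := f) (w := z)) // => [c|j]; first exact: mmapC.
exact: scal_varE.
Qed.

End Substitution.

(** * The variety attached to an algebra with involution *)

Lemma invmx_mul (R : comUnitRingType) n (a b : 'M[R]_n) :
  a \in unitmx -> b \in unitmx -> invmx (a *m b) = invmx b *m invmx a.
Proof.
move=> ua ub; have uab : a *m b \in unitmx by rewrite unitmx_mul ua.
apply: (can_inj (mulKmx uab)); rewrite mulmxV // -mulmxA (mulmxA b) mulmxV //.
by rewrite mul1mx mulmxV.
Qed.

(** [g] stands for the inverse of [h]; as a separate argument it can be transported along ring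
    morphisms. *)
Definition conj_family (R : nzRingType) n N (h g : 'M[R]_n) (E : 'I_N -> 'M[R]_n) l :=
  h *m E l *m g.

(* Restriction to the line through two matrices reduces primality of the ideal of the
   variety to that of one-variable polynomials. *)
Section Pencil.
Variables (k : fieldType) (L : fieldType) (io : {rmorphism k -> L}) (n : nat).
Variables h1 h2 : 'M[k]_n.

Definition pencil : 'M[{poly k}]_n :=
  map_mx polyC h1 + 'X *: map_mx polyC (h2 - h1).

Definition pencil_at (t : k) : 'M[k]_n := h1 + t *: (h2 - h1).

Lemma pencil_atE t : pencil_at t = map_mx (horner_eval t) pencil.
Proof.
apply/matrixP => i j.
by rewrite !mxE /horner_eval hornerD hornerM hornerX !hornerC.
Qed.

Lemma pencil_at0 : pencil_at 0 = h1. Proof. by rewrite /pencil_at scale0r addr0. Qed.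
Lemma pencil_at1 : pencil_at 1 = h2. Proof. by rewrite /pencil_at scale1r addrC subrK. Qed.

Lemma det_pencil_at t : \det (pencil_at t) = (\det pencil).[t].
Proof. by rewrite pencil_atE det_map_mx. Qed.

(** Off the zeros of the determinant, [u] is a polynomial in [t] over a power of that determinant,
    as are the entries of the inverse of the pencil. *)
Definition pencil_regular (u : k -> L) : Prop :=
  exists (s : nat) (P : {poly L}), forall t, \det (pencil_at t) != 0 ->
    P.[io t] = io (\det (pencil_at t)) ^+ s * u t.

Let D := map_poly io (\det pencil).

Let DE t : D.[io t] = io (\det (pencil_at t)).
Proof. by rewrite /D horner_map det_pencil_at. Qed.

Lemma pencil_regular_poly (p : {poly L}) : pencil_regular (fun t => p.[io t]).
Proof. by exists 0%N, p => t _; rewrite expr0 mul1r. Qed.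

Lemma pencil_regular_cst c : pencil_regular (fun=> c).
Proof. by exists 0%N, c%:P => t _; rewrite hornerC expr0 mul1r. Qed.

Lemma pencil_regularD u v : pencil_regular u -> pencil_regular v ->
  pencil_regular (fun t => u t + v t).
Proof.
move=> [s [P hP]] [s' [P' hP']]; exists (s + s')%N, (P * D ^+ s' + P' * D ^+ s) => t dt.
rewrite hornerD !hornerM !horner_exp DE hP // hP' // exprD mulrDr -!mulrA.
by rewrite [u t * _]mulrC [v t * _]mulrC !mulrA [X in _ + X * _]mulrC.
Qed.

Lemma pencil_regularM u v : pencil_regular u -> pencil_regular v ->
  pencil_regular (fun t => u t * v t).
Proof.
move=> [s [P hP]] [s' [P' hP']]; exists (s + s')%N, (P * P') => t dt.
by rewrite hornerM hP // hP' // exprD mulrACA.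
Qed.

Lemma pencil_regular_sum (I : Type) (s : seq I) (u : I -> k -> L) :
  (forall i, pencil_regular (u i)) -> pencil_regular (fun t => \sum_(i <- s) u i t).
Proof.
move=> hu; elim: s => [|i s IH].
  by under eq_fun do rewrite big_nil; exact: pencil_regular_cst.
by under eq_fun do rewrite big_cons; apply: pencil_regularD.
Qed.

Lemma pencil_regular_prod (I : Type) (s : seq I) (u : I -> k -> L) :
  (forall i, pencil_regular (u i)) -> pencil_regular (fun t => \prod_(i <- s) u i t).
Proof.
move=> hu; elim: s => [|i s IH].
  by under eq_fun do rewrite big_nil; exact: pencil_regular_cst.
by under eq_fun do rewrite big_cons; apply: pencil_regularM.
Qed.

Lemma pencil_regular_mmap m (v : k -> 'I_m -> L) (p : {mpoly k[m]}) :
  (forall i, pencil_regular (fun t => v t i)) ->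
  pencil_regular (fun t => mmap io (v t) p).
Proof.
move=> hv; rewrite /mmap; apply: pencil_regular_sum => a.
apply: pencil_regularM; first exact: pencil_regular_cst.
apply: pencil_regular_prod => i; elim: (a i) => [|b IH].
  by under eq_fun do rewrite expr0; exact: pencil_regular_cst.
by under eq_fun do rewrite exprS; apply: pencil_regularM.
Qed.

Definition pencil_regular_mx r s (u : k -> 'M[L]_(r, s)) : Prop :=
  forall i j, pencil_regular (fun t => u t i j).

Lemma pencil_regular_mulmx p q r (u : k -> 'M[L]_(p, q)) (v : k -> 'M[L]_(q, r)) :
  pencil_regular_mx u -> pencil_regular_mx v ->
  pencil_regular_mx (fun t => u t *m v t).
Proof.
move=> hu hv i j; under eq_fun do rewrite mxE.
by apply: pencil_regular_sum => l; apply: pencil_regularM.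
Qed.

Lemma pencil_regular_pencil : pencil_regular_mx (fun t => map_mx io (pencil_at t)).
Proof.
move=> i j; have -> : (fun t => map_mx io (pencil_at t) i j) =
    (fun t => (map_poly io (pencil i j)).[io t]).
  by apply/funext => t; rewrite mxE horner_map pencil_atE mxE.
exact: pencil_regular_poly.
Qed.

Lemma pencil_regular_inv : pencil_regular_mx (fun t => map_mx io (invmx (pencil_at t))).
Proof.
move=> i j; exists 1%N, (map_poly io ((\adj pencil) i j)) => t dt.
have ut : pencil_at t \in unitmx by rewrite unitmxE unitfE.
rewrite expr1 horner_map [X in _ = _ * X]mxE -rmorphM /invmx ut [X in _ = io (_ * X)]mxE mulrA mulfV // mul1r.
by rewrite pencil_atE -map_mx_adj [X in _ = io X]mxE.
Qed.

(** The two numerators and the determinant are nonzero polynomials in [t], and [k] is infinite. *)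
Lemma pencil_common_nonzero (u v : k -> L) : [pchar k] =i pred0 ->
  h1 \in unitmx -> h2 \in unitmx -> pencil_regular u -> pencil_regular v ->
  u 0 != 0 -> v 1 != 0 -> exists t, [/\ pencil_at t \in unitmx, u t != 0 & v t != 0].
Proof.
rewrite !unitmxE !unitfE => char0 d1 d2 [s [P hP]] [s' [P' hP']] u0 v1.
have P0 : P != 0.
  apply: contraNneq u0 => P0; have := hP 0; rewrite pencil_at0 => /(_ d1)/esym/eqP.
  by rewrite P0 horner0 mulf_eq0 expf_eq0 fmorph_eq0 (negPf d1) andbF.
have P'0 : P' != 0.
  apply: contraNneq v1 => P0'; have := hP' 1; rewrite pencil_at1 => /(_ d2)/esym/eqP.
  by rewrite P0' horner0 mulf_eq0 expf_eq0 fmorph_eq0 (negPf d2) andbF.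
have D0 : D != 0.
  apply: contraNneq d1 => D0; have := DE 0; rewrite D0 horner0 pencil_at0 => /esym/eqP.
  by rewrite fmorph_eq0.
have nz : P * P' * D != 0 by rewrite !mulf_neq0.
have [t + _] := infinite_avoid io [::] char0 nz.
rewrite !hornerM !mulf_eq0 !negb_or DE fmorph_eq0 -andbA => /and3P[pt p't dt].
exists t; split; first by rewrite unitmxE unitfE.
  by apply: contraNneq pt => ut; rewrite hP // ut mulr0.
by apply: contraNneq p't => ut; rewrite hP' // ut mulr0.
Qed.

End Pencil.

(* An algebra with involution over its center [mK], with involution [ms]: [mg] are the
   structure constants of the chosen basis as polynomials in the generators [mz] of the
   center, [mx] are the images of the basis under a splitting over [mL], and [mzs], [mxs]
   tell which generators and basis elements are skew. *)
Record split_model (k : closedFieldType) (n : nat) := SplitModel {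
  mr : nat;
  mK : fieldType;
  mL : fieldType;
  mi : {rmorphism k -> mK};
  ms : {rmorphism mK -> mK};
  mkap : {rmorphism mK -> mL};
  mz : 'I_mr -> mK;
  mx : 'I_(n * n) -> 'M[mL]_n;
  mzs : 'I_mr -> bool;
  mxs : 'I_(n * n) -> bool;
  mg : 'I_(n * n) -> 'I_(n * n) -> 'I_(n * n) -> {mpoly k[mr]};
  m_n_gt0 : (0 < n)%N;
  m_char0 : [pchar k] =i pred0;
  ms_mi : forall c, ms (mi c) = mi c;
  ms_mz : forall j, ms (mz j) = (-1) ^+ mzs j * mz j;
  mx_mul : forall i j, mx i *m mx j = \sum_l mkap (mmap mi mz (mg i j l)) *: mx l;
  mx_basis : vec_matrix mx \in unitmx;
  mg_sign : forall i j l, (-1) ^+ mxs l * ms (mmap mi mz (mg i j l)) =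
    (-1) ^+ mxs i * (-1) ^+ mxs j * mmap mi mz (mg j i l);
  mz_gen : forall a : mK, exists P Q : {mpoly k[mr]},
    mmap mi mz Q != 0 /\ a * mmap mi mz Q = mmap mi mz P
}.

Arguments mz {k n} _ _.
Arguments mzs {k n} _ _.

(** * The ideal of the conjugates of the [L]-point *)

Section Locus.
Variables (k : closedFieldType) (n : nat) (d : split_model k n).
Local Notation r := (mr d).
Local Notation N := (n * n)%N.
Local Notation m := #|coord_index n N r|.
Local Notation K := (mK d).
Local Notation L := (mL d).
Local Notation kap := (mkap d).
Implicit Types (p q : {mpoly k[m]}) (P Q : {mpoly k[r]}) (h g : 'M[k]_n).

Definition mio : {rmorphism k -> L} := kap \o mi d.
Definition zL : 'I_r -> L := kap \o mz d.
Definition evK P : K := mmap (mi d) (mz d) P.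
(** The value of [p] at the conjugate by [h] of the [L]-point given by [mx] and [zL]. *)
Definition evL h p : L :=
  mmap mio (point (conj_family (map_mx mio h) (map_mx mio (invmx h)) (mx d)) zL) p.

Definition space : Type := (('I_N -> 'M[k]_n) * ('I_r -> k))%type.
Implicit Types (v w : space).

Definition coords v : 'I_m -> k := point v.1 v.2.

Definition vanishing p : Prop := forall h, h \in unitmx -> evL h p = 0.

Definition locus v : Prop := forall p, vanishing p -> p.@[coords v] = 0.

Definition conj_space h v : space := (conj_family h (invmx h) v.1, v.2).

Definition tau_space v : space :=
  (fun l => (-1) ^+ mxs d l *: (v.1 l)^T, fun j => (-1) ^+ mzs d j * v.2 j).

Definition conj_poly h p : {mpoly k[m]} :=
  substitute (conj_family (map_mx (@mpolyC _ _) h) (map_mx (@mpolyC _ _) (invmx h))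
    (@mat_var n N r k)) (@scal_var n N r k) p.

Definition tau_poly p : {mpoly k[m]} :=
  substitute (fun l => (-1) ^+ mxs d l *: (@mat_var n N r k l)^T)
    (fun j => (-1) ^+ mzs d j * @scal_var n N r k j) p.

Definition tau_scal P : {mpoly k[r]} :=
  mmap (@mpolyC _ k) (fun j => (-1) ^+ mzs d j * 'X_j) P.

(** It is nonzero where the matrix coordinates form a basis of the matrix algebra; this open set is
    where fibers over the central coordinates are single orbits. *)
Definition det_poly : {mpoly k[m]} := \det (vec_matrix (@mat_var n N r k)).

Local Notation scal := (scal_poly n N).

Section Evaluation.
Variables (S : comNzRingType) (f : {rmorphism k -> S}).
Variables (E : 'I_N -> 'M[S]_n) (z : 'I_r -> S).

Lemma map_mx_mpolyC a b (h : 'M[k]_(a, b)) :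
  map_mx (mmap f (point E z)) (map_mx (@mpolyC m k) h) = map_mx f h.
Proof. by apply/matrixP => s t; rewrite !mxE mmapC. Qed.

Lemma conj_polyE h p : mmap f (point E z) (conj_poly h p) =
  mmap f (point (conj_family (map_mx f h) (map_mx f (invmx h)) E) z) p.
Proof.
rewrite substituteE; apply: mmap_eq; apply: eq_point => [l|j] /=; last exact: scal_varE.
by rewrite /conj_family !map_mxM !map_mx_mpolyC mat_varE.
Qed.

Lemma tau_polyE p : mmap f (point E z) (tau_poly p) =
  mmap f (point (fun l => (-1) ^+ mxs d l *: (E l)^T) (fun j => (-1) ^+ mzs d j * z j)) p.
Proof.
rewrite substituteE; apply: mmap_eq; apply: eq_point => [l|j] /=.
  by rewrite map_mxZ -map_trmx mat_varE rmorphXn rmorphN1.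
by rewrite rmorphM /= scal_varE rmorphXn rmorphN1.
Qed.

Lemma det_polyE : mmap f (point E z) det_poly = \det (vec_matrix E).
Proof.
rewrite -det_map_mx; congr (\det _); apply/matrixP => i j; rewrite !mxE.
case/mxvec_indexP: j => s t.
by rewrite !mxvecE; have /matrixP/(_ s t) := mat_varE f E z i; rewrite mxE.
Qed.

Lemma tau_scalE P : mmap f z (tau_scal P) = mmap f (fun j => (-1) ^+ mzs d j * z j) P.
Proof.
rewrite /tau_scal (mmap_mmap (fg := f) (w := fun j => (-1) ^+ mzs d j * z j)) // => [c|j].
  exact: mmapC.
by rewrite rmorphM /= mmapU rmorphXn rmorphN1.
Qed.

End Evaluation.

Lemma coords_conj_poly h v p : (conj_poly h p).@[coords v] = p.@[coords (conj_space h v)].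
Proof.
rewrite /meval (conj_polyE (idfun : {rmorphism k -> k})); apply: mmap_eq.
by apply: eq_point => // l; rewrite !map_mx_id.
Qed.

Lemma coords_tau_poly v p : (tau_poly p).@[coords v] = p.@[coords (tau_space v)].
Proof. exact: (tau_polyE (idfun : {rmorphism k -> k})). Qed.

Lemma coords_det v : det_poly.@[coords v] = \det (vec_matrix v.1).
Proof. exact: (det_polyE (idfun : {rmorphism k -> k})). Qed.

Lemma coords_scal v P : (scal P).@[coords v] = P.@[v.2].
Proof. exact: (scal_polyE (idfun : {rmorphism k -> k})). Qed.

Lemma coords_mat_var v l : map_mx (meval (coords v)) (@mat_var n N r k l) = v.1 l.
Proof. exact: (mat_varE (idfun : {rmorphism k -> k})). Qed.

Lemma evLB h p q : evL h (p - q) = evL h p - evL h q.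
Proof. exact: rmorphB. Qed.

Lemma evLM h p q : evL h (p * q) = evL h p * evL h q.
Proof. exact: rmorphM. Qed.

Lemma evL_scal h P : evL h (scal P) = kap (evK P).
Proof.
by rewrite /evL scal_polyE /evK; apply/esym; apply: mmap_mmap.
Qed.

Lemma conj_familyM (R : comUnitRingType) (a b : 'M[R]_n) (E : 'I_N -> 'M[R]_n) :
  a \in unitmx -> b \in unitmx ->
  conj_family (a *m b) (invmx (a *m b)) E =
  conj_family a (invmx a) (conj_family b (invmx b) E).
Proof.
by move=> ua ub; apply/funext => l; rewrite /conj_family invmx_mul // !mulmxA.
Qed.

Lemma evL_conj_poly h g p : h \in unitmx -> g \in unitmx ->
  evL g (conj_poly h p) = evL (h *m g) p.
Proof.
move=> uh ug; rewrite /evL conj_polyE; apply: mmap_eq; apply: eq_point => // l.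
by rewrite /conj_family invmx_mul // !map_mxM !mulmxA.
Qed.

Lemma vanishing_conj h p : h \in unitmx -> vanishing p -> vanishing (conj_poly h p).
Proof.
move=> uh vp g ug; rewrite evL_conj_poly // vp //.
by rewrite unitmx_mul uh.
Qed.

Lemma locus_conj h v : h \in unitmx -> locus v -> locus (conj_space h v).
Proof.
by move=> uh lv p vp; rewrite -coords_conj_poly lv //; exact: vanishing_conj.
Qed.

Lemma not_vanishing p : ~ vanishing p -> exists2 h, h \in unitmx & evL h p != 0.
Proof. by move=> /existsNP[h] /not_implyP[uh /eqP hp]; exists h. Qed.

(** If [p] is nonzero at the conjugate by [h1] and [q] at that by [h2], then on the line through
    [h1] and [h2] some invertible matrix makes both nonzero, and values lie in the field [L]. *)
Lemma vanishing_prime p q : vanishing (p * q) -> vanishing p \/ vanishing q.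
Proof.
move=> vpq; apply: contrapT => /not_orP[/not_vanishing[h1 u1 e1] /not_vanishing[h2 u2 e2]].
have reg p' : pencil_regular mio h1 h2 (fun t => evL (pencil_at h1 h2 t) p').
  apply: pencil_regular_mmap => i; rewrite /point; case: enum_val => [[l [s t]]|j] /=.
    apply: pencil_regular_mulmx; last exact: pencil_regular_inv.
    apply: pencil_regular_mulmx; first exact: pencil_regular_pencil.
    by move=> a b; exact: pencil_regular_cst.
  exact: pencil_regular_cst.
have [||t [ut pt qt]] := pencil_common_nonzero (m_char0 d) u1 u2 (reg p) (reg q).
- by rewrite pencil_at0.
- by rewrite pencil_at1.
by have := vpq _ ut; rewrite evLM => /eqP; rewrite mulf_eq0 (negPf pt) (negPf qt).
Qed.

Lemma det_not_vanishing : ~ vanishing det_poly.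
Proof.
move=> /(_ 1%:M (unitmx1 _ _)); rewrite /evL det_polyE.
have -> : conj_family (map_mx mio 1%:M) (map_mx mio (invmx 1%:M)) (mx d) = mx d.
  by apply/funext => l; rewrite /conj_family invmx1 !map_mx1 mul1mx mulmx1.
by apply/eqP; rewrite -unitfE -unitmxE mx_basis.
Qed.

(** Conjugation fixes the central coordinates, so the polynomials in them that vanish are the
    relations between the generators of [K]. *)
Lemma scal_vanishing P : vanishing (scal P) <-> evK P = 0.
Proof.
split=> [/(_ 1%:M (unitmx1 _ _))|e0 h _]; rewrite evL_scal ?e0 ?rmorph0 //.
by move/eqP; rewrite fmorph_eq0 => /eqP.
Qed.

Lemma locus_center v P : locus v -> evK P = 0 -> P.@[v.2] = 0.
Proof. by move=> lv /scal_vanishing/lv; rewrite coords_scal. Qed.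

Definition structure_poly i j : 'M[{mpoly k[m]}]_n :=
  @mat_var n N r k i *m @mat_var n N r k j - \sum_l scal (mg d i j l) *: @mat_var n N r k l.

(** The multiplication rules are polynomial in all coordinates and hold at every conjugate of the
    [L]-point, so they belong to the ideal entrywise. *)
Lemma locus_structure v i j : locus v ->
  v.1 i *m v.1 j = \sum_l (mg d i j l).@[v.2] *: v.1 l.
Proof.
move=> lv; apply/eqP; rewrite -subr_eq0; apply/eqP.
have -> : v.1 i *m v.1 j - \sum_l (mg d i j l).@[v.2] *: v.1 l =
    map_mx (meval (coords v)) (structure_poly i j).
  rewrite map_mxB map_mxM !coords_mat_var [X in _ = _ - X]raddf_sum; congr (_ - _).
  by apply: eq_bigr => l _; rewrite /= map_mxZ coords_mat_var /= coords_scal.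
apply/matrixP => s t; rewrite mxE [RHS]mxE; apply: lv => h uh.
rewrite /evL; set E := conj_family _ _ _.
have -> : mmap mio (point E zL) (structure_poly i j s t) =
   map_mx (mmap mio (point E zL)) (structure_poly i j) s t by rewrite [RHS]mxE.
suff -> : map_mx (mmap mio (point E zL)) (structure_poly i j) = 0 by rewrite mxE.
rewrite map_mxB map_mxM !mat_varE raddf_sum.
have sE P : mmap mio (point E zL) (scal P) = kap (evK P) by exact: (evL_scal h).
under eq_bigr do rewrite /= map_mxZ mat_varE /= sE.
apply/eqP; rewrite subr_eq0; apply/eqP.
rewrite /E /conj_family !mulmxA !map_invmx mulmxKV ?map_unitmx // -[in LHS](mulmxA _ (mx d i)).
rewrite mx_mul mulmx_sumr mulmx_suml; apply: eq_bigr => l _.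
by rewrite -scalemxAr -scalemxAl.
Qed.

Lemma evK_tau P : evK (tau_scal P) = ms d (evK P).
Proof.
rewrite /evK tau_scalE; apply/esym.
by apply: (mmap_mmap (g := ms d)) => [c|j]; [exact: ms_mi | exact: ms_mz].
Qed.

End Locus.
Arguments zL {k n} _ _.

(** * Points over [k] and stability under [tau] *)

Section LocusPoints.
Variables (k : closedFieldType) (n : nat) (d : split_model k n).
Local Notation r := (mr d).
Local Notation N := (n * n)%N.
Local Notation m := #|coord_index n N r|.
Local Notation K := (mK d).
Local Notation L := (mL d).
Local Notation kap := (mkap d).
Local Notation scal := (scal_poly n N).
Implicit Types (p q : {mpoly k[m]}) (P Q : {mpoly k[r]}) (h g : 'M[k]_n) (v w : space d).

Let char0 := m_char0 d.
Let y : 'I_m -> L := point (mx d) (zL d).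

Lemma point_surj (S : Type) (u : 'I_m -> S) :
  exists (E : 'I_N -> 'M[S]_n) (z : 'I_r -> S), u = point E z.
Proof.
exists (fun l => \matrix_(s, t) u (enum_rank (inl (l, (s, t)) : coord_index n N r))).
exists (fun j => u (enum_rank (inr j : coord_index n N r))).
apply/funext => i; rewrite /point -{1}(enum_valK i).
by case: (enum_val i) => [[l [s t]]|j] //=; rewrite mxE.
Qed.

Lemma evL1 p : evL 1%:M p = mmap (mio d) y p.
Proof.
apply: mmap_eq; apply: eq_point => // l.
by rewrite /conj_family invmx1 map_mx1 mul1mx mulmx1.
Qed.

(** The points over [k] of the affine variety whose function field is [K]. *)
Definition center_specialization (w : 'I_r -> k) : Prop :=
  forall P, evK P = 0 -> P.@[w] = 0.

Section Relative.
Variables (T : idomainType) (e : {rmorphism T -> L}) (cT : {rmorphism {mpoly k[r]} -> T}).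
Hypothesis e_cT : forall P, e (cT P) = kap (evK P).

Definition lift_poly p : {mpoly T[m]} := map_mpoly (cT \o @mpolyC r k) p.

Lemma lift_polyE p : mmap e y (lift_poly p) = evL 1%:M p.
Proof.
rewrite evL1 /lift_poly /map_mpoly.
pose f : {rmorphism k -> {mpoly T[m]}} := @mpolyC m T \o (cT \o @mpolyC r k).
apply: (@mmap_mmap _ _ _ _ f (mmap e y)) => [c|i] /=; last by rewrite mmapU.
by rewrite mmapC /= e_cT /evK mmapC.
Qed.

Lemma lift_poly_spec (h : {rmorphism T -> k}) (u : 'I_m -> k) p :
  (forall c, h (cT c%:MP) = c) -> mmap h u (lift_poly p) = p.@[u].
Proof.
move=> hk; rewrite /lift_poly /map_mpoly /meval.
pose f : {rmorphism k -> {mpoly T[m]}} := @mpolyC m T \o (cT \o @mpolyC r k).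
apply: (@mmap_mmap _ _ _ _ f (mmap h u) _ (idfun : {rmorphism k -> k}) u) => [c|i] /=.
  by rewrite mmapC /= hk.
by rewrite mmapU.
Qed.

(** Extends a specialization of [T], which already fixes the central coordinates, to all coordinates
    of the [L]-point. [T] will be the ring of polynomials in the central coordinates, with or
    without one further variable. *)
Lemma relative_extension (B : {mpoly T[m]}) : mmap e y B != 0 ->
  exists2 a : T, e a != 0 & forall h : {rmorphism T -> k},
    specialization e h -> h a != 0 -> exists E : 'I_N -> 'M[k]_n,
      let u := point E (fun j => h (cT 'X_j)) in
      mmap h u B != 0 /\ forall b : {mpoly T[m]}, mmap e y b = 0 -> mmap h u b = 0.
Proof.
move=> yB; have [a ea ha] := specialization_extend char0 yB.
exists a => // h hs hha; have [u [uB us]] := ha h hs hha.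
have [E [z uE]] := point_surj u.
suff ez : z = fun j => h (cT 'X_j) by exists E => /=; rewrite -ez -uE.
(* This polynomial vanishes at the [L]-point, so the specialized point keeps the central coordinates
   prescribed by [h]. *)
apply/funext => j; have := us ('X_(enum_rank (inr j : coord_index n N r)) - (cT 'X_j)%:MP).
rewrite !rmorphB /= !mmapU !mmapC /= {1}/y uE /point enum_rankK.
rewrite e_cT /evK mmapU subrr => /(_ erefl)/eqP.
by rewrite subr_eq0 => /eqP.
Qed.

(** [p - X * q] is a relation satisfied by the [L]-point, so the fraction [p / q] takes the value
    [h X] at the specialized point. *)
Lemma relative_point (X : T) p q : evL 1%:M p = e X * evL 1%:M q -> evL 1%:M q != 0 ->
  exists2 a : T, e a != 0 & forall h : {rmorphism T -> k},
    specialization e h -> (forall c, h (cT c%:MP) = c) -> h a != 0 ->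
    exists E, let v : space d := (E, fun j => h (cT 'X_j)) in
      [/\ locus v, p.@[coords v] = h X * q.@[coords v],
          q.@[coords v] != 0 & (det_poly d).@[coords v] != 0].
Proof.
move=> epq eq.
have ed : evL 1%:M (det_poly d) != 0.
  rewrite evL1 det_polyE -unitfE -unitmxE; exact: mx_basis.
have [|a ea ha] := relative_extension (B := lift_poly (q * det_poly d)).
  by rewrite lift_polyE evLM mulf_neq0.
exists a => // h hs hk hha; have [E [qE sE]] := ha h hs hha.
exists E; move: qE; rewrite (lift_poly_spec _ _ hk) rmorphM mulf_eq0 negb_or.
move=> /andP[qE dE]; split=> //.
  move=> b vb; rewrite -(lift_poly_spec _ _ hk).
  by apply: sE; rewrite lift_polyE vb ?unitmx1.
have diffE (S : comNzRingType) (f : {rmorphism T -> S}) (u : 'I_m -> S) :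
    mmap f u (lift_poly p - X%:MP * lift_poly q) =
    mmap f u (lift_poly p) - f X * mmap f u (lift_poly q).
  by rewrite mmapB [X in _ - X]rmorphM; congr (_ - _ * _); exact: mmapC.
have := sE (lift_poly p - X%:MP * lift_poly q).
rewrite (diffE _ e) (lift_polyE p) (lift_polyE q) epq subrr => /(_ erefl).
by rewrite (diffE _ h) !(lift_poly_spec _ _ hk) => /eqP; rewrite subr_eq0 => /eqP.
Qed.

End Relative.

Definition eval_center : {rmorphism {mpoly k[r]} -> L} := kap \o mmap (mi d) (mz d).

Lemma center_extension p : evL 1%:M p != 0 ->
  exists2 a : {mpoly k[r]}, evK a != 0 & forall w : 'I_r -> k, center_specialization w -> a.@[w] != 0 ->
    exists E, let v : space d := (E, w) in p.@[coords v] != 0 /\ locus v.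
Proof.
pose cT : {rmorphism {mpoly k[r]} -> {mpoly k[r]}} := idfun.
have ecT P : eval_center (cT P) = kap (evK P) by [].
rewrite -(lift_polyE ecT) => /(relative_extension ecT)[a ea ha].
exists a => [|w ws aw]; first by move: ea; rewrite fmorph_eq0.
have hs : specialization eval_center (meval w : {rmorphism {mpoly k[r]} -> k}).
  by move=> P /= /eqP; rewrite fmorph_eq0 => /eqP; exact: ws.
have [E] := ha _ hs aw.
have -> : (fun j => meval w (cT 'X_j)) = w by apply/funext => j; rewrite /= mevalXU.
move=> [pE sE]; have hk c : meval w (cT c%:MP) = c by rewrite /= mevalC.
exists E; split; first by rewrite -(lift_poly_spec (cT := cT) (h := meval w : {rmorphism _ -> _})).
move=> q vq; rewrite -(lift_poly_spec (cT := cT) (h := meval w : {rmorphism _ -> _})) //.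
by apply: sE; rewrite (lift_polyE ecT) vq ?unitmx1.
Qed.

Lemma center_point (a : {mpoly k[r]}) : evK a != 0 ->
  exists2 w : 'I_r -> k, center_specialization w & a.@[w] != 0.
Proof.
move=> ea; have [c ec hc] := specialization_extend char0 ea.
have [| |w [aw ws]] := hc (idfun : {rmorphism k -> k}) _ _.
- by move=> t /eqP; rewrite fmorph_eq0 => /eqP.
- by apply: contraNneq ec => /= ->; rewrite rmorph0.
by exists w.
Qed.

(** The Nullstellensatz for this ideal: if [p] is nonzero at a conjugate of the [L]-point, translate
    it to the [L]-point itself and specialize, first the central coordinates, then the matrices. *)
Lemma vanishing_locus p : (forall v, locus v -> p.@[coords v] = 0) -> vanishing p.
Proof.
move=> lp; apply: contrapT => /not_vanishing[h uh hp].
have : evL 1%:M (conj_poly h p) != 0 by rewrite evL_conj_poly ?mulmx1 ?unitmx1.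
move=> /center_extension[a /center_point[w ws aw] ha].
have [E [pE lE]] := ha w ws aw.
move/eqP: pE; apply; rewrite coords_conj_poly lp //.
exact: locus_conj.
Qed.

Lemma locus_nonempty : exists v : space d, locus v.
Proof.
have : evL 1%:M (1 : {mpoly k[m]}) != 0 by rewrite /evL rmorph1 oner_neq0.
move=> /center_extension[a /center_point[w ws aw] ha].
by have [E [_ lE]] := ha w ws aw; exists (E, w).
Qed.

(** Equal central coordinates give equal structure constants, and both families are bases. *)
Lemma locus_conj_transitive v w : locus v -> locus w -> v.2 = w.2 ->
  (det_poly d).@[coords v] != 0 -> (det_poly d).@[coords w] != 0 ->
  exists2 h, h \in unitmx & w = conj_space h v.
Proof.
rewrite !coords_det -!unitfE -!unitmxE => lv lw e2 dv dw.
have [|h uh hw] := same_structure_conjugate (m_n_gt0 d) dv dw (fun i j => locus_structure i j lv).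
  by move=> i j; rewrite (locus_structure _ _ lw) e2.
exists h => //; rewrite /conj_space e2 [LHS]surjective_pairing; congr pair.
exact/funext.
Qed.

Lemma vec_matrix_tau (E : 'I_N -> 'M[k]_n) (s : 'I_N -> bool) :
  vec_matrix E \in unitmx -> vec_matrix (fun l => (-1) ^+ s l *: (E l)^T) \in unitmx.
Proof.
move=> uE; rewrite -row_free_unit; apply/inj_row_free => c.
rewrite mulmx_sum_row => c0.
have : \sum_l (\row_l (c 0 l * (-1) ^+ s l)) 0 l *: E l = 0.
  apply: trmx_inj; apply: (can_inj mxvecK); rewrite trmx0 linear0 -[RHS]c0.
  rewrite !linear_sum; apply: eq_bigr => l _.
  by rewrite mxE rowK !linearZ /= scalerA [X in _ = X *: _]mulrC.
move=> /(vec_matrix_free uE)/rowP c0'; apply/rowP => l.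
have := c0' l; rewrite !mxE => /eqP; rewrite mulf_eq0 expf_eq0 oppr_eq0 oner_eq0 andbF orbF.
by move/eqP.
Qed.

(** At a general point [v] over [k], [tau_space v] has the same central coordinates and structure
    constants as some point of the locus, so it is a conjugate of that point. Primality removes the
    factor that expresses generality. *)
Lemma vanishing_tau p : vanishing p -> vanishing (tau_poly p).
Proof.
move=> vp; have [a ea ha] : exists2 a : {mpoly k[r]}, evK a != 0 &
    forall w : 'I_r -> k, center_specialization w -> a.@[w] != 0 ->
    exists E, let v : space d := (E, w) in (det_poly d).@[coords v] != 0 /\ locus v.
  apply: center_extension; rewrite /evL det_polyE.
  have -> : conj_family (map_mx (mio d) 1%:M) (map_mx (mio d) (invmx 1%:M)) (mx d) = mx d.
    by apply/funext => l; rewrite /conj_family invmx1 !map_mx1 mul1mx mulmx1.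
  by rewrite -unitfE -unitmxE mx_basis.
have : vanishing (tau_poly p * (scal (tau_scal a) * det_poly d)).
  apply: vanishing_locus => v lv; rewrite !mevalM coords_tau_poly coords_scal coords_det.
  have [->|av] := eqVneq (tau_scal a).@[v.2] 0; first by rewrite mul0r mulr0.
  have [->|dv] := eqVneq (\det (vec_matrix v.1)) 0; first by rewrite !mulr0.
  suff lt : locus (tau_space v) by rewrite lt ?mul0r.
  have tauE P : P.@[(tau_space v).2] = (tau_scal P).@[v.2].
    by rewrite /meval (tau_scalE (idfun : {rmorphism k -> k})).
  have ws : center_specialization (tau_space v).2.
    by move=> P P0; rewrite tauE (locus_center lv) // evK_tau P0 rmorph0.
  have [|E [dE lE]] := ha _ ws; first by rewrite tauE.
  move: dv dE; rewrite coords_det -!unitfE -!unitmxE => dv dE.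
  have [|h uh hE] := same_structure_conjugate (m_n_gt0 d) dE
      (vec_matrix_tau (mxs d) dv) (fun i j => locus_structure i j lE).
    move=> i j; rewrite -scalemxAl -scalemxAr -trmx_mul (locus_structure _ _ lv).
    rewrite scalerA linear_sum scaler_sumr; apply: eq_bigr => l _.
    rewrite linearZ /= !scalerA tauE; congr (_ *: _).
    (* Transposition reverses products, as [sigma] does; [mg_sign] turns the constants for [j, i] at
       [v] into those for [i, j] at the new central coordinates. *)
    have : ((-1) ^+ mxs d l * tau_scal (mg d i j l) -
       (-1) ^+ mxs d i * (-1) ^+ mxs d j * mg d j i l).@[v.2] = 0.
      apply: (locus_center lv); rewrite /evK rmorphB !rmorphM !rmorphXn !rmorphN1 /=.
      by rewrite -[mmap _ _ (tau_scal _)]/(evK _) evK_tau -mg_sign subrr.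
    rewrite rmorphB !rmorphM !rmorphXn !rmorphN1 => /eqP; rewrite subr_eq0 => /eqP <-.
    by rewrite mulrC.
  suff -> : tau_space v = conj_space h (E, (tau_space v).2) by apply: locus_conj.
  by rewrite [LHS]surjective_pairing; congr pair; apply/funext => l; rewrite /= hE.
move=> /vanishing_prime[//|/vanishing_prime[]].
  by move=> /scal_vanishing; rewrite evK_tau => /eqP; rewrite fmorph_eq0 (negPf ea).
by move=> /det_not_vanishing.
Qed.

Lemma locus_tau v : locus v -> locus (tau_space v).
Proof. by move=> lv p vp; rewrite -coords_tau_poly lv //; exact: vanishing_tau. Qed.

End LocusPoints.

(** * Invariant rational functions *)

Section Invariants.
Variables (k : closedFieldType) (n : nat) (d : split_model k n).
Local Notation r := (mr d).
Local Notation N := (n * n)%N.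
Local Notation m := #|coord_index n N r|.
Local Notation K := (mK d).
Local Notation L := (mL d).
Local Notation kap := (mkap d).
Implicit Types (p q : {mpoly k[m]}) (h g : 'M[k]_n) (v w : space d).

Lemma conj_spaceM a b v : a \in unitmx -> b \in unitmx ->
  conj_space (a *m b) v = conj_space a (conj_space b v).
Proof. by move=> ua ub; rewrite /conj_space (conj_familyM _ ua ub). Qed.

(** The extra variable of [T] is sent to [f0]. As [f0] is not a fraction of central elements, it
    specializes to two values over one central point, and each extends to a point of the locus. *)
Lemma pair_over_center (f0 : L) (p q : {mpoly k[m]}) :
  (forall a : K, f0 <> kap a) -> evL 1%:M p = f0 * evL 1%:M q -> evL 1%:M q != 0 ->
  exists (v1 v2 : space d) (w1 w2 : k), [/\ w1 != w2, v1.2 = v2.2 &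
    forall vw, vw \in [:: (v1, w1); (v2, w2)] ->
      [/\ locus vw.1, p.@[coords vw.1] = vw.2 * q.@[coords vw.1],
          q.@[coords vw.1] != 0 & (det_poly d).@[coords vw.1] != 0]].
Proof.
move=> nf0 epq eq; pose T : idomainType := {poly {mpoly k[r]}}.
pose e1 : {rmorphism T -> L} := horner_eval f0 \o map_poly (@eval_center _ _ d).
pose cT : {rmorphism {mpoly k[r]} -> T} := polyC.
have ecT P : e1 (cT P) = kap (evK P) by rewrite /= map_polyC /horner_eval hornerC.
have e1X : e1 'X = f0 by rewrite /= map_polyX /horner_eval hornerX.
have [||a1 ea1 ha1] := relative_point ecT (X := 'X) (p := p) (q := q); rewrite ?e1X //.
have charL : [pchar L] =i pred0.
  by move=> c; rewrite (fmorph_pchar (mio d)) (m_char0 d).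
have [|a ea ha] := specialization_step_pair (m_char0 d) charL (e := @eval_center _ _ d) (y := f0) _ ea1.
  move=> u v; rewrite fmorph_eq0 => eu uf; apply: (nf0 (evK v / evK u)).
  rewrite rmorphM fmorphV; apply: (canRL (mulfK _)); first by rewrite fmorph_eq0.
  by rewrite mulrC.
have [w0 ws0 aw0] : exists2 w0 : 'I_r -> k, center_specialization (d := d) w0 & a.@[w0] != 0.
  by apply: center_point; move: ea; rewrite fmorph_eq0.
pose h0 : {rmorphism {mpoly k[r]} -> k} := meval w0.
have hs0 : specialization (@eval_center _ _ d) h0.
  by move=> P /= /eqP; rewrite fmorph_eq0 => /eqP; exact: ws0.
have [w1 [w2 [n12 hw]]] := ha h0 hs0 aw0.
have ext (w : k) : w \in [:: w1; w2] -> exists E : 'I_N -> 'M[k]_n,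
    let v : space d := (E, w0) in
      [/\ locus v, p.@[coords v] = w * q.@[coords v],
          q.@[coords v] != 0 & (det_poly d).@[coords v] != 0].
  move=> /hw[aw sw]; pose hh : {rmorphism T -> k} := horner_eval w \o map_poly h0.
  have hk c : hh (cT c%:MP) = c by rewrite /= map_polyC /horner_eval hornerC /= mevalC.
  have [E] := ha1 hh sw hk aw.
  have -> : (fun j => hh (cT 'X_j)) = w0.
    by apply/funext => j; rewrite /= map_polyC /horner_eval hornerC /= mevalXU.
  have -> : hh 'X = w by rewrite /= map_polyX /horner_eval hornerX.
  by exists E.
have [E1 h1] := ext w1 (mem_head _ _).
have [E2 h2] : exists E : 'I_N -> 'M[k]_n, let v : space d := (E, w0) in
      [/\ locus v, p.@[coords v] = w2 * q.@[coords v],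
          q.@[coords v] != 0 & (det_poly d).@[coords v] != 0].
  by apply: ext; rewrite !inE eqxx orbT.
exists (E1, w0), (E2, w0), w1, w2; split=> // vw.
by rewrite !inE => /orP[] /eqP ->.
Qed.

(** By invariance [p / q] takes one value [f0] at all conjugates of the [L]-point. Were [f0] outside
    [K], [p / q] would take two values on one fiber, which is a single orbit. *)
Lemma invariant_in_center p q : ~ vanishing q ->
  (forall h, h \in unitmx -> vanishing (conj_poly h p * q - p * conj_poly h q)) ->
  exists a : K, forall h, h \in unitmx -> evL h p = kap a * evL h q.
Proof.
move=> /not_vanishing[h0 u0 q0] inv.
pose f0 := evL h0 p / evL h0 q.
have pf h : h \in unitmx -> evL h p = f0 * evL h q.
  move=> uh; have uh' : h *m invmx h0 \in unitmx by rewrite unitmx_mul uh unitmx_inv.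
  have := inv _ uh' h0 u0; rewrite evLB !evLM !evL_conj_poly //.
  rewrite mulmxKV // => /eqP; rewrite subr_eq0 => /eqP e.
  by rewrite /f0 mulrAC -e mulfK.
have [[a fa]|nf] := pselect (exists a, f0 = kap a).
  by exists a => h uh; rewrite -fa pf.
have nf0 a : f0 <> kap a by move=> fa; apply: nf; exists a.
have [||v1 [v2 [w1 [w2 [n12 e12 hv]]]]] := @pair_over_center f0 (conj_poly h0 p) (conj_poly h0 q) nf0.
- by rewrite !evL_conj_poly ?unitmx1 // mulmx1 pf.
- by rewrite !evL_conj_poly ?unitmx1 // mulmx1.
have [l1 e1 q1 d1] := hv (v1, w1) (mem_head _ _).
have [l2 e2 q2 d2] : [/\ locus v2, (conj_poly h0 p).@[coords v2] = w2 * (conj_poly h0 q).@[coords v2],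
   (conj_poly h0 q).@[coords v2] != 0 & (det_poly d).@[coords v2] != 0].
  by apply: (hv (v2, w2)); rewrite !inE eqxx orbT.
have [h uh vh] := locus_conj_transitive l1 l2 e12 d1 d2.
(* The polynomials were translated by [h0], so the conjugation that carries [v1] to [v2] is itself
   translated. *)
have uh' : h0 *m h *m invmx h0 \in unitmx by rewrite !unitmx_mul u0 uh unitmx_inv.
have lu : locus (conj_space h0 v1) by apply: locus_conj.
have := lu _ (inv _ uh'); rewrite rmorphB !rmorphM /= !coords_conj_poly.
have -> : conj_space (h0 *m h *m invmx h0) (conj_space h0 v1) = conj_space h0 v2.
  rewrite vh -!conj_spaceM ?unitmx_mul ?u0 ?uh ?unitmx_inv //.
  by rewrite -!mulmxA mulVmx // mulmx1.
move: e1 e2 q1 q2; rewrite /= !coords_conj_poly => -> -> q1 q2 /eqP; rewrite subr_eq0 => /eqP e.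
exfalso; move/eqP: n12; apply; apply: (mulIf (mulf_neq0 q1 q2)).
by rewrite mulrA -e mulrAC -!mulrA; congr (_ * _); rewrite mulrC.
Qed.

End Invariants.

Local Open Scope classical_set_scope.
Local Open Scope quotient_scope.

(** * The action as a morphism *)

Section RegularGL.
Variables (k : closedFieldType) (n : nat).
Local Notation PGLn := (PGL k n).

Lemma zregular_cst (T : Type) m (D : set T) (phi : T -> 'I_m -> k) x c :
  zregular D phi x (fun=> c).
Proof.
exists c%:MP, 1; split; first by rewrite rmorph1 oner_neq0.
by move=> y _ _; rewrite mevalC rmorph1 divr1.
Qed.

Lemma zregularM (T : Type) m (D : set T) (phi : T -> 'I_m -> k) x f g :
  zregular D phi x f -> zregular D phi x g -> zregular D phi x (fun y => f y * g y).
Proof.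
move=> [p [q [qx pq]]] [p' [q' [qx' pq']]].
exists (p * p'), (q * q'); split; first by rewrite rmorphM mulf_neq0.
move=> y Dy; rewrite rmorphM mulf_eq0 negb_or => /andP[qy qy'].
by rewrite pq // pq' // mulf_div !rmorphM.
Qed.

Definition Ptau_regular (f : Ptau k n -> k) : Prop :=
  forall b (h : GL k n), regular_at h (fun h' : GL k n => f (\pi_PGLn h', b)).

Lemma Ptau_regular_on f : Ptau_regular f -> regular_on setT f.
Proof.
by move=> rf [g b] _ /=; exists setT; split=> //; exact: openT.
Qed.

Lemma Ptau_regular_cst (c : bool -> k) : Ptau_regular (fun x => c x.2).
Proof. by move=> b h; exact: (zregular_cst setT (@GL_coord k n) h (c b)). Qed.

Lemma Ptau_regularM f g : Ptau_regular f -> Ptau_regular g ->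
  Ptau_regular (fun x => f x * g x).
Proof. by move=> rf rg b h; apply: zregularM; [exact: rf | exact: rg]. Qed.

(** The entry is [g s a * (\adj g) b t / \det g], a fraction in the coordinates of a representative
    [g]. *)
Lemma Ptau_regular_conj a b s t :
  Ptau_regular (fun x => PGL_conj x.1 (delta_mx a b) s t).
Proof.
move=> c h; pose G : 'M[{mpoly k[n * n]}]_n := \matrix_(i, j) 'X_(mxvec_index i j).
have GE h' : map_mx (meval (GL_coord h')) G = val h'.
  by apply/matrixP => i j; rewrite !mxE mevalXU /GL_coord mxvecE.
exists (G s a * (\adj G) b t), (\det G).
have dE h' : (\det G).@[GL_coord h'] = \det (val h') by rewrite -det_map_mx GE.
split; first by rewrite dE -unitfE -unitmxE (valP h).
move=> h' _ _; rewrite PGL_conjE dE rmorphM /=.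
have -> : (G s a).@[GL_coord h'] = val h' s a by rewrite -GE [RHS]mxE.
have -> : ((\adj G) b t).@[GL_coord h'] = (\adj (val h')) b t.
  by rewrite -GE -map_mx_adj [RHS]mxE.
rewrite /invmx (valP h') mxE (bigD1 b) //= big1 => [|j jb].
  rewrite mxE (bigD1 a) //= big1 => [|j ja].
    by rewrite !mxE !eqxx mulr1 !addr0 [in LHS](mulrC _^-1) mulrA.
  by rewrite !mxE (negPf ja) mulr0.
by rewrite mxE big1 ?mul0r // => l _; rewrite !mxE (negPf jb) andbF mulr0.
Qed.

(** Separates the group variable from the matrix entries, as [tensor] asks. *)
Lemma PGL_conj_expand (g : PGLn) (a : 'M[k]_n) s t :
  PGL_conj g a s t = \sum_i \sum_j PGL_conj g (delta_mx i j) s t * a i j.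
Proof.
rewrite /PGL_conj {1}(matrix_sum_delta a) mulmx_sumr mulmx_suml summxE.
apply: eq_bigr => i _; rewrite mulmx_sumr mulmx_suml summxE.
by apply: eq_bigr => j _; rewrite -scalemxAr -scalemxAl mxE mulrC.
Qed.

Lemma PGL_conj_mul (g h : PGLn) a : PGL_conj (g * h)%g a = PGL_conj g (PGL_conj h a).
Proof.
elim/quotW: g => g; elim/quotW: h => h; rewrite [(_ * _)%g]PGL_mulE !PGL_conjE /=.
by rewrite invmx_mul ?(valP g) ?(valP h) // !mulmxA.
Qed.

Lemma PGL_conj_one a : PGL_conj (1%g : PGLn) a = a.
Proof. by rewrite -[1%g]/(\pi_PGLn (GL1 k n)) PGL_conjE /= invmx1 mul1mx mulmx1. Qed.

Lemma PGL_conj_tr (g : PGLn) a : (PGL_conj g a)^T = PGL_conj (PGL_contra g) a^T.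
Proof. by rewrite -PGL_conj_contra PGL_contraK. Qed.

End RegularGL.

(** * The variety and its action *)

Section LocusVariety.
Variables (k : closedFieldType) (n : nat) (d : split_model k n).
Local Notation N := (n * n)%N.
Local Notation m := #|coord_index n N (mr d)|.

Definition locus_space : Type := {v : space d | `[< locus v >]}.

Definition lcoords (x : locus_space) : 'I_m -> k := coords (val x).

HB.instance Definition _ := Choice.copy locus_space {v : space d | `[< locus v >]}.
HB.instance Definition _ := SubType.copy locus_space {v : space d | `[< locus v >]}.
HB.instance Definition _ := isOpenTopological.Build locus_space
  (zopenT setT lcoords) (@zopenI _ _ _ setT lcoords)
  (@zopen_bigU _ _ _ setT lcoords).
HB.instance Definition _ := hasRegular.Build k locus_space (zregular setT lcoords).

Lemma locusP (x : locus_space) : locus (val x).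
Proof. exact/asboolP/(valP x). Qed.

Definition in_locus (v : space d) (lv : locus v) : locus_space :=
  exist _ v (asboolT lv).

Lemma point_inj (E E' : 'I_N -> 'M[k]_n) (z z' : 'I_(mr d) -> k) :
  point E z = point E' z' -> (E, z) = (E', z').
Proof.
move=> ee; congr pair.
  apply/funext => l; apply/matrixP => s t.
  have := congr1 (@^~ (enum_rank (inl (l, (s, t)) : coord_index n N (mr d)))) ee.
  by rewrite /point enum_rankK.
apply/funext => j.
have := congr1 (@^~ (enum_rank (inr j : coord_index n N (mr d)))) ee.
by rewrite /point enum_rankK.
Qed.

Lemma lcoords_inj : injective lcoords.
Proof.
move=> x x' /point_inj e; apply: val_inj.
by rewrite [LHS]surjective_pairing [RHS]surjective_pairing.
Qed.

Lemma locus_space_chart : affine_chart [set: locus_space] lcoords.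
Proof.
split=> //; first exact: openT.
- by move=> x x' _ _; exact: lcoords_inj.
- exists (fun p => vanishing p); apply/seteqP; split=> [_ [x _ <-] p vp|u hu] /=.
    exact: locusP.
  have [E [z uE]] := point_surj u.
  have lv : locus ((E, z) : space d) by move=> p /hu; rewrite uE.
  by exists (in_locus lv).
Qed.

Lemma regular_lcoords i (x : locus_space) : regular_at x (fun x => lcoords x i).
Proof.
exists 'X_i, 1; split; first by rewrite rmorph1 oner_neq0.
by move=> y _ _; rewrite mevalXU rmorph1 divr1.
Qed.

Lemma regular_locus_cst (x : locus_space) (c : k) : regular_at x (fun=> c).
Proof. exact: zregular_cst. Qed.

Lemma locus_space_variety : is_variety locus_space.
Proof.
split.
  exists 1%N, (fun=> setT), (fun=> m), (fun=> lcoords); split=> [_|x].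
    exact: locus_space_chart.
  by exists ord0.
rewrite -openC.
suff : zprod_open (~` [set z : locus_space * locus_space | z.1 = z.2]) by [].
move=> [x x'] /= nxx'.
have [i hi] : exists i, lcoords x i != lcoords x' i.
  apply: contrapT => /forallNP h; apply: nxx'; apply: lcoords_inj.
  by apply/funext => i; apply/eqP; have /negP := h i; rewrite negbK.
(* A difference of coordinates is a tensor of length two, and it separates the two points. *)
exists setT, setT, [:: fun w : locus_space * locus_space => lcoords w.1 i - lcoords w.2 i].
split; first by split=> //; exact: openT.
- by split=> //; exact: openT.
- move=> t; rewrite inE => /eqP ->; split; last by rewrite subr_eq0.
  exists 2%N, (fun j : 'I_2 => if j == ord0 then fun x => lcoords x i else fun=> 1).
  exists (fun j : 'I_2 => if j == ord0 then fun=> 1 else fun x => - lcoords x i).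
  split.
  + move=> j y _; case: ifP => _; first exact: regular_lcoords.
    exact: regular_locus_cst.
  + move=> j y _; case: ifP => _; first exact: regular_locus_cst.
    have -> : (fun x => - lcoords x i) = (fun x : locus_space => (-1) * lcoords x i).
      by apply/funext => w; rewrite mulN1r.
    by apply: zregularM; [exact: zregular_cst | exact: regular_lcoords].
  + by apply/funext => w; rewrite big_ord_recl big_ord1 /= mulr1 mul1r.
- move=> w _ _ /(_ _ (mem_head _ _)); rewrite subr_eq0 => h /= e.
  by move: h; rewrite e eqxx.
Qed.

Definition PGL_space (g : PGL k n) (v : space d) : space d :=
  (fun l => PGL_conj g (v.1 l), v.2).

Definition tau_pow_space (b : bool) (v : space d) : space d :=
  if b then tau_space v else v.

Definition act_space (x : Ptau k n) (v : space d) : space d :=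
  PGL_space x.1 (tau_pow_space x.2 v).

Lemma locus_act x v : locus v -> locus (act_space x v).
Proof.
move=> lv; apply: (@locus_conj _ _ _ (val (repr x.1)) (tau_pow_space x.2 v)).
  exact: (valP (repr x.1)).
by rewrite /tau_pow_space; case: x.2 => //; exact: locus_tau.
Qed.

Definition act_locus (x : Ptau k n) (y : locus_space) : locus_space :=
  in_locus (locus_act x (locusP y)).

Lemma tau_spaceK : involutive (@tau_space _ _ d).
Proof.
have s2 (b : bool) (R : nzRingType) : (-1) ^+ b * (-1) ^+ b = 1 :> R.
  by rewrite -signr_addb addbb.
move=> v; rewrite [RHS]surjective_pairing; congr pair; apply/funext => l /=.
  by rewrite linearZ /= trmxK scalerA s2 scale1r.
by rewrite mulrA s2 mul1r.
Qed.

Lemma act_locus1 y : act_locus 1%g y = y.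
Proof.
apply: val_inj; rewrite /= [RHS]surjective_pairing; congr pair.
by apply/funext => l; rewrite PGL_conj_one.
Qed.

Lemma tau_pow_PGL_space b (g : PGL k n) v :
  tau_pow_space b (PGL_space g v) = PGL_space (tau_pow b g) (tau_pow_space b v).
Proof.
case: b => //=; congr pair; apply/funext => l /=.
by rewrite PGL_conj_tr PGL_conjZ.
Qed.

Lemma tau_pow_spaceD b c v :
  tau_pow_space b (tau_pow_space c v) = tau_pow_space (b (+) c) v.
Proof. by case: b c => [] []; rewrite /tau_pow_space //= tau_spaceK. Qed.

Lemma act_locusM x y z : act_locus (x * y)%g z = act_locus x (act_locus y z).
Proof.
apply: val_inj; rewrite /= /act_space tau_pow_PGL_space tau_pow_spaceD.
by congr pair; apply/funext => l; rewrite /= PGL_conj_mul.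
Qed.

(** Finite sums of products of globally regular functions form a ring containing the coordinates of
    the action. The action can thus be tested with both open sets equal to the whole space. *)
Definition global_tensor (t : Ptau k n * locus_space -> k) : Prop :=
  exists (s : nat) (a : 'I_s -> Ptau k n -> k) (b : 'I_s -> locus_space -> k),
    [/\ forall i, Ptau_regular (a i), forall i, regular_on setT (b i) &
        forall z, t z = \sum_i a i z.1 * b i z.2].

Lemma global_tensor1 a b : Ptau_regular a -> regular_on [set: locus_space] b ->
  global_tensor (fun z => a z.1 * b z.2).
Proof.
move=> ra rb; exists 1%N, (fun=> a), (fun=> b); split=> // z.
by rewrite big_ord1.
Qed.

Lemma global_tensor_cst c : global_tensor (fun=> c).
Proof.
have := @global_tensor1 (fun=> c) (fun=> 1) (Ptau_regular_cst (fun=> c))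
  (fun x _ => regular_locus_cst x 1).
by congr global_tensor; apply/funext => z; rewrite mulr1.
Qed.

Lemma global_tensorD t t' : global_tensor t -> global_tensor t' ->
  global_tensor (fun z => t z + t' z).
Proof.
move=> [s [a [b [ra rb et]]]] [s' [a' [b' [ra' rb' et']]]].
exists (s + s')%N, (fun i : 'I_(s + s') => match fintype.split i with inl j => a j | inr j => a' j end).
exists (fun i : 'I_(s + s') => match fintype.split i with inl j => b j | inr j => b' j end); split.
- by move=> i; case: fintype.split.
- by move=> i; case: fintype.split.
- move=> z; rewrite et et' big_split_ord /=; congr (_ + _); apply: eq_bigr => i _.
    by rewrite (unsplitK (inl i)).
  by rewrite (unsplitK (inr i)).
Qed.

Lemma global_tensorM t t' : global_tensor t -> global_tensor t' ->
  global_tensor (fun z => t z * t' z).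
Proof.
move=> [s [a [b [ra rb et]]]] [s' [a' [b' [ra' rb' et']]]].
pose I : finType := ('I_s * 'I_s')%type.
exists #|I|, (fun i x => a (enum_val i).1 x * a' (enum_val i).2 x).
exists (fun i x => b (enum_val i).1 x * b' (enum_val i).2 x); split.
- by move=> i; exact: Ptau_regularM.
- by move=> i x _; apply: zregularM; [exact: rb | exact: rb'].
- move=> z; rewrite et et' big_distrlr /= pair_bigA /= (reindex (@enum_val I predT)) /=.
    by apply: eq_bigr => i _; rewrite mulrACA.
  exact/onW_bij/enum_val_bij.
Qed.

Lemma global_tensor_sum (J : Type) (s : seq J) t : (forall j, global_tensor (t j)) ->
  global_tensor (fun z => \sum_(j <- s) t j z).
Proof.
move=> ht; elim: s => [|j s IH].
  by under eq_fun do rewrite big_nil; exact: global_tensor_cst.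
by under eq_fun do rewrite big_cons; apply: global_tensorD.
Qed.

Lemma global_tensor_prod (J : Type) (s : seq J) t : (forall j, global_tensor (t j)) ->
  global_tensor (fun z => \prod_(j <- s) t j z).
Proof.
move=> ht; elim: s => [|j s IH].
  by under eq_fun do rewrite big_nil; exact: global_tensor_cst.
by under eq_fun do rewrite big_cons; apply: global_tensorM.
Qed.

Lemma global_tensor_meval M (t : 'I_M -> Ptau k n * locus_space -> k) (q : {mpoly k[M]}) :
  (forall i, global_tensor (t i)) -> global_tensor (fun z => q.@[t^~ z]).
Proof.
move=> ht; under eq_fun do rewrite mevalE; apply: global_tensor_sum => e.
apply: global_tensorM; first exact: global_tensor_cst.
apply: global_tensor_prod => i; elim: (e i) => [|c IH].
  by under eq_fun do rewrite expr0; exact: global_tensor_cst.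
by under eq_fun do rewrite exprS; apply: global_tensorM.
Qed.

(** The indicator functions of the two components of the group are regular. *)
Lemma global_tensor_if t t' : global_tensor t -> global_tensor t' ->
  global_tensor (fun z => if z.1.2 then t z else t' z).
Proof.
move=> ht ht'.
have ind (c : bool -> k) : global_tensor (fun z => c z.1.2).
  have := global_tensor1 (Ptau_regular_cst c) (fun x _ => regular_locus_cst x 1).
  by congr global_tensor; apply/funext => z; rewrite mulr1.
have := global_tensorD (global_tensorM (ind (fun b => b%:R)) ht)
  (global_tensorM (ind (fun b => (~~ b)%:R)) ht').
congr global_tensor; apply/funext => z.
by case: z.1.2; rewrite !(mul1r, mul0r, addr0, add0r).
Qed.

Lemma global_tensor_act i : global_tensor (fun z => lcoords (act_locus z.1 z.2) i).
Proof.
have reg0 l s t : regular_on setT (fun x : locus_space => (val x).1 l s t).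
  move=> x _; have := regular_lcoords (enum_rank (inl (l, (s, t)) : coord_index n N (mr d))) x.
  by congr regular_at; apply/funext => w; rewrite /lcoords /coords /point enum_rankK.
have reg1 j : regular_on setT (fun x : locus_space => (val x).2 j).
  move=> x _; have := regular_lcoords (enum_rank (inr j : coord_index n N (mr d))) x.
  by congr regular_at; apply/funext => w; rewrite /lcoords /coords /point enum_rankK.
have regZ c (f : locus_space -> k) : regular_on setT f -> regular_on setT (fun x => c * f x).
  by move=> rf x xT; apply: zregularM; [exact: zregular_cst | exact: rf].
have one : Ptau_regular (fun _ : Ptau k n => 1 : k) := Ptau_regular_cst (fun=> 1).
rewrite /lcoords /coords /point; case: enum_val => [[l [s t]]|j] /=.
  have := global_tensor_if
    (t := fun z => PGL_conj z.1.1 ((tau_space (val z.2)).1 l) s t)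
    (t' := fun z => PGL_conj z.1.1 ((val z.2).1 l) s t).
  have -> : (fun z : Ptau k n * locus_space => if z.1.2
      then PGL_conj z.1.1 ((tau_space (val z.2)).1 l) s t
      else PGL_conj z.1.1 ((val z.2).1 l) s t) =
    (fun z => PGL_conj z.1.1 ((tau_pow_space z.1.2 (val z.2)).1 l) s t).
    by apply/funext => z; rewrite /tau_pow_space; case: ifP.
  have gC (u : locus_space -> 'M[k]_n) : (forall a b, regular_on setT (fun x => u x a b)) ->
      global_tensor (fun z => PGL_conj z.1.1 (u z.2) s t).
    move=> ru; under eq_fun do rewrite PGL_conj_expand.
    apply: global_tensor_sum => a; apply: global_tensor_sum => b.
    exact: (global_tensor1 (Ptau_regular_conj a b s t) (ru a b)).
  apply; last by apply: (gC (fun x => (val x).1 l)) => a b; exact: reg0.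
  apply: (gC (fun x => (tau_space (val x)).1 l)) => a b.
  by under eq_fun do rewrite !mxE; apply: regZ; exact: reg0.
have := global_tensor_if (global_tensor1 one (regZ ((-1) ^+ mzs d j) _ (reg1 j)))
  (global_tensor1 one (reg1 j)).
by congr global_tensor; apply/funext => z; rewrite /tau_pow_space; case: ifP => _; rewrite mul1r.
Qed.

Lemma global_tensor_tensor t : global_tensor t -> tensor (X := Ptau k n) setT setT t.
Proof.
move=> [s [a [b [ra rb et]]]]; exists s, a, b; split=> // [i|].
  exact: Ptau_regular_on.
exact/funext.
Qed.

Lemma act_locus_morphism :
  morphism (fun z : zprod (Ptau k n) locus_space => act_locus z.1 z.2).
Proof.
have T q : tensor (X := Ptau k n) setT setT
    (fun z : Ptau k n * locus_space => q.@[lcoords (act_locus z.1 z.2)]).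
  by apply: global_tensor_tensor; apply: global_tensor_meval; exact: global_tensor_act.
split.
  apply/continuousP => W oW.
  suff : @zprod_open _ (Ptau k n) locus_space
    [set z : Ptau k n * locus_space | W (act_locus z.1 z.2)] by [].
  move=> z Wz; have [q qz qW] := oW _ Wz.
  exists setT, setT, [:: fun z : Ptau k n * locus_space => q.@[lcoords (act_locus z.1 z.2)]].
  split; [by split=> //; exact: openT | by split=> //; exact: openT | |].
    by move=> t; rewrite inE => /eqP ->.
  by move=> w _ _ /(_ _ (mem_head _ _)); exact: qW.
move=> z f [p [q [qz pq]]].
exists setT, setT, (fun z => p.@[lcoords (act_locus z.1 z.2)]).
exists (fun z => q.@[lcoords (act_locus z.1 z.2)]).
split; [by split=> //; exact: openT | by split=> //; exact: openT | exact: T | by [] |].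
by move=> w _ _ qw; rewrite /= pq.
Qed.

Definition locus_variety : gVariety (Ptau k n) :=
  GVariety locus_space_variety act_locus1 act_locusM act_locus_morphism.

End LocusVariety.

(** * Rational maps on the variety *)

Section LocusRationalMaps.
Variables (k : closedFieldType) (n : nat) (d : split_model k n).
Local Notation r := (mr d).
Local Notation N := (n * n)%N.
Local Notation m := #|coord_index n N r|.
Local Notation K := (mK d).
Local Notation X := (locus_variety d).
Local Notation scal := (scal_poly n N).
Implicit Types (p q : {mpoly k[m]}) (x : locus_space d) (c : 'I_N -> K).

Lemma vanishing_lcoords p : (forall x, p.@[lcoords x] = 0) -> vanishing p.
Proof. by move=> px; apply: vanishing_locus => v lv; exact: (px (in_locus lv)). Qed.

Lemma lcoords_vanishing p x : vanishing p -> p.@[lcoords x] = 0.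
Proof. exact: locusP. Qed.

Lemma not_vanishing_lcoords p : ~ vanishing p -> exists x, p.@[lcoords x] != 0.
Proof.
move=> np; apply: contrapT => /forallNP h; apply: np; apply: vanishing_lcoords => x.
by apply/eqP; have /negP := h x; rewrite negbK.
Qed.

Lemma not_vanishingM p q : ~ vanishing p -> ~ vanishing q -> ~ vanishing (p * q).
Proof. by move=> np nq /vanishing_prime[]. Qed.

Lemma not_vanishing_at p x : p.@[lcoords x] != 0 -> ~ vanishing p.
Proof. by move=> px vp; rewrite lcoords_vanishing ?eqxx in px. Qed.

Lemma not_vanishing_scal (Q : {mpoly k[r]}) : evK Q != 0 -> ~ vanishing (scal Q).
Proof. by move=> /eqP nQ /scal_vanishing. Qed.

Lemma lcoords_scal (Q : {mpoly k[r]}) x : (scal Q).@[lcoords x] = Q.@[(val x).2].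
Proof. exact: coords_scal. Qed.

Lemma nonvanishing_open q : open [set x : X | q.@[lcoords (x : locus_space d)] != 0].
Proof.
suff : zopen setT (@lcoords _ _ d) [set x | q.@[lcoords x] != 0] by [].
by move=> x /= qx; exists q.
Qed.

(** A dense open set is nonempty, so it contains a nonempty principal open set; primality makes
    every such set dense. *)
Lemma generically_locusP (P : locus_space d -> Prop) :
  generically (T := X) P <->
  exists2 q, ~ vanishing q & forall x, q.@[lcoords x] != 0 -> P x.
Proof.
split=> [[U [oU dU UP]]|[q nq qP]].
  have [v lv] := locus_nonempty d.
  have [x0 [_ Ux0]] := dU setT (ex_intro _ (in_locus lv : X) I) openT.
  have [q qx0 qU] := oU _ Ux0; exists q; first exact: not_vanishing_at qx0.
  by move=> x qx; apply: UP; exact: qU.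
exists [set x : X | q.@[lcoords (x : locus_space d)] != 0]; split=> //.
  exact: nonvanishing_open.
move=> O [x Ox] oO; have [q' q'x q'O] := oO _ Ox.
have [z] := not_vanishing_lcoords (not_vanishingM nq (not_vanishing_at q'x)).
rewrite rmorphM mulf_eq0 negb_or => /andP[qz q'z].
by exists z; split=> //; exact: q'O.
Qed.

Lemma locus_irreducible : irreducible X.
Proof.
split; first by have [v lv] := locus_nonempty d; exists (in_locus lv).
move=> A B cA cB AB; apply: contrapT => /not_orP[nA nB].
have ex (C : set X) : closed C -> C <> setT ->
    exists2 q, ~ vanishing q & forall x, q.@[lcoords x] != 0 -> ~ C x.
  move=> cC nC; have [x nx] : exists x, ~ C x.
    apply: contrapT => /forallNP h; apply: nC; apply/seteqP; split=> // x _.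
    exact: contrapT (h x).
  have oC : open (~` C) by exact: closed_openC.
  have [q qx qC] := oC _ nx; exists q; first exact: not_vanishing_at qx.
  by move=> y qy; exact: qC.
have [q nq qA] := ex A cA nA; have [q' nq' qB] := ex B cB nB.
have [z] := not_vanishing_lcoords (not_vanishingM nq nq').
rewrite rmorphM mulf_eq0 negb_or => /andP[/qA nAz /qB nBz].
have [] : (A `|` B) z by rewrite AB.
  by [].
by [].
Qed.

Lemma lcoords_det x : (det_poly d).@[lcoords x] = \det (vec_matrix (val x).1).
Proof. exact: coords_det. Qed.

(** Where the matrix coordinates form a basis, an element fixing the point commutes with all
    matrices, so it is scalar. *)
Lemma locus_generically_free : pgl_generically_free X.
Proof.
apply/generically_locusP; exists (det_poly d); first exact: det_not_vanishing.
move=> x; rewrite lcoords_det -unitfE -unitmxE => ux.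
elim/quotW=> h hx; apply/eqP/PGL_eqP => /=.
have hv l : PGL_conj (\pi_(PGL k n) h) ((val x).1 l) = (val x).1 l.
  exact: (congr1 (fun y : locus_space d => (val y).1 l) hx).
have uh := valP h.
have [c hc] : exists c : k, val h = c%:M.
  apply: (commutes_with_all_scalar (m_n_gt0 d)) => a.
  rewrite (vec_matrix_span a ux) mulmx_sumr mulmx_suml; apply: eq_bigr => l _.
  rewrite -scalemxAr -scalemxAl; congr (_ *: _).
  by rewrite -{2}hv PGL_conjE mulmxKV.
exists c; last by rewrite hc scalemx1.
apply: contraTneq uh => c0; rewrite /= hc c0 unitmxE det_scalar unitfE.
by rewrite expf_eq0 eqxx (m_n_gt0 d).
Qed.

Definition combination (P : 'I_N -> {mpoly k[r]}) (Q : {mpoly k[r]}) x : 'M[k]_n :=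
  \sum_l ((P l).@[(val x).2] / Q.@[(val x).2]) *: (val x).1 l.

(** [f] is the rational map attached to the element of [A] with coordinates [c]: each coordinate in
    [K] is read as a rational function of the central coordinates, with common denominator [Q]. *)
Definition represents c (f : X -> 'M[k]_n) : Prop :=
  exists P Q, [/\ evK Q != 0, forall l, c l * evK Q = evK (P l) &
    generically (fun x : X => f x = combination P Q x)].

Lemma evKM (P Q : {mpoly k[r]}) : evK (P * Q) = evK P * evK Q.
Proof. exact: rmorphM. Qed.

Lemma evKB (P Q : {mpoly k[r]}) : evK (P - Q) = evK P - evK Q.
Proof. exact: rmorphB. Qed.

Lemma common_denominator c : exists P Q, evK Q != 0 /\ forall l, c l * evK Q = evK (P l).
Proof.
have /choice[P hP] l := mz_gen (c l).
have /choice[Q hQ] := hP.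
exists (fun l => P l * \prod_(j | j != l) Q j), (\prod_j Q j).
have prodE (I : finType) (b : pred I) (F : I -> {mpoly k[r]}) :
    evK (\prod_(j | b j) F j) = \prod_(j | b j) evK (F j) by exact: rmorph_prod.
split=> [|l]; first by rewrite prodE; apply/prodf_neq0 => l _; have [] := hQ l.
rewrite evKM !prodE (bigD1 l) //= mulrA; congr (_ * _).
by have [] := hQ l.
Qed.

Lemma locus_eq (P Q : {mpoly k[r]}) x : evK P = evK Q -> P.@[(val x).2] = Q.@[(val x).2].
Proof.
move=> PQ; apply/eqP; rewrite -subr_eq0 -rmorphB; apply/eqP.
by apply: (locus_center (locusP x)); rewrite evKB PQ subrr.
Qed.

Lemma combination_eq c P Q P' Q' x :
  (forall l, c l * evK Q = evK (P l)) -> (forall l, c l * evK Q' = evK (P' l)) ->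
  Q.@[(val x).2] != 0 -> Q'.@[(val x).2] != 0 -> combination P Q x = combination P' Q' x.
Proof.
move=> cP cP' Qx Q'x; apply: eq_bigr => l _; congr (_ *: _).
apply/eqP; rewrite eqr_div // -!rmorphM; apply/eqP; apply: locus_eq.
by rewrite !evKM -cP -cP' mulrAC.
Qed.

Lemma generically_scal (Q : {mpoly k[r]}) : evK Q != 0 ->
  generically (fun x : X => Q.@[(val (x : locus_space d)).2] != 0).
Proof.
move=> nQ; apply/generically_locusP; exists (scal Q); first exact: not_vanishing_scal.
by move=> x; rewrite lcoords_scal.
Qed.

Lemma represents_uniq c f g : represents c f -> represents c g ->
  generically (fun x : X => f x = g x).
Proof.
move=> [P [Q [nQ cP fP]]] [P' [Q' [nQ' cP' gP]]].
apply: generically_imp (generically_and (generically_and fP gP)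
  (generically_and (generically_scal nQ) (generically_scal nQ'))) => x [[-> ->] [Qx Q'x]].
exact: combination_eq cP cP' Qx Q'x.
Qed.

Lemma eq_represents c f g : generically (fun x : X => f x = g x) ->
  represents c f -> represents c g.
Proof.
move=> fg [P [Q [nQ cP fP]]]; exists P, Q; split=> //.
by apply: generically_imp (generically_and fg fP) => x [<- ->].
Qed.

(** At a general point the matrix coordinates are independent, so the coefficients agree there;
    cross-multiplied, this is a vanishing polynomial in the central coordinates, that is, an
    equality in [K]. *)
Lemma represents_inj c c' f : represents c f -> represents c' f -> forall l, c l = c' l.
Proof.
move=> [P [Q [nQ cP fP]]] [P' [Q' [nQ' cP' fP']]] l.
have /generically_locusP[q nq hq] := generically_and (generically_and fP fP')
  (generically_and (generically_scal nQ) (generically_scal nQ')).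
have : vanishing (scal (P l * Q' - P' l * Q) * (q * det_poly d)).
  apply: vanishing_lcoords => x; rewrite !rmorphM /= lcoords_scal lcoords_det.
  have [->|/hq[[e1 e2] [Qx Q'x]]] := eqVneq q.@[lcoords x] 0; first by rewrite mul0r mulr0.
  have [->|dx] := eqVneq (\det (vec_matrix (val x).1)) 0; first by rewrite !mulr0.
  move: dx; rewrite -unitfE -unitmxE => ux.
  have : \sum_l (\row_l ((P l).@[(val x).2] / Q.@[(val x).2] -
      (P' l).@[(val x).2] / Q'.@[(val x).2])) 0 l *: (val x).1 l = 0.
    under eq_bigr do rewrite mxE scalerBl.
    by rewrite sumrB -[X in X - _]/(combination P Q x) -e1 e2 subrr.
  move=> /(vec_matrix_free ux)/rowP/(_ l); rewrite !mxE => /eqP.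
  rewrite subr_eq0 eqr_div // => /eqP e.
  by rewrite rmorphB !rmorphM /= e subrr mul0r.
move=> /vanishing_prime[/scal_vanishing|/vanishing_prime[//|/det_not_vanishing //]].
rewrite evKB !evKM -cP -cP' mulrAC => /eqP; rewrite subr_eq0 => /eqP.
by move/(mulIf nQ)/(mulIf nQ').
Qed.

Lemma represents_linear t c f c' f' : represents c f -> represents c' f' ->
  represents (fun l => mi d t * c l + c' l) (fun x => t *: f x + f' x).
Proof.
move=> [P [Q [nQ cP fP]]] [P' [Q' [nQ' cP' fP']]].
exists (fun l => t *: (P l * Q') + P' l * Q), (Q * Q'); split.
- by rewrite evKM mulf_neq0.
- move=> l; rewrite /evK mmapD mmapZ -!/(evK _) !evKM -cP -cP'.
  by rewrite mulrDl -!mulrA [evK Q' * _]mulrC.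
- apply: generically_imp (generically_and (generically_and fP fP')
    (generically_and (generically_scal nQ) (generically_scal nQ'))) => x [[-> ->] [Qx Q'x]].
  rewrite scaler_sumr -big_split; apply: eq_bigr => l _ /=.
  rewrite scalerA -scalerDl; congr (_ *: _).
  by rewrite mevalD mevalZ !mevalM mulrA addf_div // mulrA.
Qed.

Lemma represents_mul c f c' f' : represents c f -> represents c' f' ->
  represents (fun l => \sum_i \sum_j c i * c' j * evK (mg d i j l)) (fun x => f x *m f' x).
Proof.
move=> [P [Q [nQ cP fP]]] [P' [Q' [nQ' cP' fP']]].
exists (fun l => \sum_i \sum_j P i * P' j * mg d i j l), (Q * Q'); split.
- by rewrite evKM mulf_neq0.
- move=> l; rewrite /evK rmorph_sum -!/(evK _) mulr_suml; apply: eq_bigr => i _.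
  rewrite rmorph_sum mulr_suml; apply: eq_bigr => j _.
  rewrite -[RHS]/(evK _) !evKM -cP -cP'.
  by rewrite mulrAC; congr (_ * _); rewrite mulrACA.
- apply: generically_imp (generically_and fP fP') => x [-> ->].
  rewrite /combination mulmx_suml.
  under eq_bigr do rewrite mulmx_sumr.
  under eq_bigr do under eq_bigr do
    rewrite -scalemxAl -scalemxAr scalerA mulf_div (locus_structure _ _ (locusP x)) scaler_sumr.
  under [RHS]eq_bigr do rewrite rmorph_sum /= mulr_suml scaler_suml.
  rewrite [RHS]exchange_big; apply: eq_bigr => i _ /=.
  rewrite exchange_big; apply: eq_bigr => l _ /=.
  rewrite [X in _ = (X / _) *: _]rmorph_sum [X in _ = X *: _]mulr_suml scaler_suml; apply: eq_bigr => j _ /=.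
  by rewrite scalerA !mevalM mulrAC.
Qed.

Lemma represents_tau c f : represents c f ->
  represents (fun l => (-1) ^+ mxs d l * ms d (c l)) (tau_tr f).
Proof.
move=> [P [Q [nQ cP fP]]].
exists (fun l => (-1) ^+ mxs d l * tau_scal (P l)), (tau_scal Q); split.
- by rewrite evK_tau fmorph_eq0.
- have evKs (b : bool) : evK ((-1) ^+ b : {mpoly k[r]}) = (-1) ^+ b :> K.
    by rewrite /evK rmorphXn rmorphN1.
  by move=> l; rewrite evKM evKs !evK_tau -cP rmorphM mulrA.
- apply: generically_imp (generically_act tau fP) => x; rewrite /tau_tr => ->.
  have tauE (P' : {mpoly k[r]}) :
      P'.@[(tau_space (val (x : locus_space d))).2] = (tau_scal P').@[(val (x : locus_space d)).2].
    by rewrite /meval (tau_scalE (idfun : {rmorphism k -> k})).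
  rewrite /combination linear_sum; apply: eq_bigr => l _ /=.
  rewrite linearZ /= !tauE PGL_conj_one linearZ /= trmxK scalerA mevalM rmorphXn rmorphN1.
  by congr (_ *: _); rewrite mulrC mulrA.
Qed.

(** Equivariance holds at every point, since conjugation leaves the coefficients unchanged. *)
Lemma combination_equi_rational (P : 'I_N -> {mpoly k[r]}) Q : evK Q != 0 ->
  (combination P Q : X -> 'M[k]_n) \in @equi_rational k n X.
Proof.
move=> nQ; have XP := locus_space_variety d; apply/asboolP; split.
  apply: generically_imp (generically_scal nQ) => x Qx i j.
  under eq_fun do rewrite summxE; apply: (regular_at_sum XP) => l.
  under eq_fun do rewrite mxE; apply: (regular_atM XP).
    exists (scal (P l)), (scal Q); split; first by rewrite lcoords_scal.
    by move=> y _ _; rewrite !lcoords_scal.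
  have := regular_lcoords (enum_rank (inl (l, (i, j)) : coord_index n N r)) x.
  by congr regular_at; apply/funext => y; rewrite /lcoords /coords /point enum_rankK.
move=> h; apply: generically_all => x; rewrite /combination /PGL_conj mulmx_sumr mulmx_suml.
by apply: eq_bigr => l _; rewrite -scalemxAr -scalemxAl.
Qed.

Lemma exists_represents c : exists f : knfun X, represents c (val f).
Proof.
have [P [Q [nQ cP]]] := common_denominator c.
have [f fE] : exists f : knfun X, val f = combination P Q.
  by exists (exist (fun f => f \in @equi_rational k n X) _ (combination_equi_rational P nQ)).
exists f, P, Q; split=> //.
by apply: generically_all => x; rewrite fE.
Qed.

End LocusRationalMaps.

(** * Every equivariant rational map comes from the algebra *)

Section Surjectivity.
Variables (k : closedFieldType) (n : nat) (d : split_model k n).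
Local Notation r := (mr d).
Local Notation N := (n * n)%N.
Local Notation m := #|coord_index n N r|.
Local Notation K := (mK d).
Local Notation X := (locus_variety d).
Local Notation scal := (scal_poly n N).
Local Notation V := (vec_matrix (@mat_var n N r k)).
Implicit Types (p q : {mpoly k[m]}) (x : locus_space d).

(** Cramer's rule: the coefficients of [det_poly d *: F] on the generic matrices. *)
Definition matrix_coef (F : 'M[{mpoly k[m]}]_n) l : {mpoly k[m]} := (mxvec F *m \adj V) 0 l.

Lemma matrix_coefE F x :
  \sum_l (matrix_coef F l).@[lcoords x] *: (val x).1 l =
  (det_poly d).@[lcoords x] *: map_mx (meval (lcoords x)) F.
Proof.
have -> : (det_poly d).@[lcoords x] *: map_mx (meval (lcoords x)) F =
    map_mx (meval (lcoords x)) (det_poly d *: F) by rewrite map_mxZ.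
have -> : det_poly d *: F = \sum_l matrix_coef F l *: @mat_var n N r k l.
  apply: (can_inj mxvecK); rewrite linearZ /= -mul_mx_scalar -mul_adj_mx mulmxA.
  rewrite mulmx_sum_row linear_sum; apply: eq_bigr => l _.
  by rewrite linearZ rowK.
rewrite raddf_sum; apply: eq_bigr => l _ /=.
by rewrite map_mxZ -(coords_mat_var (val x) l).
Qed.

(** Regularity at a single point suffices: the space is one affine chart, so each local fraction is
    valid wherever its denominator is nonzero. *)
Lemma rational_fraction (f : X -> 'M[k]_n) : rational_map f ->
  exists (F : 'M[{mpoly k[m]}]_n) q, ~ vanishing q /\
    forall x, q.@[lcoords x] != 0 -> q.@[lcoords x] *: f x = map_mx (meval (lcoords x)) F.
Proof.
move=> /generically_locusP[q0 nq0 reg]; have [x0 /reg rx0] := not_vanishing_lcoords nq0.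
have /choice[pq hpq] (ij : 'I_n * 'I_n) : exists pq : {mpoly k[m]} * {mpoly k[m]},
    pq.2.@[lcoords x0] != 0 /\ forall x, pq.2.@[lcoords x] != 0 ->
      f x ij.1 ij.2 = pq.1.@[lcoords x] / pq.2.@[lcoords x].
  have [p [q [qx0 pqE]]] := rx0 ij.1 ij.2.
  by exists (p, q); split=> // x qx; apply: pqE.
pose F := \matrix_(i, j) ((pq (i, j)).1 * \prod_(ij | ij != (i, j)) (pq ij).2).
exists F, (\prod_ij (pq ij).2); split.
  apply: (@not_vanishing_at _ _ _ _ x0); rewrite rmorph_prod.
  by apply/prodf_neq0 => ij _; have [] := hpq ij.
move=> x; rewrite rmorph_prod => /prodf_neq0 hq.
apply/matrixP => i j; rewrite !mxE rmorphM rmorph_prod (bigD1 (i, j)) //=.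
have [_ /(_ x (hq (i, j) isT)) ->] := hpq (i, j).
rewrite [LHS]mulrC mulrA mulfVK ?hq //.
Qed.

Lemma lcoords_act (h : 'M[k]_n) (uh : h \in unitmx) x :
  lcoords (act_locus (inPGL (\pi_(PGL k n) (exist _ h uh))) x) =
  coords (conj_space h (val x)).
Proof.
rewrite /lcoords; congr coords => /=; congr pair; apply/funext => l /=.
by rewrite PGL_conjE.
Qed.

(** The coefficients of [f] on the matrix coordinates are unique, so equivariance of [f] makes them
    invariant, hence elements of [K]. *)
Lemma represents_surj (f : X -> 'M[k]_n) : f \in @equi_rational k n X ->
  exists c, represents c f.
Proof.
move=> /asboolP[/rational_fraction[F [qF [nqF fF]]] ef].
pose p l := matrix_coef F l; pose q := qF * det_poly d.
have nq : ~ vanishing q by apply: not_vanishingM => //; exact: det_not_vanishing.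
have fE x : q.@[lcoords x] != 0 ->
    q.@[lcoords x] *: f x = \sum_l (p l).@[lcoords x] *: (val x).1 l.
  rewrite rmorphM mulf_eq0 negb_or => /andP[/fF qx _].
  by rewrite matrix_coefE -qx scalerA mulrC.
have inv l h : h \in unitmx -> vanishing (conj_poly h (p l) * q - p l * conj_poly h q).
  move=> uh; pose g := \pi_(PGL k n) (exist _ h uh).
  have [qg nqg hg] := (generically_locusP _).1 (ef g).
  have nqh : ~ vanishing (conj_poly h q).
    move=> vq; apply: nq => h' uh'.
    have uh'' : invmx h *m h' \in unitmx by rewrite unitmx_mul unitmx_inv uh.
    by have := vq _ uh''; rewrite evL_conj_poly // mulKVmx.
  (* The identity holds where both denominators are nonzero and [f] is equivariant for [g];
     primality removes these factors. *)
  have : vanishing ((conj_poly h (p l) * q - p l * conj_poly h q) * (q * (conj_poly h q * qg))).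
    apply: vanishing_lcoords => x; rewrite [LHS]mevalM [X in _ * X]mevalM [X in _ * (_ * X)]mevalM.
    have [->|qx] := eqVneq (q.@[lcoords x]) 0; first by rewrite mul0r mulr0.
    have [->|qhx] := eqVneq ((conj_poly h q).@[lcoords x]) 0; first by rewrite mul0r !mulr0.
    have [->|/hg fx] := eqVneq (qg.@[lcoords x]) 0; first by rewrite !mulr0.
    pose hx := act_locus (inPGL g) x.
    have cE p' : (conj_poly h p').@[lcoords x] = p'.@[lcoords hx].
      by rewrite lcoords_act -coords_conj_poly.
    rewrite cE in qhx; have uhx : vec_matrix (val hx).1 \in unitmx.
      by move: qhx; rewrite mevalM mulf_eq0 negb_or => /andP[_]; rewrite lcoords_det -unitfE -unitmxE.
    suff : \row_l (q.@[lcoords x] * (p l).@[lcoords hx] -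
          q.@[lcoords hx] * (p l).@[lcoords x]) = 0.
      move/rowP/(_ l); rewrite !mxE => e.
      by rewrite [X in X * _]mevalB [X in (X - _) * _]mevalM [X in (_ - X) * _]mevalM /= !cE
         [X in X - _]mulrC [X in _ - X]mulrC e mul0r.
    (* Two expressions of the same multiple of [f hx] on the basis at the translated point, the
       second obtained by conjugating the one at [x]. *)
    apply: (vec_matrix_free uhx).
    under eq_bigr do rewrite mxE scalerBl -!scalerA.
    rewrite sumrB -!scaler_sumr -(fE hx qhx).
    have -> : \sum_i (p i).@[lcoords x] *: (val hx).1 i = PGL_conj g (q.@[lcoords x] *: f x).
      rewrite fE // /PGL_conj mulmx_sumr mulmx_suml; apply: eq_bigr => i _.
      by rewrite -scalemxAr -scalemxAl.
    by rewrite PGL_conjZ -fx !scalerA mulrC subrr.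
  by move=> /vanishing_prime[//|/vanishing_prime[/nq //|/vanishing_prime[/nqh //|/nqg]]].
have /choice[c hc] l := invariant_in_center nq (inv l).
have [P [Q [nQ cP]]] := common_denominator c.
exists c, P, Q; split=> //; apply/generically_locusP.
exists (q * scal Q); first by apply: not_vanishingM => //; exact: not_vanishing_scal.
move=> x; rewrite rmorphM mulf_eq0 negb_or => /andP[qx Qx].
have fx := fE x qx; rewrite /= lcoords_scal in Qx.
have -> : f x = (q.@[lcoords x])^-1 *: (q.@[lcoords x] *: f x).
  by rewrite scalerA mulVf // scale1r.
rewrite fx scaler_sumr; apply: eq_bigr => l _; rewrite scalerA; congr (_ *: _).
rewrite mulrC; apply/eqP; rewrite eqr_div // -!lcoords_scal -!rmorphM -subr_eq0 -rmorphB.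
apply/eqP/lcoords_vanishing => h uh.
by rewrite evLB [X in X - _]evLM [X in _ - X]evLM !evL_scal hc // -cP rmorphM mulrAC subrr.
Qed.

End Surjectivity.

(** * From the algebra to the variety *)

Section ModelIsomorphism.
Variables (k : closedFieldType) (n : nat) (d : split_model k n) (A : algType k).
Variables (c : {rmorphism mK d -> A}) (sigma : {linear A -> A}).
Local Notation N := (n * n)%N.
Local Notation K := (mK d).
Local Notation X := (locus_variety d).
Variables (e : 'I_N -> A) (co : A -> 'I_N -> K).
Hypothesis sigmaP : algebra_involution sigma.
Hypothesis c_comm : forall z a, GRing.comm (c z) a.
Hypothesis c_mi : forall t, c (mi d t) = t%:A.
Hypothesis c_ms : forall z, c (ms d z) = sigma (c z).
Hypothesis coP : forall a, a = \sum_i c (co a i) * e i.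
Hypothesis e_free : forall z : 'I_N -> K, \sum_i c (z i) * e i = 0 -> forall i, z i = 0.
Hypothesis e_sign : forall l, sigma (e l) = (-1) ^+ mxs d l * e l.
Hypothesis e_mul : forall i j l, co (e i * e j) l = evK (mg d i j l).

Let coE := co_uniq coP e_free.

Lemma co_linear t a b l : co (t *: a + b) l = mi d t * co a l + co b l.
Proof.
move: l; apply: coE; under eq_bigr do rewrite rmorphD rmorphM mulrDl -mulrA c_mi.
by rewrite big_split -mulr_sumr -!coP mulr_algl.
Qed.

Lemma co_mul a b l : co (a * b) l = \sum_i \sum_j co a i * co b j * evK (mg d i j l).
Proof.
move: l; apply: coE; rewrite {1}(coP a) {1}(coP b) mulr_suml.
under [RHS]eq_bigr do rewrite rmorph_sum mulr_suml.
rewrite [RHS]exchange_big; apply: eq_bigr => i _; rewrite mulr_sumr.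
under [RHS]eq_bigr do rewrite rmorph_sum mulr_suml.
rewrite [RHS]exchange_big; apply: eq_bigr => j _.
under [RHS]eq_bigr do rewrite !rmorphM -mulrA -e_mul.
rewrite -mulr_sumr -coP /= -!mulrA; congr (_ * _).
by rewrite !mulrA; congr (_ * _); exact/esym/c_comm.
Qed.

Lemma co_sigma a l : co (sigma a) l = (-1) ^+ mxs d l * ms d (co a l).
Proof.
have [_ sM _] := sigmaP; move: l; apply: coE.
rewrite {1}(coP a) linear_sum; apply: eq_bigr => l _.
rewrite sM e_sign -c_ms rmorphM rmorphXn rmorphN1 -!mulrA; congr (_ * _).
exact/esym/c_comm.
Qed.

Lemma model_isomorphism : exists phi : {linear A -> kn X},
  [/\ bijective phi, GRing.monoid_morphism phi & forall a, phi (sigma a) = sigma_tau (phi a)].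
Proof.
have /choice[F FP] (z : 'I_N -> K) : exists f : knfun X, represents z (val f).
  exact: exists_represents.
pose f a : kn X := \pi_(kn X) (F (co a)).
have fE a (g : knfun X) : represents (co a) (val g) -> f a = \pi_(kn X) g.
  by move=> rg; apply/eqP/kn_eqP; apply: represents_uniq (FP _) rg.
have eq_rep (z z' : 'I_N -> K) g : z =1 z' -> represents z g -> represents (d := d) z' g.
  by move=> /funext ->.
have f_linear t a b : f (t *: a + b) = t *: f a + f b.
  rewrite /f -[t *: \pi_(kn X) _]/(kn_scale t (\pi_(kn X) (F (co a)))) kn_scaleE kn_addrE.
  apply: (fE (t *: a + b)).
  apply: (eq_rep _ _ _ (fun l => esym (co_linear t a b l))).
  exact: represents_linear (FP _) (FP _).
have f_mul a b : f (a * b) = f a * f b.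
  rewrite -[RHS]/(kn_mul (\pi_(kn X) (F (co a))) (\pi_(kn X) (F (co b)))) kn_mulE.
  apply: (fE (a * b)).
  apply: (eq_rep _ _ _ (fun l => esym (co_mul a b l))).
  exact: represents_mul (FP _) (FP _).
have f_sigma a : f (sigma a) = sigma_tau (f a).
  apply: fE; apply: (eq_rep _ _ _ (fun l => esym (co_sigma a l))).
  apply: represents_tau; apply: eq_represents (FP (co a)).
  by apply: generically_imp (kn_repr (F (co a))) => x ->.
have f_inj : injective f.
  move=> a b /eqP/kn_eqP fab; rewrite (coP a) (coP b); apply: eq_bigr => l _.
  congr (c _ * _); apply: (represents_inj _ (FP (co b))).
  exact: eq_represents fab (FP _).
have f_surj u : exists a, f a = u.
  elim/quotW: u => g; have [z gz] := represents_surj (valP g).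
  exists (\sum_l c (z l) * e l); apply: fE; apply: eq_rep gz => l.
  by rewrite (coE (z := z)).
have f_bij : bijective f.
  have /choice[g gP] := f_surj; exists g => // a; apply: f_inj; exact: gP.
have f1 : f 1 = 1.
  (* [f] is multiplicative and onto, so its value at 1 is a unit element. *)
  have [a fa] := f_surj 1.
  by rewrite -fa -[a in RHS]mul1r f_mul fa mulr1.
have [phi phiE] : exists phi : {linear A -> kn X}, phi =1 f.
  by exists (HB.pack_for {linear A -> kn X} f (GRing.isLinear.Build _ _ _ _ f f_linear)).
have {}phiE : f = phi by apply/funext => a; rewrite phiE.
by exists phi; rewrite -phiE.
Qed.

End ModelIsomorphism.

(** * Symmetric and skew generators *)

Section SymmetricBasis.
Variables (K : fieldType) (A : nzRingType) (c : {rmorphism K -> A}) (N : nat).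
Variables (e : 'I_N -> A) (co : A -> 'I_N -> K) (sigma : {additive A -> A}).
Hypothesis two_neq0 : 2%:R != 0 :> K.
Hypothesis coP : forall a, a = \sum_i c (co a i) * e i.
Hypothesis e_free : forall z : 'I_N -> K, \sum_i c (z i) * e i = 0 -> forall i, z i = 0.
Hypothesis sigmaK : involutive sigma.

(** The elements [e i + sigma (e i)] and [e i - sigma (e i)] span, as 2 is invertible, so a basis
    can be selected among them. [sigma] is merely additive here: it may act on [K]. *)
Lemma symmetric_basis : exists (e' : 'I_N -> A) (b : 'I_N -> bool) (co' : A -> 'I_N -> K),
  [/\ forall a, a = \sum_i c (co' a i) * e' i,
      forall z : 'I_N -> K, \sum_i c (z i) * e' i = 0 -> forall i, z i = 0 &
      forall i, sigma (e' i) = (-1) ^+ b i * e' i].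
Proof.
have coE := co_uniq coP e_free.
pose g (i : 'I_(N + N)) : A :=
  match fintype.split i with inl j => e j + sigma (e j) | inr j => e j - sigma (e j) end.
pose gb (i : 'I_(N + N)) := match fintype.split i with inl _ => false | inr _ => true end.
have gs i : sigma (g i) = (-1) ^+ gb i * g i.
  rewrite /g /gb; case: fintype.split => j.
    by rewrite expr0 mul1r raddfD sigmaK addrC.
  by rewrite expr1 mulN1r raddfB sigmaK opprB.
pose M : 'M[K]_(N + N, N) := \matrix_(i, j) co (g i) j.
have full : row_full M.
  rewrite -sub1mx -(eqmx_scale _ two_neq0); apply/row_subP => i.
  have -> : row i (2%:R *: 1%:M) = row (lshift N i) M + row (rshift N i) M.
    apply/rowP => j; rewrite !mxE /g (unsplitK (inl i)) (unsplitK (inr i)).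
    rewrite -(coE (e i + sigma (e i) + (e i - sigma (e i))) (fun j => co (e i + sigma (e i)) j + co (e i - sigma (e i)) j)).
      rewrite addrACA subrr addr0; apply/esym.
      rewrite (coE _ (fun j => 2%:R * (i == j)%:R)) //.
      rewrite (bigD1 i) //= eqxx mulr1 big1 ?addr0 ?rmorph_nat ?mulr_natl ?mulr2n // => l li.
      by rewrite eq_sym (negPf li) mulr0 rmorph0 mul0r.
    under eq_bigr do rewrite rmorphD mulrDl.
    by rewrite big_split -!coP.
  by rewrite addmx_sub // row_sub.
(* An invertible selection of rows of the spanning family; [invmx B] is the change of
   coordinates. *)
pose B := rowsub (fullrankfun full) M.
have uB : B \in unitmx by exact: fullrowsub_unit.
pose e' i := g (fullrankfun full i).
have e'E (z : 'I_N -> K) : \sum_i c (z i) * e' i = \sum_j c ((\row_i z i *m B) 0 j) * e j.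
  under [RHS]eq_bigr do rewrite mxE rmorph_sum mulr_suml.
  rewrite exchange_big; apply: eq_bigr => i _ /=.
  rewrite {1}(coP (e' i)) mulr_sumr; apply: eq_bigr => j _.
  by rewrite !mxE rmorphM mulrA.
exists e', (fun i => gb (fullrankfun full i)).
exists (fun a i => (\row_j co a j *m invmx B) 0 i); split=> [a|z|i]; last exact: gs.
  rewrite e'E {1}(coP a); apply: eq_bigr => j _.
  have -> : \row_i (\row_j0 co a j0 *m invmx B) 0 i = \row_j0 co a j0 *m invmx B.
    by apply/rowP => l; rewrite mxE.
  by rewrite mulmxKV // mxE.
rewrite e'E => /e_free z0 i; have zB : \row_i z i *m B = 0.
  by apply/rowP => j; rewrite z0 mxE.
by have /rowP/(_ i) := congr1 (mulmx^~ (invmx B)) zB; rewrite mulmxK // mul0mx !mxE.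
Qed.

End SymmetricBasis.

Section ModelConstruction.
Variables (k : closedFieldType) (n : nat) (A : algType k) (sigma : {linear A -> A}).
Variables (K : fieldType) (c : {rmorphism K -> A}) (iK : {rmorphism k -> K}).
Variable sK : {rmorphism K -> K}.
Local Notation N := (n * n)%N.
Variables (e0 : 'I_N -> A) (co0 : A -> 'I_N -> K) (s : nat) (gens : 'I_s -> K).
Hypothesis char0 : [pchar k] =i pred0.
Hypothesis n_gt0 : (0 < n)%N.
Hypothesis sigmaP : algebra_involution sigma.
Hypothesis c_comm : forall z a, GRing.comm (c z) a.
Hypothesis c_center : forall a, (forall b, GRing.comm a b) -> exists z, a = c z.
Hypothesis c_iK : forall t, c (iK t) = t%:A.
Hypothesis c_sK : forall z, c (sK z) = sigma (c z).
Hypothesis A_simple : forall u : A, u != 0 ->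
  exists s : seq (A * A), \sum_(p <- s) p.1 * u * p.2 = 1.
Hypothesis co0P : forall a, a = \sum_i c (co0 a i) * e0 i.
Hypothesis e0_free : forall z : 'I_N -> K, \sum_i c (z i) * e0 i = 0 -> forall i, z i = 0.
Hypothesis gens_generate : forall F : K -> Prop, (forall t, F (iK t)) ->
  (forall x y, F x -> F y -> F (x - y)) -> (forall x y, F x -> F y -> F (x * y)) ->
  (forall x y, F x -> x * y = 1 -> F y) -> (forall j, F (gens j)) -> forall z, F z.

Let two_neq0 : 2%:R != 0 :> K.
Proof. by rewrite -(rmorph_nat iK) fmorph_eq0 (pcharf0P k).1. Qed.

Let sKK z : sK (sK z) = z.
Proof.
have [_ _ sigmaK] := sigmaP.
by apply: (fmorph_inj c); rewrite !c_sK sigmaK.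
Qed.

Let sK_iK t : sK (iK t) = iK t.
Proof.
have [s1 _ _] := sigmaP.
by apply: (fmorph_inj c); rewrite c_sK !c_iK linearZ /= s1.
Qed.

Section Basis.
Variables (e : 'I_N -> A) (b : 'I_N -> bool) (co : A -> 'I_N -> K).
Hypothesis coP : forall a, a = \sum_i c (co a i) * e i.
Hypothesis e_free : forall z : 'I_N -> K, \sum_i c (z i) * e i = 0 -> forall i, z i = 0.
Hypothesis e_sign : forall i, sigma (e i) = (-1) ^+ b i * e i.

(** The structure constants of the basis join the given generators of [K], so that they become
    polynomials in the generators. *)
Definition gen_index : finType := ('I_s + 'I_N * 'I_N * 'I_N)%type.

Definition gen_elt (j : gen_index) : K :=
  match j with inl i => gens i | inr u => co (e u.1.1 * e u.1.2) u.2 end.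

Definition sgen_index : finType := (gen_index * bool)%type.

(** Each generator is replaced by its sum and its difference with its image under [sK], which are
    symmetric and skew. *)
Definition sgen (i : 'I_#|sgen_index|) : K :=
  let u := enum_val i in gen_elt u.1 + (-1) ^+ u.2 * sK (gen_elt u.1).

Definition sgen_sign (i : 'I_#|sgen_index|) : bool := (enum_val i).2.

(* [t = ((t + sigma t) + (t - sigma t)) / 2] *)
Definition gen_poly (j : gen_index) : {mpoly k[#|sgen_index|]} :=
  2%:R^-1 *: ('X_(enum_rank ((j, false) : sgen_index)) + 'X_(enum_rank ((j, true) : sgen_index))).

Lemma gen_polyE j : mmap iK sgen (gen_poly j) = gen_elt j.
Proof.
rewrite /gen_poly mmapZ mmapD !mmapU /sgen !enum_rankK /= expr0 mul1r expr1 mulN1r.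
rewrite addrACA subrr addr0 -mulr2n -[gen_elt j *+ 2]mulr_natl mulrA fmorphV rmorph_nat.
by rewrite mulVf ?mul1r.
Qed.

Lemma sK_sgen j : sK (sgen j) = (-1) ^+ sgen_sign j * sgen j.
Proof.
rewrite /sgen /sgen_sign rmorphD rmorphM rmorphXn rmorphN1 sKK mulrDr mulrA.
by rewrite -signr_addb addbb mul1r addrC.
Qed.

(** The fractions in the new generators form a subfield that contains [k] and the old ones. *)
Lemma sgen_generate z : exists P Q : {mpoly k[#|sgen_index|]},
  mmap iK sgen Q != 0 /\ z * mmap iK sgen Q = mmap iK sgen P.
Proof.
move: z; apply: gens_generate => [t|x y|x y|x y|j].
- by exists t%:MP, 1; rewrite rmorph1 oner_neq0 mulr1 mmapC.
- move=> [P [Q [nQ xP]]] [P' [Q' [nQ' yP]]]; exists (P * Q' - P' * Q), (Q * Q').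
  rewrite rmorphB !rmorphM /= mulf_neq0 // -xP -yP; split=> //.
  by rewrite mulrBl !mulrA; congr (_ - _); rewrite mulrAC.
- move=> [P [Q [nQ xP]]] [P' [Q' [nQ' yP]]]; exists (P * P'), (Q * Q').
  by rewrite !rmorphM /= mulf_neq0 // -xP -yP mulrACA.
- move=> [P [Q [nQ xP]]] xy; exists Q, P.
  have nx : x != 0.
    by apply/eqP => x0; move/eqP: xy; rewrite x0 mul0r eq_sym oner_eq0.
  by rewrite -xP mulf_neq0 // mulrA [y * x]mulrC xy mul1r.
- exists (gen_poly (inl j)), 1.
  by rewrite gen_polyE rmorph1 oner_neq0 mulr1.
Qed.

(** Both sides are the coordinates of [sigma (e i * e j)], computed from the expansion of
    [e i * e j] and from the reversal of products. *)
Lemma structure_sign i j l :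
  (-1) ^+ b l * sK (co (e i * e j) l) = (-1) ^+ b i * (-1) ^+ b j * co (e j * e i) l.
Proof.
have [_ sM _] := sigmaP; have coE := co_uniq coP e_free.
have e1 := coE (sigma (e i * e j)) (fun l => (-1) ^+ b l * sK (co (e i * e j) l)).
have e2 := coE (sigma (e i * e j)) (fun l => (-1) ^+ b i * (-1) ^+ b j * co (e j * e i) l).
rewrite -e1 -?e2 //.
  have -> : sigma (e i * e j) = (-1) ^+ b i * (-1) ^+ b j * (e j * e i).
    rewrite sM !e_sign -[RHS]mulrA !mulr_sign.
    by case: (b i); case: (b j); rewrite ?mulrN ?mulNr ?opprK.
  rewrite {1}(coP (e j * e i)) mulr_sumr; apply: eq_bigr => l' _.
  by rewrite !rmorphM !rmorphXn !rmorphN1 !mulrA.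
rewrite {1}(coP (e i * e j)) linear_sum; apply: eq_bigr => l' _.
rewrite sM e_sign -c_sK rmorphM rmorphXn rmorphN1 -!mulrA; congr (_ * _).
exact/esym/c_comm.
Qed.

Lemma model_of_basis : exists X : gVariety (Ptau k n),
  [/\ irreducible X, pgl_generically_free X &
    exists phi : {linear A -> kn X},
      [/\ bijective phi, GRing.monoid_morphism phi &
          forall a, phi (sigma a) = sigma_tau (phi a)]].
Proof.
have [r [L [kap [Phi [rN rP fr]]]]] := splitting_field c_comm c_center A_simple coP e_free.
(* The degree of the splitting is determined by the dimension over the center. *)
have rn : r = n by apply/eqP; rewrite -(@eqn_exp2r r n 2) // -!mulnn rN.
subst r.
have mulE i j : Phi (e i) *m Phi (e j) =
    \sum_l kap (mmap iK sgen (gen_poly (inr (i, j, l)))) *: Phi (e l).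
  have [_ PM _ _] := rP; rewrite -PM (representation_basis coP _ rP).
  by apply: eq_bigr => l _; rewrite gen_polyE.
have signE i j l : (-1) ^+ b l * sK (mmap iK sgen (gen_poly (inr (i, j, l)))) =
    (-1) ^+ b i * (-1) ^+ b j * mmap iK sgen (gen_poly (inr (j, i, l))).
  by rewrite !gen_polyE structure_sign.
have unitE : vec_matrix (fun i => Phi (e i)) \in unitmx by rewrite -row_free_unit.
pose d : split_model k n := SplitModel n_gt0 char0 sK_iK sK_sgen mulE unitE signE sgen_generate.
exists (locus_variety d); split.
- exact: locus_irreducible.
- exact: locus_generically_free.
apply: (@model_isomorphism k n d A c sigma e co) => //.
by move=> i j l; rewrite /evK /= gen_polyE.
Qed.

End Basis.

Lemma involution_model : exists X : gVariety (Ptau k n),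
  [/\ irreducible X, pgl_generically_free X &
    exists phi : {linear A -> kn X},
      [/\ bijective phi, GRing.monoid_morphism phi &
          forall a, phi (sigma a) = sigma_tau (phi a)]].
Proof.
have [_ _ sigmaK] := sigmaP.
have [e [b [co [coP e_free e_sign]]]] := symmetric_basis two_neq0 co0P e0_free sigmaK.
exact: model_of_basis coP e_free e_sign.
Qed.

End ModelConstruction.

(** * The center of a simple algebra as a field *)

Section CenterField.
Variables (k : closedFieldType) (A : algType k) (A_simple : simple_algebra A).

Definition center_pred : {pred A} := fun a => `[< center a >].

Lemma centerP a : reflect (center a) (a \in center_pred).
Proof. exact: asboolP. Qed.

Fact center_subring : subring_closed center_pred.
Proof.
split=> [|x y /centerP cx /centerP cy|x y /centerP cx /centerP cy]; apply/centerP => a.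
- exact/commr_sym/commr1.
- by apply/commr_sym/commrB; apply/commr_sym; [exact: cx | exact: cy].
- by apply/commr_sym/commrM; apply/commr_sym; [exact: cx | exact: cy].
Qed.

HB.instance Definition _ := GRing.isSubringClosed.Build _ center_pred center_subring.

Definition center_field : Type := {a : A | a \in center_pred}.
HB.instance Definition _ := SubChoice.copy center_field {a : A | a \in center_pred}.
HB.instance Definition _ :=
  GRing.SubChoice_isSubNzRing.Build _ _ center_field (GRing.subringClosedP _).

Fact center_field_mulC : commutative (@GRing.mul center_field).
Proof. by move=> x y; apply: val_inj; have /centerP/(_ (val y)) := valP x. Qed.

HB.instance Definition _ :=
  GRing.PzRing_hasCommutativeMul.Build center_field center_field_mulC.

(** The sums [\sum p.1 * u * p.2] form a two-sided ideal containing [u]. *)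
Lemma simple_generate (u : A) : u != 0 ->
  exists s : seq (A * A), \sum_(p <- s) p.1 * u * p.2 = 1.
Proof.
move=> nu; pose I := [set a : A | exists s : seq (A * A), \sum_(p <- s) p.1 * u * p.2 = a].
have idI : two_sided_ideal I.
  split.
  - by exists [::]; rewrite big_nil.
  - by move=> x y [s <-] [t <-]; exists (s ++ t); rewrite big_cat.
  - move=> a x b [s <-]; exists [seq (a * p.1, p.2 * b) | p <- s].
    rewrite big_map mulr_sumr mulr_suml; apply: eq_bigr => p _ /=.
    by rewrite !mulrA.
have uI : I u by exists [:: (1, 1)]; rewrite big_seq1 mul1r mulr1.
have [I0|IT] := A_simple idI; last by have : I 1 by rewrite IT.
by move: uI; rewrite I0 => u0; rewrite u0 eqxx in nu.
Qed.

Lemma center_inverse (z : center_field) : z != 0 -> exists y : center_field, y * z = 1.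
Proof.
move=> nz; have cz : center (val z) by exact/centerP/(valP z).
have [s hs] : exists s : seq (A * A), \sum_(p <- s) p.1 * val z * p.2 = 1.
  apply: simple_generate; apply: contra nz => /eqP z0; apply/eqP/val_inj.
  by rewrite z0.
(* [val z] is central, so it can be moved out of the sum that equals 1. *)
pose y := \sum_(p <- s) p.1 * p.2.
have yz : y * val z = 1.
  rewrite -hs mulr_suml; apply: eq_bigr => p _.
  by rewrite -!mulrA; congr (_ * _); exact/esym/cz.
have zy : val z * y = 1 by rewrite cz.
have cy : y \in center_pred.
  apply/centerP => a; rewrite /GRing.comm -[RHS]mul1r -yz -mulrA; congr (y * _).
  by rewrite mulrA cz -mulrA zy mulr1.
by exists (exist _ y cy); apply: val_inj.
Qed.

Definition center_inv (z : center_field) : center_field :=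
  if pselect (exists y : center_field, y * z = 1) is left ex then projT1 (cid ex) else 0.

Fact center_mulVf (z : center_field) : z != 0 -> center_inv z * z = 1.
Proof.
move=> /center_inverse ex; rewrite /center_inv; case: pselect => // ex'.
exact: (projT2 (cid ex')).
Qed.

Fact center_inv0 : center_inv 0 = 0.
Proof.
rewrite /center_inv; case: pselect => // ex; exfalso; case: ex => y.
by rewrite mulr0 => /eqP; rewrite eq_sym oner_eq0.
Qed.

Definition center_fieldType : fieldType :=
  HB.pack_for fieldType center_field
    (GRing.ComNzRing_isField.Build center_field center_mulVf center_inv0).

End CenterField.

Theorem proposition2p3 (k : closedFieldType) (char0 : [pchar k] =i pred0)
    (n : nat) (n_ge2 : (2 <= n)%N)
    (A : algType k) (csaA : central_simple_of_degree A n)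
    (sigma : {linear A -> A}) (sigmaP : algebra_involution sigma) :
  exists X : gVariety (Ptau k n),
    [/\ irreducible X, pgl_generically_free X &
      exists phi : {linear A -> kn X},
        [/\ bijective phi, GRing.monoid_morphism phi &
            forall a, phi (sigma a) = sigma_tau (phi a)]].
Proof.
have [A_simple [s [s_center s_gen]] [e eP]] := csaA.
have [s1 sM sigmaK] := sigmaP.
pose K := center_fieldType A_simple.
have mkK (a : A) : center a -> {z : K | val (z : center_field A) = a}.
  by move=> ca; exists (exist _ a (asboolT ca)).
pose c0 (z : K) : A := val (z : center_field A).
have [c cE] : exists c : {rmorphism K -> A}, c =1 c0.
  have cB : {morph c0 : x y / x - y} by [].
  have cM : GRing.monoid_morphism c0 by [].
  exists (HB.pack_for {rmorphism K -> A} c0 (GRing.isZmodMorphism.Build _ _ c0 cB)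
    (GRing.isMonoidMorphism.Build _ _ c0 cM)) => //.
have c_comm z a : GRing.comm (c z) a.
  by rewrite cE; have /centerP := valP (z : center_field A); exact.
have c_onto a : center a -> exists z, a = c z.
  by move=> /mkK[z za]; exists z; rewrite cE.
have c_inj : injective c by exact: fmorph_inj.
have alg_center (t : k) : center (t%:A : A).
  by move=> a; rewrite /GRing.comm mulr_algl mulr_algr.
have sig_center a : center a -> center (sigma a).
  by move=> ca b; rewrite /GRing.comm -[b]sigmaK -!sM ca.
have [iK iKE] : exists iK : {rmorphism k -> K}, forall t, c (iK t) = t%:A.
  have /choice[i iE] (t : k) : exists z, t%:A = c z by exact/c_onto.
  have iB : {morph i : x y / x - y}.
    by move=> x y; apply: c_inj; rewrite rmorphB -!iE scalerBl.
  have iM : GRing.monoid_morphism i.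
    split; first by apply: c_inj; rewrite rmorph1 -iE scale1r.
    by move=> x y; apply: c_inj; rewrite rmorphM -!iE mulr_algl scalerA.
  exists (HB.pack_for {rmorphism k -> K} i (GRing.isZmodMorphism.Build _ _ i iB)
    (GRing.isMonoidMorphism.Build _ _ i iM)) => //.
have [sK sKE] : exists sK : {rmorphism K -> K}, forall z, c (sK z) = sigma (c z).
  have /choice[i iE] (z : K) : exists z', sigma (c z) = c z'.
    by apply/c_onto/sig_center => a; exact: c_comm.
  have iB : {morph i : x y / x - y}.
    by move=> x y; apply: c_inj; rewrite rmorphB -!iE rmorphB linearB.
  have iM : GRing.monoid_morphism i.
    split; first by apply: c_inj; rewrite -iE !rmorph1.
    by move=> x y; apply: c_inj; rewrite rmorphM -iE rmorphM sM !iE c_comm.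
  exists (HB.pack_for {rmorphism K -> K} i (GRing.isZmodMorphism.Build _ _ i iB)
    (GRing.isMonoidMorphism.Build _ _ i iM)) => //.
(* The index types over [n ^ 2] and [n * n] are convertible. *)
have /choice[co coP] (a : A) : exists co : 'I_(n * n) -> K, a = \sum_i c (co i) * e i.
  have [z [[zc az] _]] := eP a.
  have /choice[z' zE] i : exists z', z i = c z' by exact/c_onto/zc.
  by exists z'; rewrite az; apply: eq_bigr => i _; rewrite zE.
have e_free (z : 'I_(n * n) -> K) : \sum_i c (z i) * e i = 0 -> forall i, z i = 0.
  (* Independence is the uniqueness of the coordinates of 0. *)
  move=> z0 i; have [w [_ wU]] := eP 0; apply: c_inj; rewrite rmorph0.
  have e1 : w = fun i => c (z i) by apply: wU; split=> // j a; exact: c_comm.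
  have e2 : w = fun=> 0.
    apply: wU; split=> [j a|]; first exact/commr_sym/commr0.
    by rewrite big1 // => j _; rewrite mul0r.
  exact: (congr1 (@^~ i) (etrans (esym e1) e2)).
have /choice[gens gensE] (j : 'I_(size s)) : exists z, s`_j = c z.
  by apply/c_onto/s_center; rewrite mem_nth.
apply: (involution_model (c := c) (iK := iK) (sK := sK) (co0 := co) (gens := gens)) => //.
- by rewrite (leq_trans _ n_ge2).
- exact: simple_generate.
move=> F Fk FB FM FV Fg z.
(* The image of [F] in [A] is a central subextension containing the generators, so it contains the
   center. *)
suff [z' Fz' /c_inj -> //] : [set a | exists2 z, F z & a = c z] (c z).
apply: s_gen; last by move=> a; exact: c_comm.
  split.
  - by move=> _ [z' _ ->] a; exact: c_comm.
  - by move=> t; exists (iK t).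
  - by move=> _ _ [x Fx ->] [y Fy ->]; exists (x - y); [exact: FB | rewrite rmorphB].
  - by move=> _ _ [x Fx ->] [y Fy ->]; exists (x * y); [exact: FM | rewrite rmorphM].
  - move=> _ b [x Fx ->] xb; have [y by_] : exists y, b = c y.
      apply: c_onto => a; have bx : b * c x = 1 by rewrite -[RHS]xb c_comm.
      by rewrite /GRing.comm -[RHS]mul1r -bx -mulrA (mulrA (c x)) c_comm -mulrA xb mulr1.
    exists y => //; apply: (FV x) => //; apply: c_inj.
    by rewrite rmorphM -by_ xb rmorph1.
move=> a /(nthP 0)[j js <-]; rewrite (gensE (Ordinal js)).
by exists (gens (Ordinal js)).
Qed.
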